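(* Let $n\ge 3$, let $\psi\in L^{\infty}(\mathbb{B}^n,\mathbb{R}^n)$ and $\phi\in L^{\infty}(\mathbb{S}^{n-1},\mathbb{R}^n)$, and suppose that $u\in C^2(\mathbb{B}^n,\mathbb{R}^n)\cap C(\overline{\mathbb{B}^n},\mathbb{R}^n)$ satisfies $$\Delta_h u(x)=\psi(x)\ \text{ for } x\in\mathbb{B}^n,\qquad u(\xi)=\phi(\xi)\ \text{ for }\xi\in\mathbb{S}^{n-1}.$$ Suppose moreover that $$\int_{\mathbb{B}^n}(1-|x|^2)^{n-1}|\psi(x)|\,d\tau(x)\le \mu_1,$$ where $\mu_1\ge 0$ is a constant. Then $$u=P_h[\phi]-G_h[\psi]\quad\text{in }\mathbb{B}^n.$$
   Context: $\mathbb{B}^n$ is the open unit ball of $\mathbb{R}^n$ and $\mathbb{S}^{n-1}$ its boundary. The hyperbolic Laplace operator is $$\Delta_h u(x)=(1-|x|^2)^2\Delta u(x)+2(n-2)(1-|x|^2)\sum_{i=1}^n x_i\frac{\partial u}{\partial x_i}(x)$$ (applied componentwise to vector-valued $u$). $\sigma$ is the $(n-1)$-dimensional Lebesgue (surface) measure on $\mathbb{S}^{n-1}$ normalized by $\sigma(\mathbb{S}^{n-1})=1$; $\nu$ is $n$-dimensional Lebesgue measure normalized by $\nu(\mathbb{B}^n)=1$; and $d\tau(x)=(1-|x|^2)^{-n}\,d\nu(x)$. Poisson integral: $P_h(x,\xi)=\left(\frac{1-|x|^2}{|\xi-x|^2}\right)^{n-1}$ for $(x,\xi)\in\mathbb{B}^n\times\mathbb{S}^{n-1}$,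 and $P_h[\phi](x)=\int_{\mathbb{S}^{n-1}}P_h(x,\xi)\phi(\xi)\,d\sigma(\xi)$ for $\phi\in L^1(\mathbb{S}^{n-1},\mathbb{R}^n)$. Green integral: for $x,y\in\mathbb{B}^n$ let $[x,y]\ge 0$ be given by $[x,y]^2=|x-y|^2+(1-|x|^2)(1-|y|^2)$, and let $|\varphi_x(y)|=\frac{|x-y|}{[x,y]}$ (this is the modulus of the Möbius involution $\varphi_x$ of $\mathbb{B}^n$ interchanging $0$ and $x$). The Green function is $G_h(x,y)=\frac1n\int_{|\varphi_x(y)|}^1\frac{(1-s^2)^{n-2}}{s^{n-1}}\,ds$ for $x\ne y$. For $n\ge 3$, $\psi\in C(\mathbb{B}^n,\mathbb{R}^n)$ with $\int_{\mathbb{B}^n}(1-|x|^2)^{n-1}|\psi(x)|\,d\tau(x)<\infty$, $G_h[\psi](x)=\int_{\mathbb{B}^n}G_h(x,y)\psi(y)\,d\tau(y)$. *)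

(* Defs.v *)
From HB Require Import structures.
From mathcomp Require Import all_boot all_order all_algebra.
From mathcomp Require Import all_classical all_reals all_analysis.
From mathcomp Require Import measurable_realfun.

Set Implicit Arguments.
Unset Strict Implicit.
Unset Printing Implicit Defensive.

Import Order.TTheory GRing.Theory Num.Theory.
Import numFieldNormedType.Exports.

Local Open Scope classical_set_scope.
Local Open Scope ring_scope.

(* R^n is 'rV[R]_n. The norm `|x| that the library puts on it is the sup norm;
   it has the Euclidean topology but is not the Euclidean norm. *)
Definition enorm (R : realType) (n : nat) (x : 'rV[R]_n) : R :=
  Num.sqrt (\sum_(i < n) x ord0 i ^+ 2).

Definition uball (R : realType) (n : nat) : set 'rV[R]_n :=
  [set x | enorm x < 1].

Definition usphere (R : realType) (n : nat) : set 'rV[R]_n :=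
  [set x | enorm x = 1].

Arguments uball {R n}.
Arguments usphere {R n}.

(* The Borel sigma-algebra of R^n, generated by the coordinate functions. *)
Definition rV_display : measure_display -> measure_display.
Proof. exact. Qed.

Section measurable_rV.
Context {d} {T : sigmaRingType d} {n : nat}.

Let coor : 'I_n -> 'rV[T]_n -> T := fun i x => x ord0 i.

Let rV_set0 : g_sigma_preimage coor set0.
Proof. exact: sigma_algebra0. Qed.

Let rV_setC A : g_sigma_preimage coor A -> g_sigma_preimage coor (~` A).
Proof. exact: sigma_algebraC. Qed.

Let rV_bigcup (F : _^nat) : (forall i, g_sigma_preimage coor (F i)) ->
  g_sigma_preimage coor (\bigcup_i (F i)).
Proof. exact: sigma_algebra_bigcup. Qed.

HB.instance Definition _ := @isMeasurable.Build (rV_display d)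
  'rV[T]_n (g_sigma_preimage coor) rV_set0 rV_setC rV_bigcup.

Lemma measurable_coor (i : 'I_n) :
  measurable_fun [set: 'rV[T]_n] (fun x : 'rV[T]_n => x ord0 i).
Proof.
move=> _ Y mY; rewrite setTI; apply: sub_sigma_algebra => /=.
rewrite -bigcup_seq/=; exists i => /=; first by rewrite mem_index_enum.
by exists Y => //; rewrite setTI.
Qed.

End measurable_rV.

Lemma measurable_fun_coorP d1 d2 (T1 : measurableType d1)
    (T2 : measurableType d2) n (f : T1 -> 'rV[T2]_n) :
  (forall i, measurable_fun [set: T1] (fun x => f x ord0 i)) ->
  measurable_fun [set: T1] f.
Proof.
move=> mf _ A mA; rewrite setTI.
pose G := [set B : set 'rV[T2]_n | measurable (f @^-1` B)].
suff : measurable `<=` G by apply.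
apply: smallest_sub.
  split => [|B|F mF]; rewrite /G/=.
  - by rewrite preimage_set0.
  - by rewrite setTD -preimage_setC; exact: measurableC.
  - by rewrite preimage_bigcup; apply: bigcupT_measurable => k; exact: mF.
rewrite -bigcup_seq => B/= [i _ [C mC <-]].
rewrite /G/= setTI -comp_preimage.
by rewrite -[X in measurable X]setTI; exact: mf.
Qed.

(* n-dimensional Lebesgue measure: iterated product of the one-dimensional one,
   transported along R x R^n = R^(n+1). *)
Section leb.
Context {R : realType}.

Definition cons_rV (n : nat) (p : R * 'rV[R]_n) : 'rV[R]_n.+1 :=
  \row_(i < n.+1) oapp (fun j => p.2 ord0 j) p.1 (unlift ord0 i).

Definition uncons_rV (n : nat) (x : 'rV[R]_n.+1) : R * 'rV[R]_n :=
  (x ord0 ord0, \row_(j < n) x ord0 (lift ord0 j)).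

Lemma cons_rVK n : cancel (@cons_rV n) (@uncons_rV n).
Proof.
move=> [a x]; rewrite /uncons_rV /cons_rV mxE unlift_none/=; congr pair.
by apply/rowP => j; rewrite !mxE liftK.
Qed.

Lemma uncons_rVK n : cancel (@uncons_rV n) (@cons_rV n).
Proof.
move=> x; apply/rowP => i; rewrite mxE.
by case: unliftP => [j ->|->]/=; rewrite ?mxE.
Qed.

Lemma measurable_cons_rV n : measurable_fun setT (@cons_rV n).
Proof.
apply: measurable_fun_coorP => i.
case: (unliftP ord0 i) => [j ->|->].
  rewrite (_ : (fun _ => _) = (fun x : 'rV[R]_n => x ord0 j) \o snd).
    by apply: measurableT_comp => //; exact: measurable_coor.
  by apply/funext => p; rewrite mxE liftK.
rewrite (_ : (fun _ => _) = fst) //.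
by apply/funext => p; rewrite mxE unlift_none.
Qed.

Lemma measurable_uncons_rV n : measurable_fun setT (@uncons_rV n).
Proof.
apply/measurable_fun_pair; first exact: measurable_coor.
apply: measurable_fun_coorP => i.
rewrite (_ : (fun _ => _) = (fun x : 'rV[R]_n.+1 => x ord0 (lift ord0 i))).
  exact: measurable_coor.
by apply/funext => p; rewrite mxE.
Qed.

Section step.
Variables (n : nat) (mu : {sigma_finite_measure set 'rV[R]_n -> \bar R}).

Definition leb_step : set 'rV[R]_n.+1 -> \bar R :=
  pushforward (lebesgue_measure \x mu)%E (@cons_rV n).

Let step0 : leb_step set0 = 0%E.
Proof. by rewrite /leb_step /pushforward preimage_set0 measure0. Qed.

Let step_ge0 A : (0 <= leb_step A)%E.
Proof. by rewrite /leb_step /pushforward; exact: measure_ge0. Qed.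

Let step_sigma_additive : semi_sigma_additive leb_step.
Proof.
pose m := @cons_rV n.
have mm : measurable_fun setT m by exact: measurable_cons_rV.
have mpre A : measurable A -> measurable (m @^-1` A).
  by move=> mA; rewrite -[X in measurable X]setTI; exact: mm.
move=> F mF tF mUF; rewrite /leb_step /pushforward preimage_bigcup.
apply: measure_semi_sigma_additive.
- by move=> k; exact: mpre.
- apply/trivIsetP => /= i j _ _ ij; rewrite -preimage_setI.
  by move/trivIsetP : tF => /(_ _ _ _ _ ij) ->//; rewrite preimage_set0.
- by rewrite -preimage_bigcup; exact: mpre.
Qed.

HB.instance Definition _ := isMeasure.Build _ _ _ leb_step
  step0 step_ge0 step_sigma_additive.

Let step_sigma_finite : sigma_finite setT leb_step.
Proof.
have /sigma_finiteP[F [TF ndF Foo]] := sigma_finiteT (@lebesgue_measure R).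
have /sigma_finiteP[G [TG ndG Goo]] := sigma_finiteT mu.
exists (fun k => @uncons_rV n @^-1` (F k `*` G k)).
  rewrite -preimage_bigcup (_ : \bigcup_k _ = setT) ?preimage_setT//.
  apply/seteqP; split => // -[x y] _.
  have [i _ Fx] : (\bigcup_k F k) x by rewrite -TF.
  have [j _ Gy] : (\bigcup_k G k) y by rewrite -TG.
  exists (maxn i j) => //; split => /=.
    by move: x Fx; exact/subsetPset/ndF/leq_maxl.
  by move: y Gy; exact/subsetPset/ndG/leq_maxr.
move=> k; have [mF Fk] := Foo k; have [mG Gk] := Goo k; split.
  rewrite -[X in measurable X]setTI; apply: measurable_uncons_rV => //.
  exact: measurableX.
rewrite /leb_step /pushforward -comp_preimage.
rewrite (_ : _ \o _ = id); last by apply/funext => p /=; rewrite cons_rVK.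
by rewrite preimage_id product_measure1E// lte_mul_pinfty// ge0_fin_numE.
Qed.

HB.instance Definition _ := @Measure_isSigmaFinite.Build _ _ _ leb_step
  step_sigma_finite.

End step.

Fixpoint leb (n : nat) : {sigma_finite_measure set 'rV[R]_n -> \bar R} :=
  if n is m.+1 then leb_step (leb m) else dirac (0 : 'rV[R]_0).

End leb.

Section sphere_measure.
Context {R : realType} {n : nat}.

Lemma measurable_enorm : measurable_fun setT (@enorm R n).
Proof.
rewrite (_ : @enorm R n = (@powR R)^~ 2^-1 \o
    (fun x : 'rV[R]_n => \sum_(i < n) x ord0 i ^+ 2)).
  apply: measurableT_comp; first exact: measurable_powR.
  apply: measurable_sum => i.
  by apply: measurable_funX; exact: measurable_coor.
apply/funext => x /=; rewrite powR12_sqrt// sumr_ge0// => i _.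
exact: sqr_ge0.
Qed.

Lemma measurable_uball : measurable (@uball R n).
Proof.
rewrite (_ : uball = @enorm R n @^-1` `]-oo, 1[).
  by rewrite -[X in measurable X]setTI; exact: measurable_enorm.
by apply/seteqP; split => x; rewrite /uball/= in_itv.
Qed.

Lemma inv_leb_uball_ge0 : 0 <= (fine (leb n (@uball R n)))^-1.
Proof. by rewrite invr_ge0 fine_ge0. Qed.

(* Normalization: nu(uball) = 1. *)
Definition nu : set 'rV[R]_n -> \bar R :=
  mscale (NngNum inv_leb_uball_ge0) (leb n).

HB.instance Definition _ := Measure.on nu.

Definition radial (x : 'rV[R]_n) : 'rV[R]_n := (enorm x)^-1 *: x.

Lemma measurable_radial : measurable_fun setT radial.
Proof.
apply: measurable_fun_coorP => i.
rewrite (_ : (fun _ => _) =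
  (((@powR R)^~ (- 1)) \o @enorm R n) \* (fun x => x ord0 i)).
  apply: measurable_funM; last exact: measurable_coor.
  by apply: measurableT_comp; [exact: measurable_powR|exact: measurable_enorm].
by apply/funext => x; rewrite mxE/= powR_inv1// sqrtr_ge0.
Qed.

(* Normalized surface measure. In polar coordinates x = r xi the (normalized)
   Lebesgue measure of the ball is n r^(n-1) dr dsigma(xi), so the measure of
   a Borel set A of directions is the nu-measure of the cone
   { r xi | 0 < r < 1, xi in A } over it. *)
Definition sigma : set 'rV[R]_n -> \bar R :=
  pushforward (mrestr nu measurable_uball) radial.

Let measurable_preimage_radial A : measurable A -> measurable (radial @^-1` A).
Proof.
by move=> mA; rewrite -[X in measurable X]setTI; exact: measurable_radial.
Qed.

Let sigma0 : sigma set0 = 0%E.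
Proof. by rewrite /sigma /pushforward preimage_set0 measure0. Qed.

Let sigma_ge0 A : (0 <= sigma A)%E.
Proof. by rewrite /sigma /pushforward; exact: measure_ge0. Qed.

Let sigma_sigma_additive : semi_sigma_additive sigma.
Proof.
move=> F mF tF mUF; rewrite /sigma /pushforward preimage_bigcup.
apply: measure_semi_sigma_additive.
- by move=> k; exact: measurable_preimage_radial.
- apply/trivIsetP => /= i j _ _ ij; rewrite -preimage_setI.
  by move/trivIsetP : tF => /(_ _ _ _ _ ij) ->//; rewrite preimage_set0.
- by rewrite -preimage_bigcup; exact: measurable_preimage_radial.
Qed.

HB.instance Definition _ := isMeasure.Build _ _ _ sigma
  sigma0 sigma_ge0 sigma_sigma_additive.

End sphere_measure.

Section function_spaces.
Context {R : realType} {n : nat}.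
Local Notation E := 'rV[R]_n.

Definition Linfty (mu : {measure set E -> \bar R}) (D : set E) (f : E -> E) :=
  (forall i : 'I_n, measurable_fun D (fun x => f x ord0 i)) /\
  ('N[mu]_+oo[(fun x => (enorm (f x))%:E) \_ D] < +oo)%E.

Definition partial (i : 'I_n) (f : E -> E) : E -> E :=
  'D_(delta_mx ord0 i) f.

Fixpoint Ck (k : nat) (D : set E) (f : E -> E) : Prop :=
  (forall x, D x -> {for x, continuous f}) /\
  if k is l.+1 then
    forall i : 'I_n,
      (forall x, D x -> derivable f x (delta_mx ord0 i)) /\
      Ck l D (partial i f)
  else True.

Definition laplacian (u : E -> E) (x : E) : E :=
  \sum_(i < n) partial i (partial i u) x.

Definition hyp_laplacian (u : E -> E) (x : E) : E :=
  (1 - enorm x ^+ 2) ^+ 2 *: laplacian u x +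
  (2 * (n%:R - 2) * (1 - enorm x ^+ 2)) *:
    \sum_(i < n) x ord0 i *: partial i u x.

End function_spaces.

Section integrals.
Context {R : realType} {n : nat}.
Local Notation E := 'rV[R]_n.

(* Density of tau with respect to nu. *)
Definition tau_density (x : E) : R := (1 - enorm x ^+ 2) ^- n.

Definition poisson_kernel (x xi : E) : R :=
  ((1 - enorm x ^+ 2) / enorm (xi - x) ^+ 2) ^+ n.-1.

Definition poisson_integral (phi : E -> E) (x : E) : E :=
  \row_(i < n) \int[sigma]_(xi in usphere)
    (poisson_kernel x xi * phi xi ord0 i).

Definition bracket (x y : E) : R :=
  Num.sqrt (enorm (x - y) ^+ 2 + (1 - enorm x ^+ 2) * (1 - enorm y ^+ 2)).

Definition moebius_modulus (x y : E) : R := enorm (x - y) / bracket x y.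

(* Off the diagonal only: for x = y the integral is infinite and the
   real-valued integral returns a junk value. *)
Definition green_kernel (x y : E) : R :=
  n%:R^-1 * \int[lebesgue_measure]_(s in `[moebius_modulus x y, 1])
    ((1 - s ^+ 2) ^+ (n - 2) / s ^+ n.-1).

Definition green_integral (psi : E -> E) (x : E) : E :=
  \row_(i < n) \int[nu]_(y in uball)
    (green_kernel x y * psi y ord0 i * tau_density y).

End integrals.

(* Main.v *)
From HB Require Import structures.
Require Import Defs.
From mathcomp Require Import all_boot all_order all_algebra.
From mathcomp Require Import all_classical all_reals all_analysis.
From mathcomp Require Import measurable_realfun.
From mathcomp Require Import ring lra.

(** Fix x and let s = |phi_x(y)|^2.  For a function F of one variable, the
    hyperbolic Laplacian of y |-> F(s) is an expression in s, F'(s) and F''(s)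
    only ([hlap_comp]), and it vanishes when F' is the density - [gam] whose
    integral over [s, 1] is the Green function ([green_kernelE]).  Multiplying
    [gam] by a cutoff eta that vanishes near s = 0 and near s = 1 gives a
    profile [rad] that is smooth and compactly supported in the ball, with
      Delta_h (rad (s)) = - (2/n) s^((2-n)/2) (1 - s)^n eta'(s)   ([rad_lap]).
    The second Green identity then holds without boundary terms
    ([green_identity], from Fubini and the one-dimensional fundamental theorem)
    and yields, for every C^2 function u in the ball,
      int rad (s) Delta_h u dtau
        = - (2/n) int u s^((2-n)/2) (1 - s)^n eta'(s) dtau   ([test_identity]).

    Now let eta tend to 1 on ]0, 1[.  The left-hand side tends to
    G_h[Delta_h u](x) by dominated convergence ([green_limit]): near x the
    Green function is bounded by s^((2-n)/2), which is integrable
    ([sp_integrable]), and near the sphere it is bounded by a multiple of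
    (1 - |y|^2)^(n-1), the weight of the hypothesis on psi.  On the right, eta'
    has a positive part near s = 0 and a negative part near s = 1.  In polar
    coordinates, after rescaling 1 - |y|, the latter tends to P_h[u](x)
    ([outer_limit]).  The former concentrates at x ([inner_concentration]), with
    a total mass c(x) found by taking u = 1: the left-hand side is then 0 and
    both parts have the same mass, so c(x) = P_h[1](x) ([inner_mass]).  Hence
      c(x) u(x) = P_h[u](x) - G_h[Delta_h u](x)   ([representation]).

    That c(x) = 1 follows from the same formula, without a change of variables
    by phi_x.  It is clear for x = 0, where the Poisson kernel is constant.  For
    x <> 0, take for u the Green function with pole 0, truncated near 0.  It
    vanishes on the sphere and Delta_h u concentrates at 0 with mass - c(0), so
    that in the limit c(x) G_h(0, x) = c(0) G_h(x, 0) ([poisson_mass_eq1]).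
    The theorem is the representation formula for each component of u. *)

Set Implicit Arguments.
Unset Strict Implicit.
Unset Printing Implicit Defensive.

Import Order.TTheory GRing.Theory Num.Theory.
Import numFieldNormedType.Exports.

Local Open Scope classical_set_scope.
Local Open Scope ring_scope.

#[local] Arguments leb : simpl never.

(** * Borel sets of R^n *)

Section topology_rV.
Context {R : realType} {n : nat}.
Local Notation E := 'rV[R]_n.

Lemma measurable_ball_rV (x : E) (e : R) : measurable (ball x e : set E).
Proof.
have [e0|e0] := ltP 0 e; last first.
  by rewrite (_ : ball x e = set0)//; apply/seteqP; split => // y [] /lt_geF; rewrite e0.
rewrite (_ : ball x e =
    \bigcap_(i in [set: 'I_n]) ((fun y : E => y ord0 i) @^-1` (ball (x ord0 i) e))).
  apply: fin_bigcap_measurable => // i _.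
  rewrite -[X in measurable X]setTI; apply: measurable_coor => //.
  exact: measurable_ball.
apply/seteqP; split => y; first by case=> _ h i _ /=; exact: h.
by move=> h; split => // i j; rewrite ord1; exact: h.
Qed.

(** An open set is the union of the balls of rational centre and radius 1/(k+1)
    that it contains; balls of the sup norm are boxes, hence in the product
    sigma-algebra. *)
Lemma open_measurable_rV (U : set E) : open U -> measurable U.
Proof.
move=> oU.
pose c (q : 'rV[rat]_n) : E := \row_i ratr (q ord0 i).
pose D := [set p : 'rV[rat]_n * nat | ball (c p.1) p.2.+1%:R^-1 `<=` U].
rewrite (_ : U = \bigcup_(p in D) ball (c p.1) p.2.+1%:R^-1).
  rewrite (_ : \bigcup_(p in D) _ = \bigcup_k
      if unpickle k is Some p then if p \in D then ball (c p.1) p.2.+1%:R^-1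
      else set0 else set0).
    apply: bigcupT_measurable => k; case: unpickle => // p.
    by case: ifPn => // _; exact: measurable_ball_rV.
  apply/seteqP; split => [x [p pD px]|x [k _]].
    by exists (pickle p) => //; rewrite pickleK mem_set.
  by case: unpickle => // p; case: ifPn => // /[!inE] pD px; exists p.
apply/seteqP; split => [x Ux|x [p pD]]; last exact: pD.
have /nbhs_ballP[e /= e0 eU] := open_nbhs_nbhs (conj oU Ux).
have [k ke] : exists k : nat, k.+1%:R^-1 < e / 2 :> R.
  have e20 : 0 < e / 2 by rewrite divr_gt0.
  exists (Num.trunc (e / 2)^-1).
  by rewrite invf_plt ?posrE// truncnS_gt.
have k0 : 0 < k.+1%:R^-1 :> R by rewrite invr_gt0 ltr0n.
have qP i : exists q : rat, ball (x ord0 i) k.+1%:R^-1 (ratr q : R).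
  have /rat_in_itvoo[q] : x ord0 i - k.+1%:R^-1 < x ord0 i + k.+1%:R^-1.
    by rewrite ltrD2l (lt_trans _ k0)// oppr_lt0.
  by rewrite in_itv/= => ?; exists q; rewrite /ball/= ltr_distlC.
pose q : 'rV[rat]_n := \row_i (projT1 (cid (qP i))).
have xq : ball x k.+1%:R^-1 (c q).
  split => // i j; rewrite !mxE ord1; exact: (projT2 (cid (qP j))).
exists (q, k) => /=; last exact: ball_sym.
move=> y /= qy; apply: eU.
have : ball x (k.+1%:R^-1 + k.+1%:R^-1) y by exact: ball_triangle qy.
by apply: le_ball; rewrite [leRHS]splitr lerD// ltW.
Qed.

Lemma within_continuous_measurable_rV (D : set E) (f : E -> R) :
  measurable D -> {within D, continuous f} -> measurable_fun D f.
Proof.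
move=> mD cf; apply: (measurability _ (RGenOpens.measurableE R)) => //.
move=> _ [_ [a [b ->] <-]].
move/continuousP : cf => cf.
have oV : open (f @^-1` [set` Interval (BRight a) (BLeft b)] : set (subspace D)).
  exact/cf/interval_open.
have [V {}oV VD] := (open_subspaceP _ _).1 oV.
rewrite setIC -VD; apply: measurableI => //; exact: open_measurable_rV.
Qed.

End topology_rV.

(** * Fubini for the iterated Lebesgue measure *)

Section leb_fubini.
Context {R : realType}.
Local Open Scope ereal_scope.

(** The factor R carries here the type of real numbers on which Lebesgue measure
    lives, as Fubini requires. *)
Lemma measurable_cons_rV' n : measurable_fun
  [set: (measurableTypeR R * 'rV[R]_n)%type]
  (@cons_rV R n : (measurableTypeR R * 'rV[R]_n)%type -> 'rV[R]_n.+1).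
Proof. exact: measurable_cons_rV. Qed.

Lemma ge0_integral_leb n (f : 'rV[R]_n.+1 -> \bar R) :
  measurable_fun setT f -> (forall x, 0 <= f x) ->
  \int[leb n.+1]_x f x =
    \int[lebesgue_measure]_a \int[leb n]_y f (cons_rV (a, y)).
Proof.
move=> mf f0.
have mc := @measurable_cons_rV' n.
transitivity (\int[(@lebesgue_measure R \x leb n)%E]_p (f \o @cons_rV R n) p).
  exact: (@ge0_integral_pushforward _ _ (measurableTypeR R * 'rV[R]_n)%type
    'rV[R]_n.+1 R (@cons_rV R n) mc (lebesgue_measure \x leb n)%E
    setT f measurableT mf (fun x _ => f0 x)).
have h := measurableT_comp mf mc.
by rewrite fubini_tonelli1// => p; exact: f0.
Qed.

Lemma integrable_leb n (f : 'rV[R]_n.+1 -> \bar R) :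
  (leb n.+1).-integrable setT f ->
  (@lebesgue_measure R \x leb n)%E.-integrable setT (f \o @cons_rV R n).
Proof.
move=> /integrableP[mf fi]; have mc := @measurable_cons_rV' n.
apply/integrableP; split; first exact: measurableT_comp.
suff -> : \int[(@lebesgue_measure R \x leb n)%E]_p `|(f \o @cons_rV R n) p| =
    \int[leb n.+1]_x `|f x| by [].
have maf : measurable_fun setT (abse \o f) by exact: measurableT_comp.
apply: esym; exact: (@ge0_integral_pushforward _ _
  (measurableTypeR R * 'rV[R]_n)%type 'rV[R]_n.+1 R (@cons_rV R n) mc
  (lebesgue_measure \x leb n)%E setT _ measurableT maf
  (fun x _ => abse_ge0 (f x))).
Qed.

Lemma integral_leb_prod n (f : 'rV[R]_n.+1 -> \bar R) :
  (leb n.+1).-integrable setT f ->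
  \int[leb n.+1]_x f x = \int[(@lebesgue_measure R \x leb n)%E]_p f (cons_rV p).
Proof.
move=> fi; have [mf _] := integrableP _ _ _ fi.
exact: (@integral_pushforward _ _ (measurableTypeR R * 'rV[R]_n)%type
  'rV[R]_n.+1 R (@cons_rV R n) (@measurable_cons_rV' n) (lebesgue_measure \x leb n)%E
  setT f mf (integrable_leb fi) measurableT).
Qed.

Lemma integral_leb1 n (f : 'rV[R]_n.+1 -> \bar R) :
  (leb n.+1).-integrable setT f ->
  \int[leb n.+1]_x f x =
    \int[lebesgue_measure]_a \int[leb n]_y f (cons_rV (a, y)).
Proof.
move=> fi; rewrite integral_leb_prod//.
by rewrite -(integral12_prod_meas1 (integrable_leb fi)).
Qed.

(** The order in which the first coordinate is integrated innermost. *)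
Lemma integral_leb2 n (f : 'rV[R]_n.+1 -> \bar R) :
  (leb n.+1).-integrable setT f ->
  \int[leb n.+1]_x f x =
    \int[leb n]_y \int[lebesgue_measure]_a f (cons_rV (a, y)).
Proof.
move=> fi; rewrite integral_leb_prod//.
by rewrite -(integral21_prod_meas1 (integrable_leb fi)).
Qed.

Definition box n (M : R) : set 'rV[R]_n :=
  [set y | forall i, `[(- M)%R, M]%classic (y ord0 i)].
Arguments box : clear implicits.

Lemma measurable_box n M : measurable (box n M).
Proof.
rewrite (_ : box n M = \bigcap_(i in [set: 'I_n])
    ((fun y : 'rV[R]_n => y ord0 i) @^-1` `[(- M)%R, M])).
  apply: fin_bigcap_measurable => // i _.
  by rewrite -[X in measurable X]setTI; apply: measurable_coor.
by apply/seteqP; split => y h i => [_|]; [exact: h|exact: (h i I)].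
Qed.

(** This is what makes the measure of the ball finite and positive, hence the
    normalization of [nu] meaningful. *)
Lemma leb_box n (M : R) : (0 <= M)%R -> leb n (box n M) = (((2 * M) ^+ n)%R)%:E.
Proof.
move=> M0; elim: n => [|n ih].
  rewrite /= diracE mem_set// => -[]//.
rewrite [LHS](_ : _ = (@lebesgue_measure R \x leb n)%E
    (`[(- M)%R, M] `*` box n M)); last first.
  rewrite /= /leb_step /pushforward; congr (_ _).
  apply/seteqP; split => -[a y] /=.
    move=> h; split; first by have := h ord0; rewrite mxE unlift_none.
    by move=> i; have := h (lift ord0 i); rewrite mxE liftK.
  move=> [ha hy] i; rewrite mxE; case: unliftP => [j _|_] //=; exact: hy.
rewrite product_measure1E//; last exact: measurable_box.
have mI : (@lebesgue_measure R) `[(- M)%R, M]%classic = (2 * M)%:E.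
  rewrite lebesgue_measure_itv/= lte_fin -EFinD; case: ltP => M1; congr _%:E; lra.
by rewrite exprS EFinM; exact: (congr2 mule mI ih).
Qed.

Lemma compact_box n M : compact (box n M).
Proof.
apply: (@rV_compact R n (fun=> `[(- M)%R, M]%classic)) => i.
exact: segment_compact.
Qed.

Lemma continuous_box_integrable n M (g : 'rV[R]_n -> R) : (0 <= M)%R ->
  continuous g -> (forall y, ~ box n M y -> g y = 0%R) ->
  (leb n).-integrable setT (EFin \o g).
Proof.
move=> M0 cg g0.
rewrite (_ : EFin \o g = (EFin \o g) \_ (box n M)); last first.
  apply/funext => y; rewrite /restrict; case: ifPn => // /negP.
  by rewrite inE => yM /=; rewrite g0.
apply/(integrable_mkcond _ (measurable_box M)).
apply: measurable_bounded_integrable.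
- exact: measurable_box.
- have h : leb n (box n M) < +oo by rewrite leb_box // ltry.
  exact: h.
- apply: (measurable_funS measurableT) => //.
  apply: within_continuous_measurable_rV => //.
  exact: continuous_subspaceT.
- have /compact_bounded[K [Kr hK]] :=
    continuous_compact (continuous_subspaceT cg) (@compact_box n M).
  by exists K; split=> // x Kx y yM; exact: hK.
Qed.

End leb_fubini.
Arguments box {R} n M.
Arguments measurable_box {R n} M.
Arguments compact_box {R} n M.

(** * Directional derivatives and the divergence theorem for compact support *)

Section line_derivative.
Context {R : realType}.

(** A directional derivative only sees the restriction of the function to a line;
    this moves it between spaces of different dimensions. *)
Lemma is_derive_line (V W : normedModType R) (f : V -> R) (g : W -> R)
    (a v : V) (b w : W) (d : R) :
  (forall h : R, f (h *: v + a) = g (h *: w + b)) ->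
  is_derive a v f d -> is_derive b w g d.
Proof.
move=> fg [df <-].
have fga : f a = g b by have := fg 0; rewrite !scale0r !add0r.
have e : (fun h : R => h^-1 *: ((g \o shift b) (h *: w) - g b)) =
         (fun h : R => h^-1 *: ((f \o shift a) (h *: v) - f a)).
  by apply/funext => h /=; rewrite fg fga.
by apply: DeriveDef; [rewrite /derivable e|rewrite /derive e].
Qed.

Lemma is_derive_chain (V : normedModType R) (F : R -> R) (s : V -> R) (y v : V)
    (c d : R) : is_derive (s y) (1 : R) F c -> is_derive y v s d ->
  is_derive y v (fun z => F (s z)) (c * d).
Proof.
move=> dF ds.
pose s1 (h : R) := s (h *: v + y).
have ds1 : is_derive (0 : R) (1 : R) s1 d.
  apply: (@is_derive_line _ _ s s1 y v) ds => h.
  by rewrite /s1 addr0 [h *: 1]mulr1.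
have dF1 : is_derive (s1 0) (1 : R) F c by rewrite /s1 scale0r add0r.
apply: (@is_derive_line _ _ (F \o s1) _ 0 (1 : R) y v).
by move=> h; rewrite /s1 /= addr0 [h *: 1]mulr1.
Qed.

Lemma is_derive_cong (V : normedModType R) (f : V -> R) (x v : V) (a b : R) :
  is_derive x v f a -> a = b -> is_derive x v f b.
Proof. by move=> ? <-. Qed.

Section pointwise.
Context {V : normedModType R} (x v : V).
Implicit Types (f g : V -> R) (a b k : R).

Lemma is_derive_fD f g a b : is_derive x v f a -> is_derive x v g b ->
  is_derive x v (fun y => f y + g y) (a + b).
Proof. exact: is_deriveD. Qed.

Lemma is_derive_fB f g a b : is_derive x v f a -> is_derive x v g b ->
  is_derive x v (fun y => f y - g y) (a - b).
Proof. exact: is_deriveB. Qed.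

Lemma is_derive_fM f g a b : is_derive x v f a -> is_derive x v g b ->
  is_derive x v (fun y => f y * g y) (a * g x + f x * b).
Proof.
move=> df dg; apply: is_derive_cong (is_deriveM df dg) _.
by rewrite addrC mulrC.
Qed.

Lemma is_derive_fZ f k a : is_derive x v f a ->
  is_derive x v (fun y => k * f y) (k * a).
Proof. exact: is_deriveZ. Qed.

Lemma is_derive_fX f a m : is_derive x v f a ->
  is_derive x v (fun y => f y ^+ m) (m%:R * f x ^+ m.-1 * a).
Proof.
move=> df; have := is_deriveX m df.
by rewrite (_ : f ^+ m = fun y => f y ^+ m)// exprfctE.
Qed.

Lemma is_derive_fV f a : is_derive x v f a -> f x != 0 ->
  is_derive x v (fun y => (f y)^-1) (- a / f x ^+ 2).
Proof.
move=> df f0.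
apply: is_derive_cong (@is_derive_chain V (fun z => z^-1) f x v _ _
  (@is_deriveV R id (f x) 1 1 f0 (is_derive_id _ _)) df) _.
by rewrite /= [_ *: 1]mulr1 mulrC mulrN mulNr.
Qed.

Lemma is_derive_fsum m (h : 'I_m -> V -> R) (d : 'I_m -> R) :
  (forall i, is_derive x v (h i) (d i)) ->
  is_derive x v (fun y => \sum_(i < m) h i y) (\sum_(i < m) d i).
Proof.
move=> dh; have := is_derive_sum dh.
by rewrite (_ : \sum_(i < m) h i = fun y => \sum_(i < m) h i y)// fct_sumE.
Qed.

End pointwise.

Lemma integral_deriv_eq0 (h h' : R -> R) (M : R) : 0 <= M ->
  (forall a, is_derive (a : R) (1 : R) h (h' a)) -> continuous h' ->
  (forall a, M < `|a| -> h a = 0 /\ h' a = 0) ->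
  (\int[lebesgue_measure]_a (h' a)%:E = 0)%E.
Proof.
move=> M0 dh ch h0.
have ch1 : continuous h.
  move=> a; have [dha _] := dh a.
  exact/differentiable_continuous/derivable1_diffP.
pose I := `[- (M + 1), M + 1]%classic : set R.
transitivity (\int[lebesgue_measure]_(a in I) (h' a)%:E)%E.
  rewrite [RHS]integral_mkcond; apply: eq_integral => a _.
  rewrite /restrict; case: ifPn => //; rewrite notin_setE /I /= in_itv/=.
  move=> aI; rewrite (h0 a _).2//; rewrite ltNge; apply/negP.
  by rewrite ler_norml => /andP[? ?]; apply: aI; apply/andP; split; lra.
rewrite (@continuous_FTC2 _ h' h)//; first last.
- by move=> x _; rewrite derive1E; have [] := dh x.
- split; first by move=> x _; have [] := dh x.
  + by apply: cvg_at_right_filter; exact: ch1.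
  + by apply: cvg_at_left_filter; exact: ch1.
- exact: continuous_subspaceT.
- by lra.
have h00 a : M + 1 = `|a| -> h a = 0.
  by move=> e; rewrite (h0 a _).1// -e; lra.
rewrite !h00 ?subee//.
- by rewrite normrN ger0_norm//; lra.
- by rewrite ger0_norm//; lra.
Qed.

Lemma continuous_rV (T : topologicalType) n (f : T -> 'rV[R]_n) (x : T) :
  (forall i, {for x, continuous (fun y => f y ord0 i)}) ->
  {for x, continuous f}.
Proof.
move=> fi; apply/cvg_ballP => e e0.
have : \forall z \near x, forall j, ball (f x ord0 j) e (f z ord0 j).
  apply: filter_forall => j; have /cvg_ballP := fi j; exact.
by apply: filterS => z zj; split => // i j; rewrite ord1; exact: zj.
Qed.

Lemma continuous_cons_rV n (a : R) :
  continuous (fun y : 'rV[R]_n => cons_rV (a, y)).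
Proof.
move=> y; apply: continuous_rV => i.
case: (unliftP ord0 i) => [j|] ->.
  rewrite (_ : (fun _ => _) = (fun y : 'rV[R]_n => y ord0 j)).
    exact: coord_continuous.
  by apply/funext => z; rewrite mxE liftK.
rewrite (_ : (fun _ => _) = cst a); first by apply: cst_continuous.
by apply/funext => z; rewrite mxE unlift_none.
Qed.

Lemma continuous_cons_rV1 n (y : 'rV[R]_n) :
  continuous (fun a : R => cons_rV (a, y)).
Proof.
move=> a; apply: continuous_rV => i.
case: (unliftP ord0 i) => [j|] ->.
  rewrite (_ : (fun _ => _) = cst (y ord0 j)); first by apply: cst_continuous.
  by apply/funext => z; rewrite mxE liftK.
rewrite (_ : (fun _ => _) = id); first exact: cvg_id.
by apply/funext => z; rewrite mxE unlift_none.
Qed.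

(** Induction on the dimension: if the derivative is along the first coordinate,
    that coordinate is integrated first, by the fundamental theorem; otherwise
    the induction hypothesis applies for each value of the first coordinate. *)
Theorem integral_partial_eq0 n (i : 'I_n) (M : R) (g g' : 'rV[R]_n -> R) :
  0 <= M -> (forall y, is_derive y (delta_mx ord0 i) g (g' y)) ->
  continuous g' ->
  (forall y, ~ box n M y -> g y = 0 /\ g' y = 0) ->
  (\int[leb n]_y (g' y)%:E = 0)%E.
Proof.
move=> M0; elim: n i g g' => [[]//|n ih] i g g' dg cg g0.
have ig : (leb n.+1).-integrable setT (EFin \o g').
  by apply: (continuous_box_integrable M0) => // y /g0[].
have nbox a y : box n.+1 M (cons_rV (a, y)) -> `[- M, M]%classic a /\ box n M y.
  move=> h; split; first by have := h ord0; rewrite mxE unlift_none.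
  by move=> k; have := h (lift ord0 k); rewrite mxE liftK.
case: (unliftP ord0 i) => [j|] ei; subst i.
- rewrite (integral_leb1 ig)//; apply: integral0_eq => a _.
  apply: (ih j (fun y => g (cons_rV (a, y)))) => //.
  + move=> y; apply: (@is_derive_line _ _ g _ (cons_rV (a, y)) _ y _ _ _ (dg _)).
    move=> h; congr (g _); apply/rowP => k; rewrite !mxE.
    case: unliftP => [l ->|->]/=; rewrite ?mxE ?eqxx/=.
      by rewrite (inj_eq lift_inj).
    by rewrite mulr0 add0r.
  + move=> y; apply: continuous_comp; first exact: continuous_cons_rV.
    exact: cg.
  + by move=> y yM; apply: g0 => /nbox[].
- rewrite (integral_leb2 ig)//; apply: integral0_eq => y _.
  apply: (@integral_deriv_eq0 (fun a => g (cons_rV (a, y)))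
    (fun a => g' (cons_rV (a, y))) M) => //.
  + move=> a; apply: (@is_derive_line _ _ g _ (cons_rV (a, y)) _ a _ _ _ (dg _)).
    move=> h; congr (g _); apply/rowP => k; rewrite !mxE.
    case: unliftP => [l ->|->]/=; rewrite ?mxE ?eqxx/=.
      by rewrite mulr0 add0r.
    by [].
  + move=> a; apply: continuous_comp; first exact: continuous_cons_rV1.
    exact: cg.
  + move=> a aM; apply: g0 => /nbox[/=].
    by rewrite in_itv/= -ler_norml leNgt aM.
Qed.

End line_derivative.

(** * Dilations and Lebesgue measure *)

Section scaling.
Context {R : realType}.
Local Open Scope ereal_scope.

(** Uniqueness of Lebesgue measure: the image under t *: _ , multiplied by t,
    gives intervals their length. *)
Lemma ge0_integral_scale1 (t : R) (G : measurableTypeR R -> \bar R) :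
  (0 < t)%R -> measurable_fun setT G -> (forall a, 0 <= G a) ->
  \int[lebesgue_measure]_a G (t * a)%R =
    (t^-1)%:E * \int[lebesgue_measure]_a G a.
Proof.
move=> t0 mG G0.
pose s : measurableTypeR R -> measurableTypeR R := fun a => (t * a)%R.
have ms : measurable_fun setT s by exact: mulrl_measurable.
have t0' : (0 <= t)%R by exact: ltW.
pose m : {measure set (measurableTypeR R) -> \bar R} :=
  mscale (NngNum t0') (measure_function_pushforward__canonical__measure_function_Measure lebesgue_measure ms).
have mE A : measurable A -> lebesgue_measure A = m A.
  apply: (@lebesgue_measure_unique R m) => _ [[a b]] _ <-.
  have sE : s @^-1` `]a, b]%classic = `](t^-1 * a)%R, (t^-1 * b)%R]%classic.
    apply/seteqP; split => z /=; rewrite !in_itv/=;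
    by rewrite ler_pdivlMl// ltr_pdivrMl.
  transitivity (t%:E *
      lebesgue_measure (`](t^-1 * a)%R, (t^-1 * b)%R]%classic : set R)); last first.
    by rewrite -sE.
  rewrite !lebesgue_measure_itv/= !lte_fin ltr_pM2l ?invr_gt0//.
  case: ifPn => ab; last by rewrite mule0.
  rewrite -!EFinD -EFinM; congr _%:E.
  by rewrite mulrBr !mulrA divff ?gt_eqF// !mul1r.
have -> : \int[lebesgue_measure]_a G a = \int[m]_a G a.
  by apply: eq_measure_integral => A mA _; exact: mE.
rewrite (ge0_integral_mscale _ measurableT (NngNum t0') mG)//=.
rewrite muleA -EFinM mulVf ?gt_eqF// mul1e.
by rewrite (@ge0_integral_pushforward _ _ _ _ _ _ ms _ setT).
Qed.

Lemma measurable_scale n (t : R) :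
  measurable_fun setT (fun y : 'rV[R]_n => (t *: y)%R).
Proof.
apply: measurable_fun_coorP => i.
rewrite (_ : (fun _ => _) = (fun y : 'rV[R]_n => t * y ord0 i)%R).
  by apply: measurable_funM => //; exact: measurable_coor.
by apply/funext => y; rewrite mxE.
Qed.

Lemma ge0_integral_scale n (t : R) (f : 'rV[R]_n -> \bar R) :
  (0 < t)%R -> measurable_fun setT f -> (forall a, 0 <= f a) ->
  \int[leb n]_y f (t *: y)%R = ((t ^- n)%R)%:E * \int[leb n]_y f y.
Proof.
move=> t0; elim: n f => [|n ih] f mf f0.
  rewrite expr0 invr1 mul1e; apply: eq_integral => y _; congr f.
  by apply/rowP => -[].
have mft := measurableT_comp mf (@measurable_scale n.+1 t).
rewrite ge0_integral_leb//.
have cE a y : (t *: cons_rV (a, y) = cons_rV ((t * a)%R, (t *: y)%R) :> 'rV[R]_n.+1)%R.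
  by apply/rowP => i; rewrite !mxE; case: unliftP => [j _|_] /=; rewrite ?mxE.
have mfc a : measurable_fun setT (fun y : 'rV[R]_n => f (cons_rV (a, y))).
  apply: measurableT_comp => //.
  have := measurable_fun_pair2 a (@measurable_cons_rV' R n); exact.
have -> : \int[lebesgue_measure]_a \int[leb n]_y f (t *: cons_rV (a, y))%R =
    \int[lebesgue_measure]_a
      (((t ^- n)%R)%:E * \int[leb n]_y f (cons_rV ((t * a)%R, y))).
  apply: eq_integral => a _; under eq_integral do rewrite cE.
  by rewrite (ih (fun y => f (cons_rV ((t * a)%R, y)))).
pose G a := \int[leb n]_y f (cons_rV (a, y)).
have mG : measurable_fun [set: measurableTypeR R] G.
  have := @measurable_fun_fubini_tonelli_F _ _ (measurableTypeR R) 'rV[R]_n R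
    (leb n) (f \o @cons_rV R n).
  apply.
    exact: (measurableT_comp mf (@measurable_cons_rV' R n)).
  by move=> p; exact: f0.
have G0 a : 0 <= G a by apply: integral_ge0.
rewrite ge0_integralZl//; last 2 first.
- by move=> a _; exact: G0.
- by rewrite lee_fin invr_ge0 exprn_ge0// ltW.
  rewrite (ge0_integral_scale1 t0 mG G0) muleA -EFinM -invfM -exprSr.
  by rewrite ge0_integral_leb.
by have := measurableT_comp mG (mulrl_measurable t); exact.
Qed.

End scaling.

(** * The Euclidean norm and polar coordinates *)

Section enorm_theory.
Context {R : realType} {n : nat}.
Implicit Types x y : 'rV[R]_n.

Lemma enorm_ge0 x : 0 <= enorm x. Proof. exact: sqrtr_ge0. Qed.

Lemma sqr_enorm x : enorm x ^+ 2 = \sum_(i < n) x ord0 i ^+ 2.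
Proof. by rewrite sqr_sqrtr// sumr_ge0// => i _; exact: sqr_ge0. Qed.

Lemma enormZ (t : R) x : enorm (t *: x) = `|t| * enorm x.
Proof.
rewrite /enorm -sqrtr_sqr -sqrtrM ?sqr_ge0//; congr Num.sqrt.
by rewrite mulr_sumr; apply: eq_bigr => i _; rewrite mxE exprMn.
Qed.

Lemma enorm0 : enorm (0 : 'rV[R]_n) = 0.
Proof. by rewrite -(scale0r 0) enormZ normr0 mul0r. Qed.

Lemma sqr_coord_le x i : x ord0 i ^+ 2 <= enorm x ^+ 2.
Proof.
by rewrite sqr_enorm (bigD1 i)//= lerDl sumr_ge0// => j _; exact: sqr_ge0.
Qed.

Lemma enorm_eq0 x : enorm x = 0 -> x = 0.
Proof.
move=> x0; apply/rowP => i; rewrite mxE; apply/eqP.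
rewrite -sqrf_eq0 eq_le sqr_ge0 andbT (le_trans (sqr_coord_le x i))//.
by rewrite x0 expr0n.
Qed.

Lemma enorm_gt0 x : x != 0 -> 0 < enorm x.
Proof.
by move=> x0; rewrite lt0r enorm_ge0 andbT; apply: contra_neq x0 => /enorm_eq0.
Qed.

Lemma enorm_radial x : 0 < enorm x -> enorm (radial x) = 1.
Proof.
by move=> x0; rewrite enormZ normfV ger0_norm ?enorm_ge0// mulVf ?gt_eqF.
Qed.

Lemma radialK x : 0 < enorm x -> enorm x *: radial x = x.
Proof. by move=> x0; rewrite /radial scalerA divff ?gt_eqF// scale1r. Qed.

End enorm_theory.

(** The origin is a null set without a direction [radial]; it is left out of
    polar coordinates. *)
Definition pball {R : realType} {n} : set 'rV[R]_n :=
  [set y | (0 < enorm y) && (enorm y < 1)].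

Lemma measurable_invr (R : realType) : measurable_fun setT (@GRing.inv R).
Proof.
have -> : @GRing.inv R = fun x => if x == 0 then 0 else x^-1.
  by apply/funext => x; case: eqP => // ->; rewrite invr0.
apply: measurable_fun_if => //.
- apply: (measurable_fun_bool true); rewrite setTI.
  rewrite (_ : _ @^-1` _ = [set 0]); first exact: measurable_set1.
  by apply/seteqP; split => x /=; [move/eqP|move=> ->; rewrite eqxx].
- rewrite setTI (_ : _ @^-1` _ = ~` [set 0]); last first.
    by apply/seteqP; split => x /=; [move=> + e; rewrite e eqxx|move/eqP/negbTE].
  apply: open_continuous_measurable_fun; first exact/closed_openC/closed_eq.
  by move=> x; rewrite inE /= => /eqP x0; exact: inv_continuous.
Qed.

Section polar.
Context {R : realType}.
Local Notation L := (@lebesgue_measure R).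

Lemma measurable_pball n : measurable (@pball R n).
Proof.
rewrite -[X in measurable X]setTI.
apply: (_ : measurable_fun setT (fun y => (0 < enorm y) && (enorm y < 1))) => //.
by apply: measurable_and; apply: measurable_fun_ltr => //; exact: measurable_enorm.
Qed.

Lemma set10_box n : [set 0] = box n (0 : R).
Proof.
apply/seteqP; split => y /=; first by move=> -> i; rewrite mxE/= in_itv/= oppr0 lexx.
move=> h; apply/rowP => i; rewrite mxE; apply/eqP; rewrite eq_le.
by have := h i; rewrite /= in_itv/= oppr0 andbC.
Qed.

Lemma leb_set10 n : leb n.+1 [set 0 : 'rV[R]_n.+1] = 0%E.
Proof. by rewrite set10_box leb_box// mulr0 expr0n. Qed.

Lemma pballE n : @pball R n = uball `\` [set 0].
Proof.
apply/seteqP; split => y; rewrite /pball /uball /=.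
  by move=> /andP[y0 ->]; split => // e; move: y0; rewrite e enorm0 ltxx.
by move=> [-> /eqP/enorm_gt0 ->].
Qed.

Lemma ge0_integral_pball n (f : 'rV[R]_n.+1 -> \bar R) :
  measurable_fun setT f -> (forall x, 0 <= f x)%E ->
  (\int[leb n.+1]_(y in uball) f y = \int[leb n.+1]_(y in pball) f y)%E.
Proof.
move=> mf f0; rewrite pballE; apply: ge0_negligible_integral => //.
- by rewrite set10_box; exact: measurable_box.
- exact: measurable_uball.
- exact: measurable_funTS.
- exact: leb_set10.
Qed.

(** With d = n.+1, the integrand is d t^(-d-1), in the factored form in which it
    appears in [ge0_integral_polar]. *)
Lemma integral_power_tail n (rho : R) : 0 < rho ->
  (\int[L]_(t in `[rho, +oo[) (n.+1%:R * t ^+ n * t ^- n.+1 * t ^- n.+1)%:E =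
    (rho ^- n.+1)%:E)%E.
Proof.
move=> rho0.
have dF (x : R) : 0 < x -> is_derive x (1 : R) (fun t : R => - t ^- n.+1)
    (n.+1%:R * x ^+ n * x ^- n.+1 * x ^- n.+1).
  move=> x0; have x_neq0 : x ^+ n.+1 != 0 by rewrite expf_neq0// gt_eqF.
  have dG := is_derive_fZ (-1) (is_derive_fV
    (is_derive_fX n.+1 (is_derive_id x (1 : R))) x_neq0).
  have eG : (fun y : R => -1 / y ^+ n.+1) = (fun t : R => - t ^- n.+1).
    by apply/funext => t; rewrite mulN1r.
  rewrite -eG.
  apply: is_derive_cong dG _.
  by rewrite -pred_Sn; move: x_neq0; set X := x ^+ n.+1 => X0; field.
have cF (x : R) : 0 < x -> {for x, continuous (fun t : R => - t ^- n.+1)}.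
  move=> x0; have [dx _] := dF _ x0.
  exact/differentiable_continuous/derivable1_diffP.
rewrite (@ge0_continuous_FTC2y R _ (fun t => - t ^- n.+1) rho 0).
- by rewrite sub0e -EFinN opprK.
- move=> x x0; have {}x0 := lt_le_trans rho0 x0.
  by rewrite !mulr_ge0 ?invr_ge0 ?exprn_ge0 ?ltW.
- apply: continuous_in_subspaceT => x; rewrite inE/= in_itv/= andbT => x0.
  have {}x0 := lt_le_trans rho0 x0.
  have x_neq0 k : x ^+ k != 0 by rewrite expf_neq0// gt_eqF.
  apply: cvgM; last by apply: cvgV; [exact: x_neq0|exact: exprn_continuous].
  apply: cvgM; last by apply: cvgV; [exact: x_neq0|exact: exprn_continuous].
  by apply: cvgM; [exact: cvg_cst|exact: exprn_continuous].
- apply/cvgr0Pnorm_lt => e e0; near=> x.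
  have x1 : 1 <= x by near: x; apply: nbhs_pinfty_ge; rewrite num_real.
  have x0 : 0 < x by lra.
  rewrite normrN ger0_norm ?invr_ge0 ?exprn_ge0 ?ltW//.
  rewrite -[ltRHS]invrK ltf_pV2 ?posrE ?invr_gt0 ?exprn_gt0//.
  apply: (@lt_le_trans _ _ x); last by rewrite exprS ler_peMr ?exprn_ege1 ?ltW.
  by near: x; apply: nbhs_pinfty_gt; rewrite num_real.
- by move=> x /(lt_trans rho0)/dF[].
- by apply: cvg_at_right_filter; exact: cF.
- by move=> x; rewrite in_itv/= andbT => /(lt_trans rho0)/dF[_]; rewrite derive1E.
Unshelve. all: by end_near. Qed.

Lemma measurable_if0 d (T : measurableType d) (b : T -> bool) (f : T -> R) :
  measurable_fun setT b -> measurable_fun setT f ->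
  measurable_fun setT (fun x => if b x then f x else 0).
Proof. by move=> mb mf; exact: measurable_fun_ifT. Qed.

Lemma integral_mkif d (T : measurableType d) (mu : {measure set T -> \bar R})
    (D : set T) (b : T -> bool) (f : T -> R) : (forall x, D x <-> b x) ->
  (\int[mu]_(x in D) (f x)%:E = \int[mu]_x (if b x then f x else 0)%:E)%E.
Proof.
move=> Db; rewrite integral_mkcond; apply: eq_integral => x _.
rewrite /restrict; have [xD|xD] := boolP (x \in D).
  by move: xD; rewrite inE => /Db ->.
case: ifP => // bx; move: xD; rewrite notin_setE => /(_ _); case.
exact/Db.
Qed.

(** Polar coordinates, with the sphere parametrized by the ball itself.  Insert
    |y|^d int_(|y|)^oo d t^(-d-1) dt = 1, where d = n.+1, into the integral of f, exchange the
    integrals, substitute t *: y for y, and exchange them back: the integral over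
    t is now over the ray through y, on which t |y| is the radius r. *)
Theorem ge0_integral_polar n (f : 'rV[R]_n.+1 -> R) :
  measurable_fun setT f -> (forall x, 0 <= f x) ->
  (\int[leb n.+1]_(y in pball) (f y)%:E =
   \int[leb n.+1]_(y in pball) \int[L]_(r in `]0%R, 1%R[)
      (n.+1%:R * r ^+ n * f (r *: radial y))%:E)%E.
Proof.
move=> mf f0.
pose E := 'rV[R]_n.+1.
pose F (y : E) := if (0 < enorm y) && (enorm y < 1) then f y else 0.
have F0 y : 0 <= F y by rewrite /F; case: ifP.
have mF : measurable_fun setT F.
  apply: measurable_if0 => //.
  by apply: measurable_and; apply: measurable_fun_ltr => //; exact: measurable_enorm.
pose K (p : E * measurableTypeR R) :=
  if [&& 0 < enorm p.1, enorm p.1 < 1 & 0 < p.2]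
  then n.+1%:R * enorm p.1 ^+ n.+1 * p.2 ^+ n * F (p.2 *: p.1) else 0.
have K0 p : 0 <= K p.
  rewrite /K; case: ifP => // /and3P[p0 p1 t0].
  by rewrite !mulr_ge0 ?exprn_ge0 ?enorm_ge0// ltW.
pose J (p : E * measurableTypeR R) :=
  if [&& 0 < enorm p.1, enorm p.1 < p.2 & 0 < p.2]
  then n.+1%:R * p.2 ^+ n * p.2 ^- n.+1 * p.2 ^- n.+1 * (enorm p.1 ^+ n.+1 * F p.1)
  else 0.
have J0 p : 0 <= J p.
  rewrite /J; case: ifP => // /and3P[p0 p1 t0].
  by rewrite !mulr_ge0 ?invr_ge0 ?exprn_ge0 ?enorm_ge0// ltW.
have m1 : measurable_fun [set: (E * measurableTypeR R)%type] fst by [].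
have m2 : measurable_fun [set: (E * measurableTypeR R)%type]
  (snd : _ -> measurableTypeR R) by [].
have mn : measurable_fun [set: (E * measurableTypeR R)%type] (fun p => enorm p.1).
  exact: (measurableT_comp (@measurable_enorm R n.+1)).
have msc : measurable_fun [set: (E * measurableTypeR R)%type]
    (fun p => p.2 *: p.1 : E).
  apply: measurable_fun_coorP => i.
  rewrite (_ : (fun _ => _) = (fun p : E * measurableTypeR R => p.2 * p.1 ord0 i)).
    apply: measurable_funM => //.
    exact: (measurableT_comp (@measurable_coor _ _ _ i)).
  by apply/funext => p; rewrite mxE.
have mK : measurable_fun setT K.
  apply: measurable_if0.
    apply: measurable_and; first exact: measurable_fun_ltr.
    by apply: measurable_and; exact: measurable_fun_ltr.
  apply: measurable_funM; last exact: measurableT_comp.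
  apply: measurable_funM; last exact: measurable_funX.
  by apply: measurable_funM => //; exact: measurable_funX.
have mI k : measurable_fun [set: (E * measurableTypeR R)%type] (fun p => p.2 ^- k).
  apply: (measurableT_comp (@measurable_invr R)).
  exact: measurable_funX.
have mI1 k : measurable_fun [set: measurableTypeR R] (fun t => t ^- k).
  apply: (measurableT_comp (@measurable_invr R)).
  exact: measurable_funX.
have mt : measurable_fun [set: measurableTypeR R]
    (fun t => n.+1%:R * t ^+ n * t ^- n.+1 * t ^- n.+1).
  apply: measurable_funM => //; apply: measurable_funM => //.
  by apply: measurable_funM => //; exact: measurable_funX.
have mJ : measurable_fun setT J.
  apply: measurable_if0.
    apply: measurable_and; first exact: measurable_fun_ltr.
    by apply: measurable_and; exact: measurable_fun_ltr.
  apply: measurable_funM; last first.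
    apply: measurable_funM; first exact: measurable_funX.
    exact: measurableT_comp.
  apply: measurable_funM => //; apply: measurable_funM => //.
  by apply: measurable_funM => //; exact: measurable_funX.
(* With d = n.+1, J is d t^(-d-1) |y|^d f(y) on |y| < t, and K is J after the
   dilation of y by t. *)
transitivity (\int[leb n.+1]_y \int[L]_t (J (y, t))%:E)%E.
  rewrite (@integral_mkif _ _ _ pball (fun y => (0 < enorm y) && (enorm y < 1)))//.
  apply: eq_integral => z _; rewrite -/(F z).
  have [z0|z0] := ltP 0 (enorm z); last first.
    rewrite /F ltNge z0/= integral0_eq// => t _.
    by rewrite /J/= ltNge z0.
  transitivity (\int[L]_(t in `]enorm z, +oo[)
      ((enorm z ^+ n.+1 * F z)%:E * (n.+1%:R * t ^+ n * t ^- n.+1 * t ^- n.+1)%:E))%E.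
    rewrite ge0_integralZl//; last 3 first.
    - by apply/measurable_EFinP; exact: measurable_funTS.
    - move=> t /=; rewrite in_itv/= andbT => zt; have t0 := lt_trans z0 zt.
      by rewrite lee_fin !mulr_ge0 ?invr_ge0 ?exprn_ge0 ?ltW.
    - by rewrite lee_fin mulr_ge0// exprn_ge0// enorm_ge0.
    rewrite integral_itv_obnd_cbnd; last first.
      by apply/measurable_EFinP; exact: measurable_funTS.
    rewrite integral_power_tail// -EFinM mulrAC.
    by rewrite divff ?mul1r// expf_neq0// gt_eqF.
  under eq_integral do rewrite -EFinM.
  rewrite (@integral_mkif _ _ _ _ (fun t : measurableTypeR R => (enorm z < t) && (0 < t)))//; last first.
    move=> t; rewrite /= in_itv/= andbT; split => [zt|/andP[]//].
    by rewrite zt (lt_trans z0).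
  by apply: eq_integral => t _; rewrite /J/= z0/=; case: ifP => // _; rewrite mulrC.
rewrite (fubini_tonelli (EFin \o J))/=; last 2 first.
- exact/measurable_EFinP.
- by move=> p; rewrite lee_fin.
transitivity (\int[L]_t \int[leb n.+1]_y (K (y, t))%:E)%E.
  apply: eq_integral => t _.
  have [t0|t0] := ltP 0 t; last first.
    by rewrite !integral0_eq// => y _; rewrite /J /K/= (le_gtF t0) !andbF.
  pose g (z : E) := if (0 < enorm z) && (enorm z < t)
    then n.+1%:R * t ^+ n * t ^- n.+1 * (enorm z ^+ n.+1 * F z) else 0.
  have g0 z : (0 <= (g z)%:E)%E.
    rewrite lee_fin /g; case: ifP => // _.
    by rewrite !mulr_ge0 ?invr_ge0 ?exprn_ge0 ?enorm_ge0// ltW.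
  have mg : measurable_fun setT (EFin \o g).
    apply/measurable_EFinP; apply: measurable_if0.
      by apply: measurable_and; apply: measurable_fun_ltr => //;
        exact: measurable_enorm.
    apply: measurable_funM => //; apply: measurable_funM => //.
    by apply: measurable_funX; exact: measurable_enorm.
  have -> : (\int[leb n.+1]_y (K (y, t))%:E = \int[leb n.+1]_y (g (t *: y))%:E)%E.
    apply: eq_integral => y _; rewrite /K /g/= enormZ gtr0_norm// t0 andbT.
    rewrite pmulr_rgt0// -ltr_pdivlMl// mulVf ?gt_eqF//.
    case: ifP => // _; congr _%:E; rewrite exprMn.
    have tn0 : t ^+ n.+1 != 0 by rewrite expf_neq0// gt_eqF.
    by field.
  rewrite (ge0_integral_scale t0 (f := EFin \o g) mg g0).
  rewrite -ge0_integralZl//; last 2 first.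
  - by move=> z _; exact: g0.
  - by rewrite lee_fin invr_ge0 exprn_ge0// ltW.
  apply: eq_integral => z _; rewrite -EFinM /J /g/= t0 andbT.
  case: ifP => //; last by rewrite mulr0.
  by move=> _; congr _%:E; rewrite [RHS]mulrA; congr (_ * _); rewrite [RHS]mulrC.
rewrite -(fubini_tonelli (EFin \o K))/=; last 2 first.
- exact/measurable_EFinP.
- by move=> p; rewrite lee_fin.
apply: esym; rewrite integral_mkcond; apply: eq_integral => y _.
rewrite /restrict; case: ifPn => [|]; last first.
  rewrite notin_setE /pball/= => /negP yb; rewrite integral0_eq// => t _.
  by rewrite /K/= andbA (negbTE yb).
rewrite inE /pball/= => /andP[y0 y1].
pose q r := if 0 < r then n.+1%:R * r ^+ n * F (r *: radial y) else 0.
have q0 r : (0 <= (q r)%:E)%E.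
  by rewrite lee_fin /q; case: ifP => // r0; rewrite !mulr_ge0 ?exprn_ge0// ltW.
have mq : measurable_fun [set: measurableTypeR R] (EFin \o q).
  apply/measurable_EFinP; apply: measurable_if0.
    exact: measurable_fun_ltr.
  apply: measurable_funM.
    by apply: measurable_funM => //; exact: measurable_funX.
  apply: measurableT_comp => //; apply: measurable_fun_coorP => i.
  rewrite (_ : (fun _ => _) = (fun r : measurableTypeR R => r * radial y ord0 i)).
    by apply: measurable_funM.
  by apply/funext => r; rewrite mxE.
transitivity (\int[L]_r (q r)%:E)%E.
  rewrite (@integral_mkif _ _ _ _ (fun r : measurableTypeR R => (0 < r) && (r < 1))); last first.
    by move=> t; rewrite /= in_itv/=.
  apply: eq_integral => r _; rewrite /q /F.
  have [r0|//] := ltP 0 r.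
  rewrite enormZ enorm_radial// mulr1 gtr0_norm// r0/=.
  by case: ifP => //; rewrite mulr0.
have yinv : 0 < (enorm y)^-1 by rewrite invr_gt0.
have -> : (\int[L]_r (q r)%:E = (enorm y)%:E * \int[L]_t (q (enorm y * t))%:E)%E.
  have := @ge0_integral_scale1 R (enorm y) (EFin \o q) y0 mq q0.
  move=> /= ->; rewrite muleA -EFinM divff ?gt_eqF// mul1e//.
rewrite -ge0_integralZl//; last 2 first.
- have := measurableT_comp mq (mulrl_measurable (enorm y)); exact.
- by rewrite lee_fin ltW.
apply: eq_integral => t _; rewrite -EFinM /q /K/= y0 y1/= pmulr_rgt0//.
case: ifP; last by rewrite mulr0.
have -> : (enorm y * t) *: radial y = t *: y.
  by rewrite mulrC -scalerA radialK.
by move=> t0; congr _%:E; rewrite exprMn exprS; ring.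
Qed.

End polar.

(** * The normalized measures on the ball and on the sphere *)

Section nu_theory.
Context {R : realType} {n : nat}.
Local Notation E := 'rV[R]_n.

Lemma uball_box : (@uball R n) `<=` box n 1.
Proof.
move=> y; rewrite /uball/= => y1 i; rewrite /= in_itv/=.
rewrite -ler_norml -(@ler_pXn2r _ 2) ?nnegrE// expr1n real_normK ?num_real//.
rewrite (le_trans (sqr_coord_le y i))// -(expr1n _ 2).
by rewrite ler_pXn2r ?nnegrE ?enorm_ge0// ltW.
Qed.

Lemma box_uball : box n (n.+1%:R^-1) `<=` (@uball R n).
Proof.
move=> y yb; rewrite /uball/= -(@ltr_pXn2r _ 2) ?nnegrE ?enorm_ge0//.
rewrite expr1n sqr_enorm.
apply: (@le_lt_trans _ _ (\sum_(i < n) n.+1%:R^-1)).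
  apply: ler_sum => i _; have := yb i; rewrite /= in_itv/= -ler_norml => yi.
  rewrite -[leLHS]real_normK ?num_real//.
  apply: (@le_trans _ _ (n.+1%:R^-1 ^+ 2)).
    by rewrite ler_pXn2r ?nnegrE ?invr_ge0.
  by rewrite expr2 ler_piMr ?invr_ge0// invf_le1 ?ler1n.
by rewrite sumr_const card_ord -[ltLHS]mulr_natr mulrC ltr_pdivrMr// mul1r ltr_nat.
Qed.

Lemma leb_uball_fin : (leb n (@uball R n) < +oo)%E.
Proof.
have := @leb_box R n 1 ler01; rewrite -ge0_fin_numE// => h.
rewrite ge0_fin_numE//; apply: (@le_lt_trans _ _ (leb n (box n 1))).
  apply: le_measure; rewrite ?inE; [exact: measurable_uball|exact: measurable_box|].
  exact: uball_box.
by rewrite h ltry.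
Qed.

Lemma leb_uball_gt0 : 0 < fine (leb n (@uball R n)).
Proof.
rewrite fine_gt0// leb_uball_fin andbT.
apply: (@lt_le_trans _ _ (leb n (box n (n.+1%:R^-1)))).
  by rewrite leb_box ?invr_ge0// lte_fin exprn_gt0// mulr_gt0 ?invr_gt0.
apply: le_measure; rewrite ?inE; [exact: measurable_box|exact: measurable_uball|].
exact: box_uball.
Qed.

Lemma nu_uball : nu (@uball R n) = 1%E.
Proof.
rewrite /nu /mscale /= -[leb n uball]fineK; last first.
  by rewrite ge0_fin_numE// leb_uball_fin.
by rewrite -EFinM mulVf// gt_eqF// leb_uball_gt0.
Qed.

Lemma ge0_integral_nu (D : set E) (f : E -> \bar R) :
  measurable D -> measurable_fun D f -> (forall x, D x -> 0 <= f x)%E ->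
  (\int[nu]_(x in D) f x =
     ((fine (leb n (@uball R n)))^-1)%:E * \int[leb n]_(x in D) f x)%E.
Proof. by move=> mD mf f0; exact: ge0_integral_mscale. Qed.

Lemma integral_nu_eq0 (f : E -> R) :
  (leb n).-integrable setT (EFin \o f) -> (\int[leb n]_x (f x)%:E = 0)%E ->
  (\int[nu]_x (f x)%:E = 0)%E.
Proof.
move=> fi f0; have [mf _] := integrableP _ _ _ fi.
have fip := integrable_funepos measurableT fi.
have fin := integrable_funeneg measurableT fi.
rewrite integralE in f0.
have e : (\int[leb n]_x (EFin \o f)^\+ x = \int[leb n]_x (EFin \o f)^\- x)%E.
  move: f0 (integrable_fin_num measurableT fip) (integrable_fin_num measurableT fin).
  case: (integral _ _ _) => [a| |]//; case: (integral _ _ _) => [b| |]// + _ _.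
  by rewrite -EFinB => /eqP; rewrite eqe subr_eq0 => /eqP ->.
rewrite integralE !ge0_integral_nu//.
- rewrite e subee// fin_numM//; exact: integrable_fin_num.
- exact: measurable_funeneg.
- exact: measurable_funepos.
Qed.

Lemma bounded_integrable_nu (D : set E) (f : E -> R) (M : R) :
  measurable D -> D `<=` uball -> measurable_fun D f ->
  (forall x, D x -> `|f x| <= M) -> nu.-integrable D (EFin \o f).
Proof.
move=> mD Db mf fM; apply: measurable_bounded_integrable => //.
  apply: (@le_lt_trans _ _ (nu (@uball R n))); last by rewrite nu_uball ltry.
  by apply: le_measure; rewrite ?inE//; exact: measurable_uball.
exists M; split; first exact: num_real.
by move=> x Mx y Dy /=; rewrite (le_trans (fM _ Dy))// ltW.
Qed.

End nu_theory.

Section sigma_theory.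
Context {R : realType} {n : nat}.
Local Notation E := 'rV[R]_n.

(** The restricted measure does not charge the complement of its support, so the
    domain may be cut down to it, where the two measures agree. *)
Lemma integral_mrestr d (T : measurableType d) (mu : {measure set T -> \bar R})
    (D P : set T) (mD : measurable D) (f : T -> \bar R) : measurable P ->
  (mrestr mu mD).-integrable P f ->
  (\int[mrestr mu mD]_(x in P) f x = \int[mu]_(x in P `&` D) f x)%E.
Proof.
move=> mP fi.
have z0 : (mrestr mu mD) (P `\` D) = 0%E.
  by rewrite /mrestr setDE -setIA setICl setI0 measure0.
rewrite (negligible_integral _ mP fi z0); last exact: measurableD.
rewrite setDD; apply: eq_measure_integral => A mA AP; rewrite /mrestr.
by congr (mu _); apply/setIidl => x /AP[].
Qed.

(** The surface measure is the image under [radial] of the volume of the ball.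
    Surface integrals are therefore volume integrals of functions of the
    direction, the form they have below. *)
Lemma Rintegral_sigma (f : E -> R) (M : R) :
  measurable (@usphere R n) ->
  measurable_fun usphere f -> (forall x, usphere x -> `|f x| <= M) ->
  \int[sigma]_(xi in usphere) f xi = \int[nu]_(y in pball) f (radial y).
Proof.
move=> ms mf fM.
pose f' := f \_ usphere.
have mf' : measurable_fun setT f' by move/(measurable_restrictT f ms) : mf.
have f'M x : `|f' x| <= `|M|.
  rewrite /f' /restrict; case: ifPn => [|_]; last by rewrite normr0.
  by rewrite inE => /fM /le_trans -> //; exact: ler_norm.
have mP : measurable (@radial R n @^-1` usphere).
  by rewrite -[X in measurable X]setTI; exact: measurable_radial.
have mg : measurable_fun setT (f' \o @radial R n).
  by apply: measurableT_comp => //; exact: measurable_radial.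
have gi : (mrestr nu (@measurable_uball R n)).-integrable
    (@radial R n @^-1` usphere) (EFin \o (f' \o @radial R n)).
  apply: measurable_bounded_integrable => //.
  - apply: (@le_lt_trans _ _ (nu (@uball R n))); last by rewrite nu_uball ltry.
    apply: le_measure; rewrite ?inE//.
    + by apply: measurableI => //; exact: measurable_uball.
    + exact: measurable_uball.
  - exact: measurable_funTS.
  - exists `|M|; split; first exact: num_real.
    by move=> x Mx y _ /=; rewrite (le_trans (f'M _))// ltW.
congr fine.
transitivity (\int[sigma]_(xi in usphere) (f' xi)%:E)%E.
  by apply: eq_integral => x xs; rewrite /f' /restrict xs.
have mf'E : measurable_fun setT (EFin \o f') by exact/measurable_EFinP.
rewrite [LHS](integral_pushforward (@measurable_radial R n) mf'E gi ms).
rewrite integral_mrestr//.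
rewrite (_ : _ `&` _ = pball); last first.
  apply/seteqP; split => y; rewrite /pball/=.
    move=> [+ y1]; rewrite /usphere/= enormZ normfV ger0_norm ?enorm_ge0// => e.
    rewrite [enorm y < 1]y1 andbT lt0r enorm_ge0 andbT; apply/eqP => y0.
    by move: e; rewrite y0 mulr0 => /esym/eqP; rewrite oner_eq0.
  by move=> /andP[y0 y1]; split => //; exact: enorm_radial.
apply: eq_integral => y /[!inE] /andP[y0 _] /=.
by rewrite /f' /restrict mem_set//; exact: enorm_radial.
Qed.

End sigma_theory.

(** * The Green identity of the hyperbolic Laplacian *)

Section pointwise_continuity.
Context {R : realType} {T : topologicalType}.
Implicit Types (f g : T -> R) (x : T).

Lemma cont_near_eq f g x : f x = g x -> (\forall z \near x, f z = g z) ->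
  {for x, continuous f} -> {for x, continuous g}.
Proof.
by move=> fg ne cf; rewrite /prop_for /continuous_at -fg;
  apply: cvg_trans cf; exact: near_eq_cvg.
Qed.

Lemma cont_cst x (k : R) : {for x, continuous (fun _ : T => k)}.
Proof. exact: cvg_cst. Qed.

Lemma contD f g x : {for x, continuous f} -> {for x, continuous g} ->
  {for x, continuous (fun z => f z + g z)}.
Proof. exact: cvgD. Qed.

Lemma contB f g x : {for x, continuous f} -> {for x, continuous g} ->
  {for x, continuous (fun z => f z - g z)}.
Proof. exact: cvgB. Qed.

Lemma contM f g x : {for x, continuous f} -> {for x, continuous g} ->
  {for x, continuous (fun z => f z * g z)}.
Proof. exact: cvgM. Qed.

Lemma contV f x : f x != 0 -> {for x, continuous f} ->
  {for x, continuous (fun z => (f z)^-1)}.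
Proof. exact: cvgV. Qed.

Lemma cont_comp (F : R -> R) f x : {for x, continuous f} ->
  {for f x, continuous F} -> {for x, continuous (fun z => F (f z))}.
Proof. by move=> cf cF; exact: (@continuous_comp _ _ _ f F). Qed.

Lemma contX f x m : {for x, continuous f} ->
  {for x, continuous (fun z => f z ^+ m)}.
Proof. by move=> cf; apply: (@cont_comp (fun t => t ^+ m)) => //; exact: exprn_continuous. Qed.

Lemma cont_sum (I : Type) (s : seq I) (h : I -> T -> R) x :
  (forall i, {for x, continuous (h i)}) ->
  {for x, continuous (fun z => \sum_(i <- s) h i z)}.
Proof.
move=> ch; elim: s => [|i s ih].
  rewrite (_ : (fun z => _) = fun=> 0); first exact: cont_cst.
  by apply/funext => z; rewrite big_nil.
rewrite (_ : (fun z => _) = fun z => h i z + \sum_(j <- s) h j z).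
  exact: contD.
by apply/funext => z; rewrite big_cons.
Qed.

End pointwise_continuity.

Section enorm_continuity.
Context {R : realType} {n : nat}.
Local Notation E := 'rV[R]_n.

Lemma continuous_enorm2 : continuous (fun y : E => enorm y ^+ 2).
Proof.
move=> y; rewrite (_ : (fun y => _) = (fun y : E => \sum_(i < n) y ord0 i ^+ 2)).
  by apply: cont_sum => i; apply: contX; exact: coord_continuous.
by apply/funext => z; rewrite sqr_enorm.
Qed.

Lemma continuous_enorm : continuous (@enorm R n).
Proof.
rewrite (_ : @enorm R n = (fun y => Num.sqrt (enorm y ^+ 2))); last first.
  by apply/funext => y; rewrite sqrtr_sqr ger0_norm ?enorm_ge0.
move=> y; apply: (@continuous_comp _ _ _ (fun y : E => enorm y ^+ 2) Num.sqrt).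
  exact: continuous_enorm2.
exact: sqrt_continuous.
Qed.

Lemma open_uball : open (@uball R n).
Proof.
rewrite (_ : uball = @enorm R n @^-1` [set t | t < 1])//.
by apply: open_comp; [move=> ? _; exact: continuous_enorm|exact: open_lt].
Qed.

Lemma near_uball (y : E) : uball y -> \forall z \near y, uball z.
Proof. by move=> yb; exact: (open_nbhs_nbhs (conj open_uball yb)). Qed.

Lemma near_enorm2_gt (r : R) (y : E) :
  r < enorm y ^+ 2 -> \forall z \near y, r < enorm z ^+ 2.
Proof.
move=> ry; apply: (@open_nbhs_nbhs _ y [set y : E | r < enorm y ^+ 2]).
split => //.
apply: (@open_comp _ _ (fun y : E => enorm y ^+ 2) [set t | r < t]).
  by move=> ? _; exact: continuous_enorm2.
exact: open_gt.
Qed.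

Lemma is_derive_coord (y v : E) (i : 'I_n) :
  is_derive y v (fun z : E => z ord0 i) (v ord0 i).
Proof.
apply: (@is_derive_line R R E id _ (y ord0 i) (v ord0 i) y v).
  by move=> h; rewrite !mxE.
Qed.

Lemma is_derive_enorm2 (y : E) (i : 'I_n) :
  is_derive y (delta_mx ord0 i) (fun z : E => enorm z ^+ 2) (2 * y ord0 i).
Proof.
rewrite (_ : (fun y => _) = (fun y : E => \sum_(j < n) y ord0 j ^+ 2)); last first.
  by apply/funext => z; rewrite sqr_enorm.
apply: is_derive_cong.
  by apply: is_derive_fsum => j; apply: is_derive_fX; exact: is_derive_coord.
rewrite (bigD1 i)//= mxE !eqxx mulr1 expr1 big1 ?addr0// => j ji.
by rewrite mxE eqxx (negbTE ji) mulr0.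
Qed.

End enorm_continuity.

Section zero_extension.
Context {R : realType} {n : nat}.
Local Notation E := 'rV[R]_n.
Variables (r : R) (f : E -> R).
Hypothesis r1 : r < 1.
Hypothesis f0 : forall y, uball y -> r < enorm y ^+ 2 -> f y = 0.

(** A function that vanishes near the sphere stays as smooth when extended by
    zero, which reduces integration by parts on the ball to that on R^n. *)
Definition ext0 (f : E -> R) (y : E) : R := if enorm y < 1 then f y else 0.

Lemma near_ext0_in (g : E -> R) (y : E) : uball y -> \forall z \near y, g z = ext0 g z.
Proof. by move/near_uball; apply: filterS => z; rewrite /ext0 => ->. Qed.

Lemma near_ext0_out (y : E) : ~ uball y -> \forall z \near y, cst 0 z = ext0 f z.
Proof.
move=> yb; have : r < enorm y ^+ 2.
  by apply: (lt_le_trans r1); rewrite exprn_ege1// leNgt; exact/negP.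
move/near_enorm2_gt; apply: filterS => z rz; rewrite /ext0; case: ifP => // zb.
by rewrite f0.
Qed.

Lemma continuous_ext0 : (forall y, uball y -> {for y, continuous f}) ->
  continuous (ext0 f).
Proof.
move=> cf y; have [yb|yb] := pselect (uball y).
  apply: (cont_near_eq _ (near_ext0_in f yb)); last exact: cf.
  by rewrite /ext0 (_ : enorm y < 1).
apply: (cont_near_eq _ (near_ext0_out yb)); last exact: cont_cst.
by rewrite /ext0 ifF//; exact/negP.
Qed.

Lemma integrable_compact_support : (forall y, uball y -> {for y, continuous f}) ->
  nu.-integrable uball (EFin \o f).
Proof.
move=> cf; have ce := continuous_ext0 cf.
have [K [Kr hK]] := compact_bounded
  (continuous_compact (continuous_subspaceT ce) (@compact_box R n 1)).
apply: (@bounded_integrable_nu _ _ _ _ (`|K| + 1)) => //.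
- exact: measurable_uball.
- apply: within_continuous_measurable_rV; first exact: measurable_uball.
  by apply: continuous_in_subspaceT => y; rewrite inE => /cf.
- move=> y yb; have -> : f y = ext0 f y by rewrite /ext0 yb.
  apply: (hK (`|K| + 1)); first by rewrite ltr_pwDr// ler_norm.
  by exists y => //; exact: uball_box.
Qed.

End zero_extension.

Section ball_ibp.
Context {R : realType} {n : nat}.
Local Notation E := 'rV[R]_n.

Lemma Rintegral_partial_eq0 (i : 'I_n) (r : R) (V V' : E -> R) : r < 1 ->
  (forall y, uball y -> is_derive y (delta_mx ord0 i) V (V' y)) ->
  (forall y, uball y -> {for y, continuous V'}) ->
  (forall y, uball y -> r < enorm y ^+ 2 -> V y = 0 /\ V' y = 0) ->
  \int[nu]_(y in uball) V' y = 0.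
Proof.
move=> r1 dV cV V0.
have V0' y : uball y -> r < enorm y ^+ 2 -> V y = 0 by move=> yb /(V0 _ yb)[].
have V'0 y : uball y -> r < enorm y ^+ 2 -> V' y = 0 by move=> yb /(V0 _ yb)[].
have ce := continuous_ext0 r1 V'0 cV.
have e0 g y : ~ box n (1 : R) y -> ext0 g y = 0.
  by move=> yb; rewrite /ext0; case: ifP => // /uball_box/yb.
have de y : is_derive y (delta_mx ord0 i) (ext0 V) (ext0 V' y).
  have [yb|yb] := pselect (uball y).
    rewrite {2}/ext0 (_ : enorm y < 1)//.
    by apply: (near_eq_is_derive (near_ext0_in V yb)); exact: dV.
  rewrite {2}/ext0 ifF; last exact/negP.
  by apply: (near_eq_is_derive (near_ext0_out r1 V0' yb)); exact: is_derive_cst.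
rewrite Rintegral_mkcond (_ : V' \_ uball = ext0 V'); last first.
  apply/funext => y; rewrite /restrict /ext0; case: ifPn => [|].
    by rewrite inE /uball/= => ->.
  by rewrite notin_setE /uball/=; case: ifP.
rewrite /Rintegral integral_nu_eq0//.
- by apply: (continuous_box_integrable ler01) => // y /e0.
- by apply: (integral_partial_eq0 ler01 de ce) => y /e0.
Qed.

Lemma Rintegral_sum d (T : measurableType d) (mu : {measure set T -> \bar R})
    (D : set T) (m : nat) (f : 'I_m -> T -> R) : measurable D ->
  (forall i, mu.-integrable D (EFin \o f i)) ->
  \int[mu]_(x in D) (\sum_(i < m) f i x) = \sum_(i < m) \int[mu]_(x in D) f i x.
Proof.
move=> mD fi; rewrite /Rintegral.
under eq_integral do rewrite -sumEFin.
rewrite integral_sum// -sum_fine// => i _.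
exact: (integrable_fin_num mD (fi i)).
Qed.

End ball_ibp.

Section green_identity.
Context {R : realType} {n : nat}.
Local Notation E := 'rV[R]_n.

Let deriv_weightE (m : nat) (b t : R) : (2 <= m)%N -> b != 0 ->
  - ((m - 2)%:R * b ^+ (m - 2).-1 * (0 - 2 * t)) / (b ^+ (m - 2)) ^+ 2 =
  2 * (m%:R - 2) * t * b ^- m.-1.
Proof.
move=> m2 bn0; rewrite -natrB//.
case: m m2 => [|[|m]]// _; rewrite subn2/=.
case: m => [|m]/=; first by rewrite !(mul0r, mulr0, oppr0).
have Bn0 : b ^+ m != 0 by rewrite expf_neq0.
rewrite !exprS; move: Bn0; set B := b ^+ m => Bn0.
by field; rewrite bn0 Bn0.
Qed.

Let green_algebra (m : nat) (b w u A1 A2 B1 B2 : R) : (2 <= m)%N -> b != 0 ->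
  w * (b ^+ 2 * A2 + 2 * (m%:R - 2) * b * A1) * b ^- m -
  u * (b ^+ 2 * B2 + 2 * (m%:R - 2) * b * B1) * b ^- m =
  2 * (m%:R - 2) * b ^- m.-1 * w * A1 - 2 * (m%:R - 2) * b ^- m.-1 * u * B1 +
  (b ^- (m - 2) * w * A2 - b ^- (m - 2) * u * B2).
Proof.
case: m => [|[|m]]// _ bn0; rewrite subn2/=.
have Bn0 : b ^+ m != 0 by rewrite expf_neq0.
rewrite !exprS; move: Bn0; set B := b ^+ m => Bn0.
set nn := m.+2%:R.
by field; rewrite bn0 Bn0.
Qed.

(** u1 and u2 are the first and the pure second partial derivatives.  Passing
    them as data, rather than as iterated limits, makes derivatives of explicit
    functions computable. *)
Definition C2_ball (u : E -> R) (u1 u2 : 'I_n -> E -> R) : Prop := forall i y, uball y ->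
  [/\ is_derive y (delta_mx ord0 i) u (u1 i y),
      is_derive y (delta_mx ord0 i) (u1 i) (u2 i y),
      {for y, continuous u}, {for y, continuous (u1 i)} &
      {for y, continuous (u2 i)}].

(** The hyperbolic Laplacian of a scalar function with partial derivatives u1
    and u2. *)
Definition hlap (u1 u2 : 'I_n -> E -> R) (y : E) : R :=
  (1 - enorm y ^+ 2) ^+ 2 * (\sum_(i < n) u2 i y) +
  2 * (n%:R - 2) * (1 - enorm y ^+ 2) * \sum_(i < n) y ord0 i * u1 i y.

Lemma uball_defect (y : E) : uball y -> 0 < 1 - enorm y ^+ 2.
Proof.
by rewrite /uball/= => y1; rewrite subr_gt0 expr_lt1 ?enorm_ge0.
Qed.

Lemma continuous_defect (y : E) : {for y, continuous (fun z : E => 1 - enorm z ^+ 2)}.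
Proof. by apply: contB; [exact: cont_cst|exact: continuous_enorm2]. Qed.

Lemma continuous_tau (y : E) : uball y -> {for y, continuous (@tau_density R n)}.
Proof.
move=> yb; apply: contV; first by rewrite expf_neq0// gt_eqF// uball_defect.
by apply: contX; exact: continuous_defect.
Qed.

Lemma continuous_hlap (u : E -> R) (u1 u2 : 'I_n -> E -> R) y : (0 < n)%N -> C2_ball u u1 u2 -> uball y ->
  {for y, continuous u} /\ {for y, continuous (hlap u1 u2)}.
Proof.
move=> n0 hu yb; have cu i := hu i y yb; split.
  by have [_ _] := cu (Ordinal n0).
apply: contD; apply: contM.
- by apply: contX; exact: continuous_defect.
- by apply: cont_sum => i; have [] := cu i.
- by apply: contM; [exact: cont_cst|exact: continuous_defect].
- apply: cont_sum => i; apply: contM; first exact: coord_continuous.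
  by have [] := cu i.
Qed.

(** With b = 1 - |y|^2, the operator is in divergence form:
    b^(-n) Delta_h u = div (b^(2-n) grad u).  Hence the difference of the two
    integrands is the divergence of b^(2-n) (w grad u - u grad w), which has
    compact support. *)
Theorem green_identity (u w : E -> R) (u1 u2 w1 w2 : 'I_n -> E -> R) (r : R) : (2 <= n)%N -> r < 1 ->
  C2_ball u u1 u2 -> C2_ball w w1 w2 ->
  (forall y, uball y -> r < enorm y ^+ 2 ->
     w y = 0 /\ forall i, w1 i y = 0 /\ w2 i y = 0) ->
  \int[nu]_(y in uball) (w y * hlap u1 u2 y * tau_density y) =
  \int[nu]_(y in uball) (u y * hlap w1 w2 y * tau_density y).
Proof.
move=> n2 r1 hu hw w0.
have n0 : (0 < n)%N by apply: leq_trans n2.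
have cL y yb := continuous_hlap (y := y) n0 hu yb.
have cLw y yb := continuous_hlap (y := y) n0 hw yb.
have hlw0 y : uball y -> r < enorm y ^+ 2 -> hlap w1 w2 y = 0.
  move=> yb /(w0 _ yb)[_ wi]; rewrite /hlap !big1 ?mulr0 ?addr0// => i _.
    by rewrite (wi i).1 mulr0.
  by rewrite (wi i).2.
apply/eqP; rewrite -subr_eq0 -RintegralB//; last 3 first.
- exact: measurable_uball.
- apply: (integrable_compact_support r1).
    by move=> y yb /(w0 _ yb)[-> _]; rewrite !mul0r.
  move=> y yb; apply: contM; last exact: continuous_tau.
  by apply: contM; [have [] := cLw y yb|have [] := cL y yb].
- apply: (integrable_compact_support r1).
    by move=> y yb /(hlw0 _ yb) ->; rewrite mulr0 mul0r.
  move=> y yb; apply: contM; last exact: continuous_tau.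
  by apply: contM; [have [] := cL y yb|have [] := cLw y yb].
(* V is the vector field b^(2-n) (w grad u - u grad w) and V' i the derivative of
   its i-th component along the i-th axis. *)
pose om (y : E) := (1 - enorm y ^+ 2) ^- (n - 2).
pose V (i : 'I_n) (y : E) := om y * (w y * u1 i y - u y * w1 i y).
pose V' (i : 'I_n) (y : E) := 2 * (n%:R - 2) * y ord0 i * (1 - enorm y ^+ 2) ^- n.-1 *
    (w y * u1 i y - u y * w1 i y) + om y * (w y * u2 i y - u y * w2 i y).
have cV' i y : uball y -> {for y, continuous (V' i)}.
  move=> yb; have [_ _ cu cu1 cu2] := hu i y yb; have [_ _ cw cw1 cw2] := hw i y yb.
  have b0 m : (1 - enorm y ^+ 2) ^+ m != 0 by rewrite expf_neq0// gt_eqF// uball_defect.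
  have cb m : {for y, continuous (fun z : E => (1 - enorm z ^+ 2) ^- m)}.
    by apply: contV => //; apply: contX; exact: continuous_defect.
  apply: contD; apply: contM; try by apply: contB; exact: contM.
    apply: contM; last exact: cb.
    by apply: contM; [exact: cont_cst|exact: coord_continuous].
  exact: cb.
have V0 i y : uball y -> r < enorm y ^+ 2 -> V i y = 0 /\ V' i y = 0.
  move=> yb /(w0 _ yb)[wy wi]; rewrite /V /V' wy (wi i).1 (wi i).2.
  by rewrite !mul0r !mulr0 !subr0 !mulr0 addr0.
have dV i y : uball y -> is_derive y (delta_mx ord0 i) (V i) (V' i y).
  move=> yb; have [du du1 _ _ _] := hu i y yb; have [dw dw1 _ _ _] := hw i y yb.
  have b0 m : (1 - enorm y ^+ 2) ^+ m != 0 by rewrite expf_neq0// gt_eqF// uball_defect.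
  have db : is_derive y (delta_mx ord0 i) (fun z : E => 1 - enorm z ^+ 2) (0 - 2 * y ord0 i).
    exact: is_derive_fB (is_derive_cst _ _ _) (is_derive_enorm2 y i).
  have dom := is_derive_fV (is_derive_fX (n - 2)%N db) (b0 (n - 2)%N).
  apply: is_derive_cong (is_derive_fM dom (is_derive_fB (is_derive_fM dw du1)
    (is_derive_fM du dw1))) _.
  have domE : - ((n - 2)%:R * (1 - enorm y ^+ 2) ^+ (n - 2).-1 * (0 - 2 * y ord0 i)) /
      ((1 - enorm y ^+ 2) ^+ (n - 2)) ^+ 2 =
      2 * (n%:R - 2) * y ord0 i * (1 - enorm y ^+ 2) ^- n.-1.
    by apply: deriv_weightE => //; rewrite gt_eqF// uball_defect.
  by rewrite domE /V' /om; ring.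
apply/eqP; transitivity (\int[nu]_(y in uball) (\sum_(i < n) V' i y)); last first.
  rewrite Rintegral_sum.
  - by apply: big1 => i _; apply: (Rintegral_partial_eq0 r1 (dV i) (cV' i) (V0 i)).
  - exact: measurable_uball.
  - move=> i; apply: (integrable_compact_support r1) => y yb; last exact: cV'.
    by move=> /(V0 i _ yb)[].
apply: eq_Rintegral => y; rewrite inE => yb.
have bn0 : 1 - enorm y ^+ 2 != 0 by rewrite gt_eqF// uball_defect.
pose c1 := 2 * (n%:R - 2) * (1 - enorm y ^+ 2) ^- n.-1.
transitivity (\sum_(i < n) (c1 * w y * (y ord0 i * u1 i y) -
    c1 * u y * (y ord0 i * w1 i y) + (om y * w y * u2 i y - om y * u y * w2 i y))).
  rewrite big_split/= !sumrB -!mulr_sumr /c1 /om /hlap /tau_density.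
  exact: green_algebra.
by apply: eq_bigr => i _; rewrite /V' /c1 /om; ring.
Qed.

End green_identity.

(** * The squared Moebius modulus and its hyperbolic Laplacian *)

Section moebius.
Context {R : realType} {n : nat}.
Local Notation E := 'rV[R]_n.
Implicit Types x y z : E.

Definition dot x y : R := \sum_(i < n) x ord0 i * y ord0 i.

(** This is |x - y|^2, expanded into a polynomial in y. *)
Definition mnum x y : R := enorm x ^+ 2 - 2 * dot x y + enorm y ^+ 2.

(** This is [x, y]^2, expanded into a polynomial in y. *)
Definition mden x y : R := 1 - 2 * dot x y + enorm x ^+ 2 * enorm y ^+ 2.

(** The square of |phi_x(y)|; unlike the modulus, it is smooth in y at x. *)
Definition ms x y : R := mnum x y / mden x y.

Lemma mnumE x y : mnum x y = enorm (x - y) ^+ 2.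
Proof.
rewrite /mnum /dot !sqr_enorm mulr_sumr -sumrB -big_split/=.
by apply: eq_bigr => i _; rewrite !mxE; ring.
Qed.

Lemma mdenE x y :
  mden x y = enorm (x - y) ^+ 2 + (1 - enorm x ^+ 2) * (1 - enorm y ^+ 2).
Proof. by rewrite -mnumE /mden /mnum; ring. Qed.

(** The bound comes from 2 x.y <= t |x|^2 + |y|^2 / t, with t = 2 / (1 + |x|^2)
    chosen so that the result is nonnegative up to |y| = 1. *)
Lemma mden_lb x y : uball x -> enorm y <= 1 ->
  (1 - enorm x ^+ 2) ^+ 2 / 4 <= mden x y.
Proof.
move=> /uball_defect a1 y1.
have p1 : enorm y ^+ 2 <= 1 by rewrite expr_le1 ?enorm_ge0.
set a := enorm x ^+ 2 in a1 *; set p := enorm y ^+ 2 in p1 *.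
have a0 : 0 <= a by exact: sqr_ge0.
have p0 : 0 <= p by exact: sqr_ge0.
(* dle expands the square of t x - y; this t leaves a positive bound at |y| = 1. *)
pose t := 2 / (1 + a).
have a2 : 1 + a != 0 by rewrite gt_eqF; lra.
have t0 : 0 < t by rewrite divr_gt0//; lra.
have dle : 2 * dot x y <= t * a + p / t.
  have : 0 <= \sum_(i < n) (t * x ord0 i - y ord0 i) ^+ 2.
    by apply: sumr_ge0 => i _; exact: sqr_ge0.
  rewrite (_ : \sum_(i < n) _ = t ^+ 2 * a - 2 * t * dot x y + p); last first.
    rewrite /a /p !sqr_enorm /dot !mulr_sumr -sumrB -big_split/=.
    by apply: eq_bigr => i _; ring.
  move=> h; rewrite -(ler_pM2l t0) mulrDr (mulrCA t p) divff ?gt_eqF// mulr1.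
  by move: h; rewrite expr2; lra.
apply: (@le_trans _ _ (1 - (t * a + p / t) + a * p)); last first.
  by rewrite /mden -/a -/p; lra.
rewrite (_ : 1 - _ + _ = (1 - a) ^+ 2 / (2 * (1 + a)) + (1 - p) * ((1 - a) / 2)); last first.
  by rewrite /t; field.
apply: (@le_trans _ _ ((1 - a) ^+ 2 / (2 * (1 + a)))).
  rewrite ler_wpM2l ?sqr_ge0// lef_pV2 ?posrE//; lra.
by rewrite lerDl mulr_ge0//; lra.
Qed.

Lemma mden_gt0 x y : uball x -> enorm y <= 1 -> 0 < mden x y.
Proof.
move=> xb yb; apply: lt_le_trans (mden_lb xb yb).
by rewrite divr_gt0// exprn_gt0// uball_defect.
Qed.

Lemma mden_ub x y : uball x -> enorm y <= 1 -> mden x y <= 4.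
Proof.
move=> /uball_defect a1 y1.
have p1 : enorm y ^+ 2 <= 1 by rewrite expr_le1 ?enorm_ge0.
have : 0 <= \sum_(i < n) (x ord0 i + y ord0 i) ^+ 2.
  by apply: sumr_ge0 => i _; exact: sqr_ge0.
rewrite (_ : \sum_(i < n) _ = enorm x ^+ 2 + 2 * dot x y + enorm y ^+ 2); last first.
  rewrite !sqr_enorm /dot !mulr_sumr -!big_split/=.
  by apply: eq_bigr => i _; ring.
rewrite /mden; have := sqr_ge0 (enorm x); have := sqr_ge0 (enorm y).
move: (dot x y) => d; nra.
Qed.

Lemma ms_compl x y : uball x -> enorm y <= 1 ->
  1 - ms x y = (1 - enorm x ^+ 2) * (1 - enorm y ^+ 2) / mden x y.
Proof.
move=> xb yb; have m0 := mden_gt0 xb yb; rewrite /ms mnumE.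
have := mdenE x y; set A := enorm (x - y) ^+ 2; set B := mden x y in m0 * => e.
have B0 : B != 0 by rewrite gt_eqF.
by rewrite -[1 in LHS](divff B0) -mulrBl e; congr (_ / _); ring.
Qed.

Lemma ms_ge0 x y : uball x -> enorm y <= 1 -> 0 <= ms x y.
Proof.
by move=> xb yb; rewrite divr_ge0 ?mnumE ?sqr_ge0// ltW// mden_gt0.
Qed.

Lemma ms_lt1 x y : uball x -> uball y -> ms x y < 1.
Proof.
move=> xb yb; rewrite -subr_gt0 ms_compl//; last exact: ltW.
by rewrite !mulr_gt0 ?invr_gt0 ?uball_defect// mden_gt0// ltW.
Qed.

Lemma ms_eq0 x y : uball x -> uball y -> ms x y = 0 -> y = x.
Proof.
move=> xb yb /eqP; rewrite mulf_eq0 invr_eq0 orbC.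
rewrite gt_eqF ?mden_gt0 ?ltW//= mnumE sqrf_eq0 => /eqP/enorm_eq0/eqP.
by rewrite subr_eq0 => /eqP.
Qed.

Lemma is_derive_dot x y (i : 'I_n) :
  is_derive y (delta_mx ord0 i) (dot x) (x ord0 i).
Proof.
apply: is_derive_cong.
  apply: is_derive_fsum => j; apply: is_derive_fZ; exact: is_derive_coord.
rewrite (bigD1 i)//= mxE !eqxx mulr1 big1 ?addr0// => j ji.
by rewrite mxE eqxx (negbTE ji) mulr0.
Qed.

Lemma continuous_dot x y : {for y, continuous (dot x)}.
Proof.
apply: cont_sum => i; apply: contM; [exact: cont_cst|exact: coord_continuous].
Qed.

Let dnum x i y : R := 2 * y ord0 i - 2 * x ord0 i.
Let dden x i y : R := 2 * enorm x ^+ 2 * y ord0 i - 2 * x ord0 i.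

Lemma is_derive_mnum x y i : is_derive y (delta_mx ord0 i) (mnum x) (dnum x i y).
Proof.
apply: is_derive_cong (is_derive_fD (is_derive_fB (is_derive_cst _ _ _)
  (is_derive_fZ 2 (is_derive_dot x y i))) (is_derive_enorm2 y i)) _.
by rewrite /dnum; ring.
Qed.

Lemma is_derive_mden x y i : is_derive y (delta_mx ord0 i) (mden x) (dden x i y).
Proof.
apply: is_derive_cong (is_derive_fD (is_derive_fB (is_derive_cst _ _ _)
  (is_derive_fZ 2 (is_derive_dot x y i)))
  (is_derive_fZ (enorm x ^+ 2) (is_derive_enorm2 y i))) _.
by rewrite /dden; ring.
Qed.

Lemma continuous_mnum x y : {for y, continuous (mnum x)}.
Proof.
apply: contD; last exact: continuous_enorm2.
by apply: contB; [exact: cont_cst|apply: contM; [exact: cont_cst|exact: continuous_dot]].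
Qed.

Lemma continuous_mden x y : {for y, continuous (mden x)}.
Proof.
apply: contD; last by apply: contM; [exact: cont_cst|exact: continuous_enorm2].
by apply: contB; [exact: cont_cst|apply: contM; [exact: cont_cst|exact: continuous_dot]].
Qed.

Definition ms1 x (i : 'I_n) y : R :=
  (dnum x i y * mden x y - mnum x y * dden x i y) / mden x y ^+ 2.

Definition ms2 x (i : 'I_n) y : R :=
  (2 * mden x y - mnum x y * (2 * enorm x ^+ 2)) / mden x y ^+ 2 -
  2 * dden x i y * (dnum x i y * mden x y - mnum x y * dden x i y) / mden x y ^+ 3.

Lemma C2_ball_ms x : uball x -> C2_ball (ms x) (ms1 x) (ms2 x).
Proof.
move=> xb i y yb; have m0 : mden x y != 0 by rewrite gt_eqF// mden_gt0// ltW.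
have m20 k : mden x y ^+ k != 0 by rewrite expf_neq0.
have dc := is_derive_coord y (delta_mx ord0 i) i; rewrite mxE !eqxx /= in dc.
have ddn : is_derive y (delta_mx ord0 i) (dnum x i) 2.
  apply: is_derive_cong (is_derive_fB (is_derive_fZ 2 dc) (is_derive_cst _ _ _)) _.
  by ring.
have ddd : is_derive y (delta_mx ord0 i) (dden x i) (2 * enorm x ^+ 2).
  apply: is_derive_cong (is_derive_fB (is_derive_fZ (2 * enorm x ^+ 2) dc) (is_derive_cst _ _ _)) _.
  by ring.
have dN := is_derive_mnum x y i; have dD := is_derive_mden x y i.
have cN := @continuous_mnum x y; have cD := @continuous_mden x y.
have cdn : {for y, continuous (dnum x i)}.
  by apply: contB; [apply: contM; [exact: cont_cst|exact: coord_continuous]|exact: cont_cst].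
have cdd : {for y, continuous (dden x i)}.
  by apply: contB; [apply: contM; [exact: cont_cst|exact: coord_continuous]|exact: cont_cst].
have cnum : {for y, continuous (fun z => dnum x i z * mden x z - mnum x z * dden x i z)}.
  by apply: contB; exact: contM.
split.
- apply: is_derive_cong (is_derive_fM dN (is_derive_fV dD m0)) _.
  by rewrite /ms1; field.
- apply: is_derive_cong (is_derive_fM (is_derive_fB (is_derive_fM ddn dD)
    (is_derive_fM dN ddd)) (is_derive_fV (is_derive_fX 2 dD) (m20 2))) _.
  by rewrite /ms2 /=; field.
- by apply: contM => //; apply: contV.
- by apply: contM => //; apply: contV => //; exact: contX.
- apply: contB; apply: contM; try by apply: contV => //; exact: contX.
    by apply: contB; apply: contM => //; exact: cont_cst.
  by apply: contM => //; apply: contM => //; exact: cont_cst.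
Qed.

Let sum_quad x y (p q r s : R) :
  \sum_(i < n) (p * y ord0 i + q * x ord0 i) * (r * y ord0 i + s * x ord0 i) =
  p * r * enorm y ^+ 2 + (p * s + q * r) * dot x y + q * s * enorm x ^+ 2.
Proof.
rewrite !sqr_enorm /dot !mulr_sumr -!big_split/=.
by apply: eq_bigr => i _; ring.
Qed.

(** Conformality of phi_x: the hyperbolic length of the gradient of s is what it
    would be for x = 0, that is s = |y|^2. *)
Lemma ms_gradient x y : uball x -> uball y ->
  (1 - enorm y ^+ 2) ^+ 2 * (\sum_(i < n) ms1 x i y ^+ 2) =
  4 * ms x y * (1 - ms x y) ^+ 2.
Proof.
move=> xb yb; have m0 : mden x y != 0 by rewrite gt_eqF// mden_gt0// ltW.
pose p := 2 * (mden x y - enorm x ^+ 2 * mnum x y) / mden x y ^+ 2.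
pose q := 2 * (mnum x y - mden x y) / mden x y ^+ 2.
rewrite (_ : \sum_(i < n) _ = \sum_(i < n) (p * y ord0 i + q * x ord0 i) *
    (p * y ord0 i + q * x ord0 i)); last first.
  by apply: eq_bigr => i _; rewrite /ms1 /dnum /dden /p /q; field.
rewrite sum_quad /p /q /ms; move: m0; rewrite /mnum /mden.
move: (enorm x ^+ 2) (enorm y ^+ 2) (dot x y) => a b d m0.
by field.
Qed.

(** Moebius invariance, by direct computation: the value is a function of s alone,
    the same as for x = 0. *)
Lemma hlap_ms x y : uball x -> uball y ->
  hlap (ms1 x) (ms2 x) y =
  2 * n%:R * (1 - ms x y) ^+ 2 + 4 * (n%:R - 2) * ms x y * (1 - ms x y).
Proof.
move=> xb yb; have m0 : mden x y != 0 by rewrite gt_eqF// mden_gt0// ltW.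
pose p := 2 * (mden x y - enorm x ^+ 2 * mnum x y) / mden x y ^+ 2.
pose q := 2 * (mnum x y - mden x y) / mden x y ^+ 2.
have e1 i : ms1 x i y = p * y ord0 i + q * x ord0 i.
  by rewrite /ms1 /dnum /dden /p /q; field.
have e2 i : ms2 x i y = p - (4 * enorm x ^+ 2 / mden x y * y ord0 i -
    4 / mden x y * x ord0 i) * (p * y ord0 i + q * x ord0 i).
  by rewrite /ms2 /dnum /dden /p /q; field.
rewrite /hlap; under eq_bigr do rewrite e2.
rewrite sumrB sumr_const card_ord -[p *+ n]mulr_natl.
rewrite (eq_bigr (fun i => (4 * enorm x ^+ 2 / mden x y * y ord0 i +
    (- (4 / mden x y)) * x ord0 i) * (p * y ord0 i + q * x ord0 i))); last first.
  by move=> i _; rewrite mulNr.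
rewrite sum_quad.
rewrite [X in _ + _ * X](eq_bigr (fun i => (1 * y ord0 i + 0 * x ord0 i) * (p * y ord0 i + q * x ord0 i))); last first.
  by move=> i _; rewrite e1; ring.
rewrite sum_quad /p /q /ms; move: m0; rewrite /mnum /mden.
move: (enorm x ^+ 2) (enorm y ^+ 2) (dot x y) n%:R => a b d N m0.
by field.
Qed.

Lemma C2_ball_comp x (F F1 F2 : R -> R) : uball x ->
  (forall t : R, 0 <= t < 1 -> is_derive t (1 : R) F (F1 t)) ->
  (forall t : R, 0 <= t < 1 -> is_derive t (1 : R) F1 (F2 t)) ->
  (forall t : R, 0 <= t < 1 -> {for t, continuous F2}) ->
  C2_ball (fun y => F (ms x y)) (fun i y => F1 (ms x y) * ms1 x i y)
    (fun i y => F2 (ms x y) * ms1 x i y ^+ 2 + F1 (ms x y) * ms2 x i y).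
Proof.
move=> xb dF dF1 cF2 i y yb.
have [ds ds1 cs cs1 cs2] := C2_ball_ms xb i yb.
have s1 : 0 <= ms x y < 1 by rewrite ms_lt1// ms_ge0// ltW.
have der_cont (G G' : R -> R) t : is_derive t (1 : R) G (G' t) -> {for t, continuous G}.
  by move=> [dG _]; exact/differentiable_continuous/derivable1_diffP.
have cF : {for ms x y, continuous F} by exact/der_cont/dF.
have cF1 : {for ms x y, continuous F1} by exact/der_cont/dF1.
have cFs := cont_comp cs cF; have cF1s := cont_comp cs cF1.
have cF2s := cont_comp cs (cF2 _ s1).
split=> //.
- exact: is_derive_chain (dF _ s1) ds.
- apply: is_derive_cong (is_derive_fM (is_derive_chain (dF1 _ s1) ds) ds1) _.
  by ring.
- exact: contM.
- by apply: contD; [apply: contM => //; exact: contX|exact: contM].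
Qed.

Lemma hlap_comp x y (F1 F2 : R -> R) : uball x -> uball y ->
  hlap (fun i y => F1 (ms x y) * ms1 x i y)
    (fun i y => F2 (ms x y) * ms1 x i y ^+ 2 + F1 (ms x y) * ms2 x i y) y =
  4 * ms x y * (1 - ms x y) ^+ 2 * F2 (ms x y) +
  (2 * n%:R * (1 - ms x y) ^+ 2 + 4 * (n%:R - 2) * ms x y * (1 - ms x y)) * F1 (ms x y).
Proof.
move=> xb yb; rewrite -hlap_ms// -ms_gradient// /hlap big_split/= -!mulr_sumr.
rewrite (_ : \sum_(i < n) y ord0 i * (F1 (ms x y) * ms1 x i y) =
    F1 (ms x y) * \sum_(i < n) y ord0 i * ms1 x i y); first by ring.
by rewrite mulr_sumr; apply: eq_bigr => i _; ring.
Qed.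

End moebius.

(** * A smooth step *)

Section smoothstep.
Context {R : realType}.
Local Notation L := (@lebesgue_measure R).
Implicit Types t : R.

(** Used at the two points where the step function is glued. *)
Lemma is_derive_quadratic_bound (g : R -> R) (a C : R) :
  (forall t, `|g t - g a| <= C * (t - a) ^+ 2) -> is_derive a (1 : R) g 0.
Proof.
move=> gC.
have C0 : 0 <= C.
  have := gC (a + 1); rewrite addrAC subrr add0r expr1n mulr1.
  exact: le_trans.
have h : (fun h : R => h^-1 *: ((g \o shift a) (h *: 1) - g a)) @ 0^' --> (0 : R).
  apply/cvgr0Pnorm_le => e e0; near=> h.
  have h0 : h != 0 by near: h; exact: nbhs_dnbhs_neq.
  rewrite /= [h *: 1]mulr1 normrZ normfV.
  rewrite ler_pdivrMl ?normr_gt0//.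
  apply: (le_trans (gC _)); rewrite addrK -[h ^+ 2]real_normK ?num_real//.
  rewrite expr2 mulrA mulrC ler_wpM2l//.
  have : `|h| <= e / (C + 1).
    near: h; apply: nbhs_dnbhs.
    have ec : 0 < e / (C + 1) by rewrite divr_gt0//; lra.
    near=> h; rewrite -[h]subr0 distrC; near: h.
    apply: filterS (nbhsx_ballx (0 : R) _ ec) => z /=; rewrite /ball/= => /ltW //.
  rewrite ler_pdivlMr; last by lra.
  by rewrite mulrC; have := normr_ge0 h; nra.
by apply: DeriveDef; [apply/cvg_ex; exists 0|exact/cvg_lim].
Unshelve. all: by end_near. Qed.

Definition clip t : R := Num.max 0 (Num.min 1 (t - 1)).
(** A C^1 step is enough, since the profile is an integral of the cutoff and thus
    of class C^2. *)
Definition hstep t : R := 3 * clip t ^+ 2 - 2 * clip t ^+ 3.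
(** The derivative of [hstep], supported in [1, 2]. *)
Definition kbump t : R := 6 * clip t * (1 - clip t).

Lemma clip_itv t : 0 <= clip t <= 1.
Proof. by rewrite /clip le_max lexx/= ge_max ler01 ge_min lexx. Qed.

Lemma clip_le t : t <= 1 -> clip t = 0.
Proof. by move=> t1; rewrite /clip max_l// ge_min subr_le0 t1 orbT. Qed.

Lemma clip_ge t : 2 <= t -> clip t = 1.
Proof.
by move=> t2; rewrite /clip min_l; [rewrite max_r//; exact: ler01|lra].
Qed.

Lemma clip_mid t : 1 <= t <= 2 -> clip t = t - 1.
Proof. by move=> /andP[t1 t2]; rewrite /clip min_r; [rewrite max_r//|]; lra. Qed.

Lemma clip_continuous : continuous clip.
Proof.
move=> t; apply: (@continuous_max _ _ (cst 0) (fun t => Num.min 1 (t - 1))).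
  exact: cvg_cst.
apply: (@continuous_min _ _ (cst 1) (fun t => t - 1)); first exact: cvg_cst.
by apply: cvgB; [exact: cvg_id|exact: cvg_cst].
Qed.

Lemma hstep_itv t : 0 <= hstep t <= 1.
Proof.
have /andP[z0 z1] := clip_itv t; rewrite /hstep; move: (clip t) z0 z1 => z z0 z1.
have e : 3 * z ^+ 2 - 2 * z ^+ 3 = z ^+ 2 * (3 - 2 * z) by ring.
have e' : 1 - (3 * z ^+ 2 - 2 * z ^+ 3) = (1 - z) ^+ 2 * (1 + 2 * z) by ring.
apply/andP; split; first by rewrite e mulr_ge0 ?sqr_ge0//; lra.
by rewrite -subr_ge0 e' mulr_ge0 ?sqr_ge0//; lra.
Qed.

Lemma hstep_le t : t <= 1 -> hstep t = 0.
Proof. by move=> /clip_le t1; rewrite /hstep t1; ring. Qed.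

Lemma hstep_ge t : 2 <= t -> hstep t = 1.
Proof. by move=> /clip_ge t1; rewrite /hstep t1; ring. Qed.

Lemma kbump_le t : t <= 1 -> kbump t = 0.
Proof. by move=> /clip_le t1; rewrite /kbump t1; ring. Qed.

Lemma kbump_ge t : 2 <= t -> kbump t = 0.
Proof. by move=> /clip_ge t1; rewrite /kbump t1; ring. Qed.

Lemma kbump_itv t : 0 <= kbump t <= 6.
Proof.
have /andP[z0 z1] := clip_itv t; rewrite /kbump; move: (clip t) z0 z1 => z z0 z1.
by apply/andP; split; nra.
Qed.

Lemma kbump_continuous : continuous kbump.
Proof.
move=> t.
have c1 := contM (@cont_cst R _ t 6) (@clip_continuous t).
exact: (contM c1 (contB (@cont_cst R _ t 1) (@clip_continuous t))).
Qed.

Lemma is_derive_hstep t : is_derive t (1 : R) hstep (kbump t).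
Proof.
have [t1|t1|->] := ltgtP t 1; last 1 first.
- rewrite kbump_le//; apply: (@is_derive_quadratic_bound _ _ 3) => s.
  rewrite (hstep_le (lexx 1)) subr0 ger0_norm; last by have /andP[] := hstep_itv s.
  have [s1|s1] := leP s 1; first by rewrite hstep_le// mulr_ge0 ?sqr_ge0.
  have /andP[z0 z1] := clip_itv s.
  have zs : clip s <= s - 1.
    by rewrite /clip ge_max ge_min lexx orbT andbT; lra.
  apply: (@le_trans _ _ (3 * clip s ^+ 2)).
    by rewrite /hstep lerBlDr lerDl mulr_ge0 ?exprn_ge0.
  by rewrite ler_pM2l// ler_pXn2r ?nnegrE//; lra.
- rewrite kbump_le ?ltW//.
  apply: (near_eq_is_derive _ (is_derive_cst (0 : R) t (1 : R))).
  near=> s; rewrite hstep_le//; apply: ltW; near: s; exact: lt_nbhsl.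
have [t2|t2|->] := ltgtP t 2; last 1 first.
- rewrite kbump_ge//; apply: (@is_derive_quadratic_bound _ _ 3) => s.
  rewrite (hstep_ge (lexx 2)) distrC ger0_norm; last first.
    by rewrite subr_ge0; have /andP[] := hstep_itv s.
  have [s1|s1] := leP 2 s; first by rewrite hstep_ge// subrr mulr_ge0 ?sqr_ge0.
  have /andP[z0 z1] := clip_itv s.
  have zs : 1 - clip s <= 2 - s.
    by rewrite lerBlDr -lerBlDl /clip le_max le_min; apply/orP; right; apply/andP; split; lra.
  apply: (@le_trans _ _ (3 * (1 - clip s) ^+ 2)).
    rewrite -subr_ge0 (_ : _ - _ = 2 * (1 - clip s) ^+ 3); last by rewrite /hstep; ring.
    by rewrite mulr_ge0 ?exprn_ge0//; lra.
  rewrite ler_pM2l// -[leRHS]sqrrN opprB ler_pXn2r ?nnegrE//; lra.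
- have dp : is_derive t (1 : R) (fun t : R => 3 * (t - 1) ^+ 2 - 2 * (t - 1) ^+ 3) (kbump t).
    have d1 := is_derive_fB (is_derive_id t (1 : R)) (is_derive_cst (1 : R) t 1).
    apply: is_derive_cong (is_derive_fB (is_derive_fZ 3 (is_derive_fX 2 d1))
      (is_derive_fZ 2 (is_derive_fX 3 d1))) _.
    by rewrite /kbump clip_mid/=; [ring|lra].
  apply: near_eq_is_derive dp; near=> s.
  rewrite /hstep clip_mid//; apply/andP; split; apply: ltW; near: s.
    exact: lt_nbhsr.
  exact: lt_nbhsl.
- rewrite kbump_ge ?ltW//.
  apply: (near_eq_is_derive _ (is_derive_cst (1 : R) t (1 : R))).
  near=> s; rewrite hstep_ge//; apply: ltW; near: s; exact: lt_nbhsr.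
Unshelve. all: by end_near. Qed.

Lemma integral_kbump (c V : R) : 0 < c -> 2 <= c * V ->
  (\int[L]_(v in `[0%R, V]) (kbump (c * v))%:E = (c^-1)%:E)%E.
Proof.
move=> c0 cV.
have V0 : 0 < V by rewrite -(pmulr_rgt0 _ c0); lra.
have dh v : is_derive v (1 : R) (fun v => c^-1 * hstep (c * v)) (kbump (c * v)).
  apply: is_derive_cong (is_derive_fZ c^-1 (is_derive_chain (is_derive_hstep _)
    (is_derive_fZ c (is_derive_id v (1 : R))))) _.
  by rewrite mulr1 mulrC mulfK// gt_eqF.
have ch v : {for v, continuous (fun v => c^-1 * hstep (c * v))}.
  by have [dv _] := dh v; exact/differentiable_continuous/derivable1_diffP.
rewrite (@continuous_FTC2 _ _ (fun v => c^-1 * hstep (c * v)))//.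
- have h0 : hstep (c * 0) = 0 by apply: hstep_le; rewrite mulr0.
  by rewrite (hstep_ge cV) h0 -EFinB !mulr1 mulr0 subr0.
- apply: continuous_subspaceT => v.
  apply: (@cont_comp _ _ kbump); last exact: kbump_continuous.
  by apply: contM; [exact: cont_cst|exact: cvg_id].
- split; first by move=> v _; have [] := dh v.
  + by apply: cvg_at_right_filter; exact: ch.
  + by apply: cvg_at_left_filter; exact: ch.
- by move=> v _; rewrite derive1E; have [] := dh v.
Qed.

End smoothstep.

(** * Radial profiles with prescribed hyperbolic Laplacian *)

Section radial.
Context {R : realType} (n : nat).
Hypothesis n3 : (3 <= n)%N.
Local Notation L := (@lebesgue_measure R).
Implicit Types t : R.

(** The power t^(-p/2). *)
Definition sp (p : nat) t : R := Num.sqrt t ^- p.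

Lemma sp_ge0 p t : 0 <= sp p t.
Proof. by rewrite invr_ge0 exprn_ge0// sqrtr_ge0. Qed.

Lemma is_derive_sp p t : 0 < t ->
  is_derive t (1 : R) (sp p) (- (p%:R / 2) * sp p.+2 t).
Proof.
move=> t0; have s0 : Num.sqrt t != 0 by rewrite gt_eqF// sqrtr_gt0.
apply: is_derive_cong (is_derive_fV (is_derive_fX p (is_derive1_sqrt t0)) _) _.
  by rewrite expf_neq0.
rewrite /sp; case: p => [|p] /=; first by rewrite !mul0r oppr0 !mul0r.
have P0 : Num.sqrt t ^+ p != 0 by rewrite expf_neq0.
rewrite !exprS; move: s0 P0; set s := Num.sqrt t; set P := s ^+ p => s0 P0.
by field; rewrite s0 P0.
Qed.

(** Minus the derivative of the Green function as a function of t = s: the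
    substitution t = r^2 in its defining integral. *)
Definition gam t : R := (2 * n%:R)^-1 * (1 - t) ^+ (n - 2) * sp n t.

Definition dgam t : R := (2 * n%:R)^-1 *
  (- (n - 2)%:R * (1 - t) ^+ (n - 3) * sp n t -
   (n%:R / 2) * (1 - t) ^+ (n - 2) * sp n.+2 t).

Lemma is_derive_gam t : 0 < t -> is_derive t (1 : R) gam (dgam t).
Proof.
move=> t0.
have d1 := is_derive_fB (is_derive_cst (1 : R) t 1) (is_derive_id t (1 : R)).
apply: is_derive_cong (is_derive_fM (is_derive_fZ (2 * n%:R)^-1
  (is_derive_fX (n - 2) d1)) (is_derive_sp n t0)) _.
rewrite /dgam (_ : (n - 2).-1 = (n - 3)%N); last by rewrite -subnS.
by ring.
Qed.

Lemma derive_continuous (f : R -> R) t (d : R) : is_derive t (1 : R) f d ->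
  {for t, continuous f}.
Proof. by move=> [df _]; exact/differentiable_continuous/derivable1_diffP. Qed.

Lemma continuous_sp p t : 0 < t -> {for t, continuous (sp p)}.
Proof. by move=> t0; exact: derive_continuous (is_derive_sp p t0). Qed.

Lemma continuous_gam t : 0 < t -> {for t, continuous gam}.
Proof. by move=> t0; exact: derive_continuous (is_derive_gam t0). Qed.

Lemma continuous_dgam t : 0 < t -> {for t, continuous dgam}.
Proof.
move=> t0.
have c1 := contB (@cont_cst R _ t 1) (@cvg_id R (nbhs t)).
apply: contM; first exact: cont_cst.
apply: contB; (apply: contM; last exact: continuous_sp);
  by apply: contM; [exact: cont_cst|exact: contX].
Qed.

Lemma gam_ge0 t : t <= 1 -> 0 <= gam t.
Proof.
move=> t1; rewrite !mulr_ge0 ?invr_ge0 ?sp_ge0 ?mulr_ge0//.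
by rewrite exprn_ge0// subr_ge0.
Qed.

(** eta is of class C^1 with derivative k, and both vanish near 0, where [gam] is
    singular. *)
Definition cutoff (eta k : R -> R) (a : R) : Prop :=
  [/\ 0 < a, (forall t, is_derive t (1 : R) eta (k t)), continuous k &
      forall t, t <= a -> eta t = 0 /\ k t = 0].

Definition rad1 (eta : R -> R) t : R := - (eta t * gam t).

Definition rad2 (eta k : R -> R) t : R := - (k t * gam t + eta t * dgam t).

(** The integral of eta * gam over [t, 1], by [radE].  It is written as a difference
    of integrals from -1, so that the fundamental theorem applies at t = 0,
    which is the value of s at the pole, as well. *)
Definition rad (eta : R -> R) t : R :=
  \int[L]_(s in `[-1, t]) rad1 eta s - \int[L]_(s in `[-1, 1]) rad1 eta s.

Section cutoff_radial.
Variables (eta k : R -> R) (a : R).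
Hypothesis ek : cutoff eta k a.

Let a0 : 0 < a. Proof. by have [] := ek. Qed.

Lemma is_derive_rad1 t : is_derive t (1 : R) (rad1 eta) (rad2 eta k t).
Proof.
have [_ de _ e0] := ek.
have [t0|t0] := ltP 0 t.
  have e : (fun y => -1 * (eta y * gam y)) = rad1 eta.
    by apply/funext => y; rewrite mulN1r.
  rewrite -e.
  apply: is_derive_cong (is_derive_fZ (-1) (is_derive_fM (de t) (is_derive_gam t0))) _.
  by rewrite mulN1r.
have ta : t < a by apply: le_lt_trans a0.
rewrite /rad2 (e0 _ (ltW ta)).1 (e0 _ (ltW ta)).2 !mul0r addr0 oppr0.
apply: near_eq_is_derive (is_derive_cst (0 : R) t (1 : R)).
near=> s; rewrite /rad1 (e0 s _).1 ?mul0r ?oppr0//.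
by apply: ltW; near: s; exact: lt_nbhsl.
Unshelve. all: by end_near. Qed.

Lemma continuous_rad1 : continuous (rad1 eta).
Proof. by move=> t; exact: derive_continuous (is_derive_rad1 t). Qed.

Lemma continuous_rad2 : continuous (rad2 eta k).
Proof.
have [_ de ck e0] := ek; move=> t.
have [t0|t0] := ltP 0 t.
  rewrite (_ : rad2 eta k = fun t => 0 - (k t * gam t + eta t * dgam t)); last first.
    by apply/funext => s; rewrite /rad2 sub0r.
  apply: (contB (@cont_cst R _ t 0)); apply: contD; apply: contM.
  - exact: ck.
  - exact: continuous_gam.
  - exact: derive_continuous (de t).
  - exact: continuous_dgam.
have ta : t < a by apply: le_lt_trans a0.
apply: (@cont_near_eq R _ (fun _ => 0)); last exact: cont_cst.
  by rewrite /rad2 (e0 _ (ltW ta)).1 (e0 _ (ltW ta)).2 !mul0r addr0 oppr0.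
near=> s.
have sa : s <= a by apply: ltW; near: s; exact: lt_nbhsl.
by rewrite /rad2 (e0 _ sa).1 (e0 _ sa).2 !mul0r addr0 oppr0.
Unshelve. all: by end_near. Qed.

Let rad1_integrable (u v : R) : L.-integrable `[u, v] (EFin \o rad1 eta).
Proof.
apply: continuous_compact_integrable; first exact: segment_compact.
exact: continuous_subspaceT continuous_rad1.
Qed.

Lemma is_derive_rad t : -1 < t -> is_derive t (1 : R) (rad eta) (rad1 eta t).
Proof.
move=> t1.
have t2 : t < t + 1 by rewrite ltrDl.
have [d1 d2] := continuous_FTC1_closed t2 (rad1_integrable (-1) (t + 1)) t1
  (continuous_rad1 (x := t)).
rewrite derive1E in d2.
have dF := DeriveDef d1 d2.
rewrite /rad; move: (\int[L]_(s in `[-1, 1]) _) => c.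
have := is_derive_fB dF (is_derive_cst c t (1 : R)).
by rewrite subr0.
Qed.

Lemma radE t : 0 <= t <= 1 -> rad eta t = \int[L]_(s in `[t, 1]) (eta s * gam s).
Proof.
move=> /andP[t0 t1].
have := @Rintegral_itvB R (rad1 eta) (BLeft (-1)) (BRight 1) t (rad1_integrable _ _).
rewrite !bnd_simp => /(_ ltac:(lra) t1).
rewrite Rintegral_itv_obnd_cbnd; last first.
  apply: integrableS (rad1_integrable t 1) => //; exact: subset_itv_oc_cc.
move=> h; rewrite /rad -opprB h.
rewrite -[LHS]mulN1r -RintegralZl//.
by apply: eq_Rintegral => s _; rewrite /rad1 mulN1r opprK.
Qed.

(** Without the cutoff both terms cancel; what remains is the term in which the
    derivative falls on eta. *)
Lemma rad_lap t : 0 <= t < 1 ->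
  4 * t * (1 - t) ^+ 2 * rad2 eta k t +
  (2 * n%:R * (1 - t) ^+ 2 + 4 * (n%:R - 2) * t * (1 - t)) * rad1 eta t =
  - (2 / n%:R) * (sp (n - 2) t * (1 - t) ^+ n * k t).
Proof.
move=> /andP[t0 t1]; have [_ _ _ e0] := ek.
have [ta|ta] := leP t a.
  by rewrite /rad1 /rad2 (e0 _ ta).1 (e0 _ ta).2; ring.
have {}t0 : 0 < t by apply: lt_trans ta.
have s0 : Num.sqrt t != 0 by rewrite gt_eqF// sqrtr_gt0.
rewrite /rad1 /rad2 /gam /dgam /sp.
rewrite -[in 4 * t](sqr_sqrtr (ltW t0)) -[in 4 * _ * t](sqr_sqrtr (ltW t0)).
set s := Num.sqrt t in s0 *.
have n0 : n%:R != 0 :> R by rewrite pnatr_eq0 -lt0n; apply: leq_trans n3.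
move: (eta t) (k t) (1 - t) => E K c.
rewrite natrB; last by apply: leq_trans n3.
rewrite (_ : n - 2 = (n - 3).+1)%N; last by rewrite -subSn.
have -> : s ^+ n = s ^+ (n - 3) * s ^+ 3 by rewrite -exprD subnK.
have -> : s ^+ n.+2 = s ^+ (n - 3) * s ^+ 5 
  by rewrite -exprD -[in LHS](subnK n3) -!addnS.
have -> : c ^+ n = c ^+ (n - 3) * c ^+ 3 by rewrite -exprD subnK.
rewrite !(exprS _ (n - 3)).
have P0 : s ^+ (n - 3) != 0 by rewrite expf_neq0.
move: s0 P0 n0; set P := s ^+ (n - 3); set C := c ^+ (n - 3).
move: n%:R => N s0 P0 n0.
by field; rewrite s0 P0 n0.
Qed.

End cutoff_radial.

End radial.

(** * The Green function as a limit of truncated profiles *)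

Lemma Rdominated_convergence d (T : measurableType d) (R : realType)
    (mu : {measure set T -> \bar R}) (D : set T) (f_ : nat -> T -> R)
    (f g : T -> R) : measurable D ->
  (forall j, measurable_fun D (f_ j)) -> measurable_fun D f ->
  (forall x, D x -> f_ ^~ x @ \oo --> f x) ->
  (forall j x, D x -> `|f_ j x| <= g x) -> mu.-integrable D (EFin \o g) ->
  mu.-integrable D (EFin \o f) /\
  \int[mu]_(x in D) f_ j x @[j --> \oo] --> \int[mu]_(x in D) f x.
Proof.
move=> mD mf_ mf fc fg gi.
have [] := @dominated_convergence _ _ R mu D mD (fun j => EFin \o f_ j)
  (EFin \o f) (EFin \o g).
- by move=> j; exact/measurable_EFinP.
- exact/measurable_EFinP.
- by apply: aeW => x Dx; apply/fine_cvgP; split; [exact: nearW|exact: fc].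
- exact: gi.
- by apply: aeW => x j Dx; rewrite lee_fin; exact: fg.
move=> fi _ h; split => //.
apply: fine_cvg; rewrite fineK//; exact: integrable_fin_num.
Qed.

Section radial_bounds.
Context {R : realType} (n : nat).
Hypothesis n3 : (3 <= n)%N.
Local Notation L := (@lebesgue_measure R).
Implicit Types t : R.

Definition Gam t : R := \int[L]_(s in `[t, 1]) gam n s.

Lemma continuous_within_pos (f : R -> R) (t : R) : 0 < t ->
  (forall s : R, 0 < s -> {for s, continuous f}) -> {within `[t, 1], continuous f}.
Proof.
move=> t0 cf; apply: continuous_in_subspaceT => s; rewrite inE/= in_itv/= => /andP[ts _].
by apply: cf; exact: lt_le_trans ts.
Qed.

Lemma gam_integrable t : 0 < t -> L.-integrable `[t, 1] (EFin \o gam n).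
Proof.
move=> t0; apply: continuous_compact_integrable; first exact: segment_compact.
by apply: continuous_within_pos => // s; exact: continuous_gam.
Qed.

(** A majorant of [Gam] with the same order of growth at 0 and of decay at 1. *)
Definition Gam_ub t : R := sp (n - 2) t * (1 - t) ^+ n.-1.

Let dGam_ub t : R := - ((n - 2)%:R / 2 * sp n t * (1 - t) ^+ n.-1 +
  n.-1%:R * (1 - t) ^+ (n - 2) * sp (n - 2) t).

Let is_derive_Gam_ub t : 0 < t -> is_derive t (1 : R) Gam_ub (dGam_ub t).
Proof.
move=> t0.
have d1 := is_derive_fB (is_derive_cst (1 : R) t 1) (is_derive_id t (1 : R)).
apply: is_derive_cong (is_derive_fM (is_derive_sp (n - 2) t0)
  (is_derive_fX n.-1 d1)) _.
rewrite /dGam_ub (_ : n.-1.-1 = n - 2)%N; last by case: (n) => [|[|m]]//=; rewrite subn2.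
rewrite (_ : (n - 2).+2 = n); last by rewrite -addn2 subnK// ltnW.
by ring.
Qed.

(** Both sides vanish at 1, and minus the derivative of the majorant is at least
    [gam]. *)
Lemma Gam_le t : 0 < t <= 1 -> 0 <= Gam t <= Gam_ub t.
Proof.
move=> /andP[t0 t1]; apply/andP; split.
  by apply: Rintegral_ge0 => s /=; rewrite in_itv/= => /andP[_ s1]; exact: gam_ge0.
move: t1; rewrite le_eqVlt => /predU1P[->|t1].
  rewrite /Gam set_itv1 Rintegral_set1 /Gam_ub subrr expr0n.
  by case: (n) n3 => [|[|m]]//= _; rewrite mulr0.
have cdW s : 0 < s -> {for s, continuous (fun s => - dGam_ub s)}.
  move=> s0; rewrite (_ : (fun s => - dGam_ub s) = fun s =>
    (n - 2)%:R / 2 * sp n s * (1 - s) ^+ n.-1 +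
    n.-1%:R * (1 - s) ^+ (n - 2) * sp (n - 2) s); last first.
    by apply/funext => z; rewrite /dGam_ub opprK.
  have c1 := contB (@cont_cst R _ s 1) (@cvg_id R (nbhs s)).
  apply: contD; apply: contM; try exact: continuous_sp; try exact: contX.
    by apply: contM; [exact: cont_cst|exact: continuous_sp].
  by apply: contM; [exact: cont_cst|exact: contX].
have cdWw := continuous_within_pos t0 cdW.
apply: (@le_trans _ _ (\int[L]_(s in `[t, 1]) (- dGam_ub s))).
  apply: le_Rintegral => //; first exact: gam_integrable.
    by apply: continuous_compact_integrable => //; exact: segment_compact.
  move=> s /=; rewrite in_itv/= => /andP[ts s1].
  have s0 : 0 < s by exact: lt_le_trans ts.
  have spE : sp (n - 2) s = s * sp n s.
    have -> : sp n s = sp (n - 2) s / s.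
      by rewrite /sp -[in LHS](subnK (ltnW n3)) exprD invfM sqr_sqrtr ?ltW.
    by rewrite mulrCA divff ?mulr1// gt_eqF.
  rewrite /dGam_ub spE /gam opprK.
  rewrite -(_ : (1 - s) * (1 - s) ^+ (n - 2) = (1 - s) ^+ n.-1); last first.
    by rewrite -exprS; congr (_ ^+ _); case: (n) n3 => [|[|m]]//= _; rewrite subn2.
  have cp : 0 <= (1 - s) ^+ (n - 2) * sp n s.
    by rewrite mulr_ge0 ?sp_ge0// exprn_ge0// subr_ge0.
  rewrite (_ : _ + _ = ((n - 2)%:R / 2 * (1 - s) + n.-1%:R * s) *
     ((1 - s) ^+ (n - 2) * sp n s)); last by ring.
  rewrite -mulrA ler_wpM2r//.
  have m1 : 1 <= (n - 2)%:R :> R by rewrite ler1n subn_gt0.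
  have m2 : 1 <= n.-1%:R :> R by rewrite ler1n; case: (n) n3 => [|[|m]].
  have nn : (2 * n%:R)^-1 <= 2^-1 :> R.
    by rewrite lef_pV2 ?posrE ?mulr_gt0 ?ltr0n ?ler_peMr ?ler1n//; apply: ltn_trans n3.
  apply: (le_trans nn); nra.
rewrite /Rintegral (@continuous_FTC2 _ _ (fun s => - Gam_ub s))//.
- rewrite /= /Gam_ub subrr expr0n.
  by case: (n) n3 => [|[|m]]//= _; rewrite mulr0 oppr0 sub0r opprK.
- split.
  + move=> s; rewrite in_itv/= => /andP[ts _].
    have [+ _] := is_derive_fZ (-1) (is_derive_Gam_ub (lt_trans t0 ts)).
    by rewrite (_ : (fun y => -1 * Gam_ub y) = (fun s => - Gam_ub s))//; apply/funext => y; rewrite mulN1r.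
  + apply: cvg_at_right_filter; apply: cvgN; exact: derive_continuous (is_derive_Gam_ub t0).
  + apply: cvg_at_left_filter; apply: cvgN; exact: derive_continuous (is_derive_Gam_ub ltr01).
- move=> s; rewrite in_itv/= => /andP[ts _]; rewrite derive1E.
  have [_] := is_derive_fZ (-1) (is_derive_Gam_ub (lt_trans t0 ts)).
  by rewrite (_ : (fun y => -1 * Gam_ub y) = (fun s => - Gam_ub s)) ?mulN1r//; apply/funext => y; rewrite mulN1r.
Qed.

Lemma rad_bounds (eta k : R -> R) (a : R) t : cutoff eta k a ->
  (forall s, 0 <= eta s <= 1) -> 0 < t <= 1 -> 0 <= rad n eta t <= Gam t.
Proof.
move=> ek e01 /andP[t0 t1]; rewrite (radE n ek); last by rewrite ltW.
have ge s : `[t, 1]%classic s -> 0 <= gam n s.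
  by rewrite /= in_itv/= => /andP[_ s1]; exact: gam_ge0.
apply/andP; split.
  by apply: Rintegral_ge0 => s /ge gs; have /andP[? _] := e01 s; exact: mulr_ge0.
apply: le_Rintegral => //.
- apply: continuous_compact_integrable; first exact: segment_compact.
  apply: continuous_within_pos => // s s0; apply: contM; last exact: continuous_gam.
  by have [_ de _ _] := ek; exact: derive_continuous (de s).
- exact: gam_integrable.
- by move=> s /ge gs; have /andP[_ ?] := e01 s; rewrite ler_piMl.
Qed.

Lemma rad_eq0 (eta k : R -> R) (a b : R) t : cutoff eta k a ->
  (forall s, b <= s -> eta s = 0) -> 0 <= t -> b <= t <= 1 -> rad n eta t = 0.
Proof.
move=> ek e0 t0 /andP[bt t1]; rewrite (radE n ek) ?t0//.
transitivity (\int[L]_(s in `[t, 1]) (0 : R)); last by rewrite Rintegral_cst ?mul0r.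
apply: eq_Rintegral; move=> s /[!inE]/=; rewrite in_itv/= => /andP[ts _]; rewrite e0 ?mul0r//; exact: le_trans ts.
Qed.

Lemma rad_Gam (eta k : R -> R) (a b : R) t : cutoff eta k a ->
  (forall s, b <= s -> eta s = 1) -> 0 <= t -> b <= t <= 1 -> rad n eta t = Gam t.
Proof.
move=> ek e0 t0 /andP[bt t1]; rewrite (radE n ek) ?t0//.
apply: eq_Rintegral => s /[!inE]/=; rewrite in_itv/= => /andP[ts _].
by rewrite e0 ?mul1r//; exact: le_trans ts.
Qed.

Lemma rad_cvg (eta k : nat -> R -> R) (a : nat -> R) t :
  (forall j, cutoff (eta j) (k j) (a j)) -> (forall j s, 0 <= eta j s <= 1) ->
  (forall s, 0 < s < 1 -> eta ^~ s @ \oo --> (1 : R)) -> 0 < t < 1 ->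
  rad n (eta j) t @[j --> \oo] --> Gam t.
Proof.
move=> ek e01 e1 /andP[t0 t1].
have gi := gam_integrable t0.
have ei j : L.-integrable `[t, 1] (EFin \o (fun s => eta j s * gam n s)).
  apply: continuous_compact_integrable; first exact: segment_compact.
  apply: continuous_within_pos => // s s0; apply: contM; last exact: continuous_gam.
  by have [_ de _ _] := ek j; exact: derive_continuous (de s).
have eio j : L.-integrable `[t, 1[ (EFin \o (fun s => eta j s * gam n s)).
  by apply: integrableS (ei j) => //; exact: subset_itv_co_cc.
have gio : L.-integrable `[t, 1[ (EFin \o gam n).
  by apply: integrableS gi => //; exact: subset_itv_co_cc.
have rE : (fun j => rad n (eta j) t) =
    (fun j => \int[L]_(s in `[t, 1[) (eta j s * gam n s)).
  apply/funext => j; rewrite (radE n (ek j)) ?(ltW t0) ?(ltW t1)//.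
  by rewrite -Rintegral_itv_bndo_bndc.
rewrite rE /Gam -Rintegral_itv_bndo_bndc//.
have mI : measurable (`[t, 1[%classic : set R) by exact: measurable_itv.
have [] := @Rdominated_convergence _ _ R L _ (fun j s => eta j s * gam n s) (gam n) (gam n) mI.
- by move=> j; apply/measurable_EFinP; have [] := integrableP _ _ _ (eio j).
- by apply/measurable_EFinP; have [] := integrableP _ _ _ gio.
- move=> s /=; rewrite in_itv/= => /andP[ts s1]; rewrite -[X in _ --> X]mul1r.
  by apply: cvgM; [apply: e1; rewrite s1 (lt_le_trans t0)|exact: cvg_cst].
- move=> j s /=; rewrite in_itv/= => /andP[ts /ltW s1].
  rewrite normrM (ger0_norm (gam_ge0 _ s1)) ler_piMl ?gam_ge0//.
  by have /andP[? ?] := e01 j s; rewrite ger0_norm.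
- exact: gio.
by [].
Qed.

Lemma green_kernelE (x y : 'rV[R]_n) : uball x -> uball y -> x != y ->
  green_kernel x y = Gam (ms x y).
Proof.
move=> xb yb xy; have m0 := mden_gt0 xb (ltW yb).
have t1 := ms_lt1 xb yb.
have t0 : 0 < ms x y.
  rewrite lt0r ms_ge0 ?ltW// andbT; apply: contra_neq xy => /(ms_eq0 xb yb) //.
have rE : moebius_modulus x y = Num.sqrt (ms x y).
  rewrite /moebius_modulus /bracket -mdenE /ms mnumE sqrtrM ?sqr_ge0// sqrtr_sqr.
  by rewrite ger0_norm ?enorm_ge0// sqrtrV// ltW.
rewrite /green_kernel rE; move: (ms x y) t0 t1 => t t0 t1.
pose r := Num.sqrt t.
have r0 : 0 < r by rewrite sqrtr_gt0.
have rr : r ^+ 2 = t by rewrite sqr_sqrtr// ltW.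
have r1 : r < 1 by rewrite -(@ltr_pXn2r _ 2) ?nnegrE ?ltW// rr expr1n.
have dsq : derive1 (fun s : R => s ^+ 2) = (fun s => 2 * s).
  apply/funext => s; rewrite derive1E.
  have [_ ->] := is_derive_fX 2 (is_derive_id s (1 : R)).
  by rewrite mulr1 expr1.
have c2 (s : R) : {for s, continuous (fun s : R => 2 * s)}.
  by apply: contM; [exact: cont_cst|exact: cvg_id].
have csq (s : R) : {for s, continuous (fun s : R => s ^+ 2)}.
  by apply: contX; exact: cvg_id.
rewrite -RintegralZl//; last first.
  apply: continuous_compact_integrable; first exact: segment_compact.
  apply: continuous_within_pos => // s s0; apply: contM.
    by apply: contX; apply: contB; [exact: cont_cst|exact: csq].
  apply: contV; first by rewrite expf_neq0// gt_eqF.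
  by apply: contX; exact: cvg_id.
rewrite /Gam /Rintegral; apply: esym.
transitivity (fine (\int[L]_(s in `[(r ^+ 2)%R, (1 ^+ 2)%R]) (gam n s)%:E)%E).
  by rewrite rr expr1n.
rewrite (@integration_by_substitution_increasing _ (fun s => s ^+ 2) (gam n) r 1)//.
- congr fine; apply: eq_integral => s; rewrite inE/= in_itv/= => /andP[rs s1].
  have s0 : 0 < s by exact: lt_le_trans rs.
  rewrite mulrfctE /= dsq /gam /sp sqrtr_sqr gtr0_norm//; congr _%:E.
  have n0 : n%:R != 0 :> R by rewrite pnatr_eq0 -lt0n; apply: ltn_trans n3.
  rewrite -[in s ^- n](prednK (ltn_trans (isT : (0 < 2)%N) n3)) (exprS s n.-1).
  have S0 : s ^+ n.-1 != 0 by rewrite expf_neq0// gt_eqF.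
  have sn0 : s != 0 := lt0r_neq0 s0.
  move: ((1 - s ^+ 2) ^+ (n - 2)) (s ^+ n.-1) (n%:R) S0 n0 => A B N B0 N0.
  by field; rewrite B0 sn0 N0.
- exact: ltW.
- move=> u v; rewrite !in_itv/= => /andP[ru _] /andP[rv _] uv.
  by rewrite ltr_pXn2r// nnegrE ltW// (lt_le_trans r0).
- by rewrite dsq => s _; exact: c2.
- by rewrite dsq; apply/cvg_ex; exists (2 * r); apply: cvg_at_right_filter; exact: c2.
- by rewrite dsq; apply/cvg_ex; exists (2 * 1); apply: cvg_at_left_filter; exact: c2.
- split.
  + by move=> s _; have [] := is_derive_fX 2 (is_derive_id s (1 : R)).
  + by apply: cvg_at_right_filter; exact: csq.
  + by apply: cvg_at_left_filter; exact: csq.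
- rewrite expr1n; apply: continuous_within_pos; first by rewrite exprn_gt0.
  by move=> s; exact: continuous_gam.
Qed.

End radial_bounds.

(** * Concentration on the sphere: the Poisson kernel *)

Section measurability.
Context {R : realType} {n : nat}.
Local Notation E := 'rV[R]_n.

Lemma measurable_dot (x : E) : measurable_fun setT (dot x).
Proof.
apply: measurable_sum => i; apply: measurable_funM => //; exact: measurable_coor.
Qed.

Lemma measurable_mden (x : E) : measurable_fun setT (mden x).
Proof.
have m2 : measurable_fun setT (fun y : E => enorm y ^+ 2).
  by apply: measurable_funX; exact: measurable_enorm.
apply: measurable_funD; last by apply: measurable_funM.
by apply: measurable_funB => //; apply: measurable_funM => //; exact: measurable_dot.
Qed.

Lemma measurable_ms (x : E) : measurable_fun setT (ms x).
Proof.
have m2 : measurable_fun setT (fun y : E => enorm y ^+ 2).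
  by apply: measurable_funX; exact: measurable_enorm.
apply: measurable_funM.
  apply: measurable_funD => //.
  by apply: measurable_funB => //; apply: measurable_funM => //; exact: measurable_dot.
apply: (measurableT_comp (@measurable_invr R)); exact: measurable_mden.
Qed.

Lemma measurable_sp p : measurable_fun setT (@sp R p).
Proof.
apply: (measurableT_comp (@measurable_invr R)); apply: measurable_funX.
by apply: continuous_measurable_fun; exact: sqrt_continuous.
Qed.

Lemma measurable_radial_line (xi : E) :
  measurable_fun [set: measurableTypeR R] (fun r : measurableTypeR R => r *: xi : E).
Proof.
apply: measurable_fun_coorP => i.
rewrite (_ : (fun _ => _) = (fun r : measurableTypeR R => r * xi ord0 i)).
  by apply: measurable_funM.
by apply/funext => r; rewrite mxE.
Qed.

End measurability.

Section reflection.
Context {R : realType}.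
Local Open Scope ereal_scope.

Lemma ge0_integral_reflect (G : measurableTypeR R -> \bar R) :
  measurable_fun setT G -> (forall a, 0 <= G a) ->
  \int[lebesgue_measure]_a G (1 - a)%R = \int[lebesgue_measure]_a G a.
Proof.
move=> mG G0.
pose s : measurableTypeR R -> measurableTypeR R := fun a => (1 - a)%R.
have ms : measurable_fun setT s.
  by apply: measurable_funB => //.
pose m : {measure set (measurableTypeR R) -> \bar R} :=
  measure_function_pushforward__canonical__measure_function_Measure lebesgue_measure ms.
have mE A : measurable A -> lebesgue_measure A = m A.
  apply: (@lebesgue_measure_unique R m) => _ [[a b]] _ <-.
  have sE : s @^-1` `]a, b]%classic = `[(1 - b)%R, (1 - a)%R[%classic.
    have h (z : R) : ((a < 1 - z <= b) = (1 - b <= z < 1 - a))%R.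
      by apply/idP/idP => /andP[? ?]; apply/andP; split; lra.
    by apply/seteqP; split => z /=; rewrite !in_itv/= h.
  transitivity (lebesgue_measure (`[(1 - b)%R, (1 - a)%R[%classic : set R)); last first.
    by rewrite -sE.
  rewrite !lebesgue_measure_itv/= !lte_fin.
  rewrite (_ : (1 - b < 1 - a)%R = (a < b)%R); last by rewrite ltrD2l ltrN2.
  by case: ifP => // _; rewrite -!EFinB; congr _%:E; ring.
transitivity (\int[m]_a G a); last first.
  by apply: eq_measure_integral => A mA _; exact/esym/mE.
by apply: esym; exact: (@ge0_integral_pushforward _ _ _ _ _ _ ms _ setT).
Qed.

(** The variable r = 1 - e v sees the boundary point r = 1 at scale e. *)
Lemma ge0_integral_zoom (e : R) (G : measurableTypeR R -> \bar R) :
  (0 < e)%R -> measurable_fun setT G -> (forall a, 0 <= G a) ->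
  \int[lebesgue_measure]_r G r =
  e%:E * \int[lebesgue_measure]_v G (1 - e * v)%R.
Proof.
move=> e0 mG G0.
rewrite -(ge0_integral_reflect mG G0).
have mG' : measurable_fun [set: measurableTypeR R] (fun a : measurableTypeR R => G (1 - a)%R).
  apply: (measurableT_comp mG); exact: measurable_funB.
have := ge0_integral_scale1 e0 mG' (fun a => G0 (1 - a)%R) => ->.
by rewrite muleA -EFinM divff ?gt_eqF// mul1e.
Qed.

End reflection.

Section outer_limit.
Context {R : realType} (m : nat).
Local Notation n := m.+1.
Local Notation E := 'rV[R]_n.
Local Notation L := (@lebesgue_measure R).
Hypothesis n3 : (3 <= n)%N.
Variable x : E.
Hypothesis xb : uball x.

(** The factor (1 - s)^n times the density of tau, by [mjacE]: it is bounded on the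
    closed ball, although tau is not.  It is the Jacobian of phi_x. *)
Definition mjac (y : E) : R := ((1 - enorm x ^+ 2) / mden x y) ^+ n.

(** The Poisson kernel, with |xi - x|^2 replaced by [x, xi]^2, to which it is
    equal on the sphere. *)
Definition pois (y : E) : R := ((1 - enorm x ^+ 2) / mden x y) ^+ n.-1.

(** Widths of the cutoffs.  The starting value 1/4 keeps the transition regions
    [eps, 2 eps] and [1 - 2 eps, 1 - eps] from overlapping. *)
Definition eps (j : nat) : R := j.+4%:R^-1.

(** The part near s = 1 of the derivative of the cutoff, with the sign changed. *)
Definition kout (j : nat) (s : R) : R := kbump ((1 - s) / eps j) / eps j.

Definition outer (g : E -> R) (j : nat) (y : E) : R :=
  2 / n%:R * (g y * sp (n - 2) (ms x y) * kout j (ms x y) * mjac y).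

Lemma eps_gt0 j : 0 < eps j. Proof. by rewrite invr_gt0. Qed.

Lemma eps_le j : eps j <= 4^-1.
Proof. by rewrite lef_pV2 ?posrE// ler_nat. Qed.

Lemma eps_cvg0 : eps @ \oo --> (0 : R).
Proof.
have := @cvg_harmonic R; rewrite -(cvg_shiftn 3).
by under eq_fun do rewrite /harmonic addn3.
Qed.

Let a1 : 0 < 1 - enorm x ^+ 2. Proof. exact: uball_defect. Qed.

Lemma mratio_bounds y : enorm y <= 1 ->
  (1 - enorm x ^+ 2) / 4 <= (1 - enorm x ^+ 2) / mden x y <= 4 / (1 - enorm x ^+ 2).
Proof.
move=> y1; have m0 := mden_gt0 xb y1; apply/andP; split.
  by rewrite ler_wpM2l ?(ltW a1)// lef_pV2 ?posrE// mden_ub.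
rewrite ler_pdivrMr// -ler_pdivrMl ?divr_gt0//.
apply: le_trans (mden_lb xb y1); rewrite invf_div expr2.
by rewrite mulrAC.
Qed.

Lemma mjac_bounds y : enorm y <= 1 ->
  0 < mjac y <= (4 / (1 - enorm x ^+ 2)) ^+ n.
Proof.
move=> y1; have /andP[h1 h2] := mratio_bounds y1.
have h0 : 0 < (1 - enorm x ^+ 2) / mden x y.
  by apply: lt_le_trans h1; rewrite divr_gt0.
rewrite exprn_gt0//= ler_pXn2r// nnegrE ltW//.
exact: lt_le_trans h2.
Qed.

Lemma kout_ge0 j s : 0 <= kout j s.
Proof.
by rewrite mulr_ge0 ?invr_ge0 ?(ltW (eps_gt0 j))//; have /andP[] := kbump_itv ((1 - s) / eps j).
Qed.

Lemma sp_le p (s : R) : 2^-1 <= s -> sp p s <= sp p 2^-1.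
Proof.
move=> s2; have s0 : 0 < s by lra.
rewrite lef_pV2 ?posrE ?exprn_gt0 ?sqrtr_gt0// ?invr_gt0//.
by rewrite lerXn2r ?nnegrE ?sqrtr_ge0// ler_wsqrtr.
Qed.

Lemma outer_ge0 g j y : 0 <= g y -> enorm y <= 1 -> 0 <= outer g j y.
Proof.
move=> g0 y1; have /andP[jy _] := mjac_bounds y1.
have c0 : 0 <= 2 / n%:R :> R by rewrite divr_ge0.
exact: (mulr_ge0 c0 (mulr_ge0 (mulr_ge0 (mulr_ge0 g0 (sp_ge0 _ _))
  (kout_ge0 _ _)) (ltW jy))).
Qed.

Lemma measurable_kbump : measurable_fun setT (@kbump R).
Proof. by apply: continuous_measurable_fun; exact: kbump_continuous. Qed.

Lemma measurable_mjac : measurable_fun setT mjac.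
Proof.
apply: measurable_funX; apply: measurable_funM => //.
apply: (measurableT_comp (@measurable_invr R)); exact: measurable_mden.
Qed.

Lemma measurable_kout j : measurable_fun setT (fun y : E => kout j (ms x y)).
Proof.
apply: measurable_funM => //; apply: (measurableT_comp measurable_kbump).
by apply: measurable_funM => //; apply: measurable_funB => //; exact: measurable_ms.
Qed.

Lemma measurable_outer g j : measurable_fun setT g -> measurable_fun setT (outer g j).
Proof.
move=> mg; apply: measurable_funM => //; apply: measurable_funM; last exact: measurable_mjac.
apply: measurable_funM; last exact: measurable_kout.
apply: measurable_funM => //.
by apply: (measurableT_comp (measurable_sp _)); exact: measurable_ms.
Qed.

Variables (g : E -> R) (M : R).
Hypothesis mg : measurable_fun setT g.
Hypothesis gM : forall y, 0 <= g y <= M.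
Hypothesis gr : forall xi : E, enorm xi = 1 -> forall r_ : nat -> R,
  (forall j, 0 <= r_ j <= 1) -> r_ @ \oo --> (1 : R) ->
  g (r_ j *: xi) @[j --> \oo] --> g xi.

(* kbump is supported in [1, 2], and (1 - s) / eps >= (1 - |x|^2) / 4 * v. *)
Let V : R := 8 / (1 - enorm x ^+ 2).
Let C : R := 2 * (M * sp (n - 2) 2^-1 * 6 * (4 / (1 - enorm x ^+ 2)) ^+ n).

Let zoom (j : nat) (xi : E) (v : R) : R :=
  let r := 1 - eps j * v in
  if (0 < r) && (r < 1) then
    2 * r ^+ m * (g (r *: xi) * sp (n - 2) (ms x (r *: xi)) *
      kbump ((1 - ms x (r *: xi)) / eps j) * mjac (r *: xi))
  else 0.

Let ray (j : nat) (y : E) : \bar R :=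
  (\int[L]_(r in `]0%R, 1%R[)
     (n%:R * r ^+ m * (if (enorm (r *: radial y) < 1)%R then outer g j (r *: radial y) else 0))%:E)%E.

Lemma ms_line xi r : enorm xi = 1 -> 0 <= r <= 1 ->
  1 - ms x (r *: xi) = (1 - enorm x ^+ 2) / mden x (r *: xi) * (1 - r ^+ 2).
Proof.
move=> x1 /andP[r0 r1]; rewrite ms_compl ?enormZ ?x1 ?mulr1 ?ger0_norm//.
by rewrite mulrAC.
Qed.

Lemma zoom_bound j xi v : enorm xi = 1 -> 0 <= zoom j xi v <= C.
Proof.
move=> x1; have M0 : 0 <= M by have /andP[] := gM 0; exact: le_trans.
have C0 : 0 <= C.
  by rewrite !mulr_ge0// ?sp_ge0// exprn_ge0// divr_ge0// ltW.
rewrite /zoom; set r := 1 - _; case: ifPn => [/andP[r0 r1]|_]; last by rewrite lexx.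
have re : enorm (r *: xi) <= 1 by rewrite enormZ x1 mulr1 gtr0_norm// ltW.
have /andP[g0 g1] := gM (r *: xi); have /andP[j0 j1] := mjac_bounds re.
have /andP[k0 k1] := kbump_itv ((1 - ms x (r *: xi)) / eps j).
have s0 := sp_ge0 (n - 2) (ms x (r *: xi)).
have rm0 : 0 <= r ^+ m by rewrite exprn_ge0// ltW.
have rm1 : r ^+ m <= 1 by rewrite exprn_ile1// ltW.
have [s2|s2] := leP (ms x (r *: xi)) 2^-1.
  rewrite kbump_ge ?(mulr0, mul0r) ?lexx// ler_pdivlMr ?eps_gt0//.
  by have := eps_le j; lra.
have s1 := sp_le (n - 2) (ltW s2).
rewrite /C; move: (g _) g0 g1 (kbump _) k0 k1 (mjac _) j0 j1 (sp _ _) s0 s1 => G g0 g1 K k0 k1 J j0 j1.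
move: (sp _ _) (r ^+ m) rm0 rm1 => S rm rm0 rm1 S' s0 s1.
have J0 := ltW j0.
apply/andP; split; first by rewrite !mulr_ge0.
apply: ler_pM; rewrite ?mulr_ge0//; first by rewrite -[leRHS]mulr1 ler_wpM2l.
by apply: ler_pM; rewrite ?mulr_ge0//; apply: ler_pM; rewrite ?mulr_ge0//; apply: ler_pM.
Qed.

Lemma measurable_zoom j xi : measurable_fun [set: measurableTypeR R]
  (zoom j xi : measurableTypeR R -> R).
Proof.
have mr : measurable_fun [set: measurableTypeR R] (fun v : measurableTypeR R => 1 - eps j * v).
  by apply: measurable_funB => //; exact: measurable_funM.
have mz := measurableT_comp (measurable_radial_line xi) mr.
have mm := measurableT_comp (measurable_ms x) mz.
apply: measurable_if0.
  by apply: measurable_and; exact: measurable_fun_ltr.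
apply: measurable_funM; first by apply: measurable_funM => //; exact: measurable_funX.
apply: measurable_funM; last exact: (measurableT_comp measurable_mjac mz).
apply: measurable_funM; last first.
  apply: (measurableT_comp measurable_kbump); apply: measurable_funM => //.
  by apply: measurable_funB.
apply: measurable_funM; first exact: (measurableT_comp mg mz).
exact: (measurableT_comp (measurable_sp _) mm).
Qed.

Lemma zoom_supp j xi v : enorm xi = 1 -> ~ `[0, V]%classic v -> zoom j xi v = 0.
Proof.
move=> x1 vV; rewrite /zoom; set r := 1 - _; case: ifPn => // /andP[r0 r1].
have e0 := eps_gt0 j.
have v0 : 0 < v by rewrite -(pmulr_rgt0 _ e0); rewrite /r in r1; lra.
have vV' : V < v.
  by rewrite ltNge; apply/negP => vle; apply: vV; rewrite /= in_itv/= vle ltW.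
rewrite kbump_ge ?(mulr0, mul0r)// ms_line ?(ltW r0) ?(ltW r1)//.
have re : enorm (r *: xi) <= 1 by rewrite enormZ x1 mulr1 gtr0_norm// ltW.
have /andP[h1 _] := mratio_bounds re.
rewrite ler_pdivlMr//.
have h2 : eps j * v <= 1 - r ^+ 2 by rewrite /r in r0 r1 *; nra.
have h3 : 2 * eps j <= (1 - enorm x ^+ 2) / 4 * (eps j * v).
  rewrite mulrCA mulrA (mulrC 2) -mulrA ler_pM2l//.
  rewrite mulrAC ler_pdivlMr// -ler_pdivrMl//.
  by rewrite mulrC; apply: ltW; apply: le_lt_trans vV'; rewrite /V; lra.
apply: (le_trans h3); apply: ler_pM => //.
  by rewrite divr_ge0// ltW.
by rewrite mulr_ge0// ltW.
Qed.

Lemma rayE j y : pball y ->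
  ray j y = (\int[L]_(v in `[0%R, V]) (zoom j (radial y) v)%:E)%E.
Proof.
move=> /andP[y0 y1]; have x1 := enorm_radial y0; set xi := radial y in x1 *.
have e0 := eps_gt0 j.
rewrite /ray (@integral_mkif _ _ _ _ _ (fun r : measurableTypeR R => (0 < r) && (r < 1))); last first.
  by move=> r; rewrite /= in_itv.
(* The zoom needs the integrand on the whole line. *)
pose f (r : measurableTypeR R) : R := if (0 < r) && (r < 1) then
  n%:R * r ^+ m * (if enorm (r *: xi) < 1 then outer g j (r *: xi) else 0) else 0.
have f0 r : (0 <= (f r)%:E)%E.
  rewrite lee_fin /f; case: ifPn => // /andP[r0 r1].
  rewrite !mulr_ge0 ?exprn_ge0 ?(ltW r0)//; case: ifPn => // h.
  by apply: outer_ge0 (ltW h); have /andP[] := gM (r *: xi).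
have mf : measurable_fun [set: measurableTypeR R] (EFin \o f).
  apply/measurable_EFinP; apply: measurable_if0.
    by apply: measurable_and; exact: measurable_fun_ltr.
  apply: measurable_funM; first by apply: measurable_funM => //; exact: measurable_funX.
  have mz := measurable_radial_line xi.
  apply: measurable_if0; last exact: (measurableT_comp (measurable_outer j mg) mz).
  apply: measurable_fun_ltr => //; exact: (measurableT_comp (@measurable_enorm R n) mz).
rewrite (ge0_integral_zoom e0 mf f0) -ge0_integralZl//; last 3 first.
- apply: (measurableT_comp mf); apply: measurable_funB => //; exact: measurable_funM.
- by move=> v _; exact: f0.
- by rewrite lee_fin ltW.
rewrite [RHS]integral_mkcond; apply: eq_integral => v _.
rewrite -EFinM.
transitivity (zoom j xi v)%:E; last first.
  rewrite /restrict; case: ifPn => //; rewrite notin_setE => /(zoom_supp j x1) ->//.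
congr _%:E; rewrite /f /zoom; case: ifPn => [/andP[r0 r1]|_]; last by rewrite mulr0.
rewrite enormZ x1 mulr1 gtr0_norm// r1 /outer /kout.
have n0 : n%:R != 0 :> R by [].
move: (g _) (sp _ _) (kbump _) (mjac _) (_ ^+ m) => G S K J rm.
by move: n%:R n0 (eps j) (lt0r_neq0 e0) => N n0 e en0; field; rewrite n0 en0.
Qed.

Lemma zoom_cvg xi v : enorm xi = 1 -> `[0, V]%classic v ->
  zoom j xi v @[j --> \oo] --> 2 * g xi * mjac xi *
    kbump (2 * ((1 - enorm x ^+ 2) / mden x xi) * v).
Proof.
move=> x1; rewrite /= in_itv/= => /andP[v0 _].
move: v0; rewrite le_eqVlt => /predU1P[<-|v0].
  rewrite mulr0 kbump_le// mulr0 (_ : (fun j => _) = fun=> 0); first exact: cvg_cst.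
  by apply/funext => j; rewrite /zoom mulr0 subr0 ltxx andbF.
pose r_ j := Num.max 0 (1 - eps j * v).
have ev : eps j * v @[j --> \oo] --> (0 : R).
  by rewrite -[X in _ --> X](mul0r v); apply: cvgM; [exact: eps_cvg0|exact: cvg_cst].
have r1 : 1 - eps j * v @[j --> \oo] --> (1 : R).
  by rewrite -[X in _ --> X]subr0; apply: cvgB => //; exact: cvg_cst.
have rc : r_ @ \oo --> (1 : R).
  apply: cvg_trans r1; apply: near_eq_cvg; near=> j.
  have evj : eps j * v < 1 by near: j; exact: (cvgr_lt _ ev).
  by rewrite /r_ max_r// subr_ge0 ltW.
have r01 j : 0 <= r_ j <= 1.
  rewrite le_max lexx/= ge_max ler01/= gerBl mulr_ge0// ?(ltW v0)//.
  exact/ltW/eps_gt0.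
have yc : r_ j *: xi @[j --> \oo] --> xi.
  by rewrite -[X in _ --> X]scale1r; exact: cvgZr_tmp.
have m1 : mden x xi != 0 by rewrite gt_eqF// mden_gt0// x1.
have mc : mden x (r_ j *: xi) @[j --> \oo] --> mden x xi.
  exact: (cvg_comp _ _ yc (@continuous_mden R n x xi)).
have lc : (1 - enorm x ^+ 2) / mden x (r_ j *: xi) @[j --> \oo] -->
    (1 - enorm x ^+ 2) / mden x xi.
  by apply: cvgM; [exact: cvg_cst|exact: cvgV].
have jc : mjac (r_ j *: xi) @[j --> \oo] --> mjac xi.
  exact: (cvg_comp _ _ lc (@exprn_continuous R n _)).
have msc : ms x (r_ j *: xi) @[j --> \oo] --> (1 : R).
  have e : (fun j => ms x (r_ j *: xi)) = (fun j => 1 -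
      (1 - enorm x ^+ 2) / mden x (r_ j *: xi) * (1 - r_ j ^+ 2)).
    by apply/funext => j; rewrite -ms_line// subKr.
  rewrite e -[X in _ --> X]subr0; apply: cvgB; first exact: cvg_cst.
  rewrite -[X in _ --> X](mulr0 ((1 - enorm x ^+ 2) / mden x xi)).
  apply: cvgM => //; rewrite -[X in _ --> X](subrr 1); apply: cvgB; first exact: cvg_cst.
  rewrite -[X in _ --> X](expr1n R 2).
  exact: (cvg_comp _ _ rc (@exprn_continuous R 2 _)).
have sc : sp (n - 2) (ms x (r_ j *: xi)) @[j --> \oo] --> (1 : R).
  have -> : 1 = sp (n - 2) 1 :> R by rewrite /sp sqrtr1 expr1n invr1.
  exact: (cvg_comp _ _ msc (@continuous_sp R (n - 2) 1 ltr01)).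
have gc := gr x1 r01 rc.
have kc : kbump ((1 - enorm x ^+ 2) / mden x (r_ j *: xi) * (v * (2 - eps j * v)))
    @[j --> \oo] --> kbump (2 * ((1 - enorm x ^+ 2) / mden x xi) * v).
  have kc0 : (1 - enorm x ^+ 2) / mden x (r_ j *: xi) * (v * (2 - eps j * v))
      @[j --> \oo] --> 2 * ((1 - enorm x ^+ 2) / mden x xi) * v.
    rewrite -mulrA mulrCA (mulrC 2 v); apply: cvgM => //.
    apply: cvgM; first exact: cvg_cst.
    by rewrite -[X in _ --> X]subr0; apply: cvgB => //; exact: cvg_cst.
  exact: (cvg_comp _ _ kc0 (@kbump_continuous R _)).
have rm : 2 * r_ j ^+ m @[j --> \oo] --> (2 : R).
  rewrite -[X in _ --> X]mulr1; apply: cvgM; first exact: cvg_cst.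
  rewrite -[X in _ --> X](expr1n R m).
  exact: (cvg_comp _ _ rc (@exprn_continuous R m _)).
rewrite (_ : 2 * g xi * mjac xi * _ = 2 * (g xi * 1 *
    kbump (2 * ((1 - enorm x ^+ 2) / mden x xi) * v) * mjac xi)); last first.
  by move: (kbump _) => K; move: (g xi) (mjac xi) => G J; ring.
apply: cvg_trans; last exact: (cvgM rm (cvgM (cvgM (cvgM gc sc) kc) jc)).
apply: near_eq_cvg; near=> j.
have ej := eps_gt0 j.
have evj : eps j * v < 1 by near: j; exact: (cvgr_lt _ ev).
have evj0 : 0 < eps j * v by exact: mulr_gt0.
have rj : r_ j = 1 - eps j * v by rewrite /r_ max_r// subr_ge0 ltW.
rewrite /zoom /= ifT; last by apply/andP; split; lra.
rewrite rj ms_line//; last by apply/andP; split; lra.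
congr (_ * (_ * _ * kbump _ * _)).
by field; rewrite gt_eqF//= gt_eqF// mden_gt0// enormZ x1 mulr1 ger0_norm; lra.
Unshelve. all: by end_near. Qed.

(** In the limit, 1 - s = (1 - |x|^2) / [x, xi]^2 * 2 eps v, so that the integral
    of the bump over v produces the factor [x, xi]^2 / (2 (1 - |x|^2)); it lowers
    the exponent of the Jacobian from n to n - 1. *)
Lemma ray_cvg y : pball y ->
  fine (ray j y) @[j --> \oo] --> pois (radial y) * g (radial y).
Proof.
move=> py; have /andP[y0 _] := py; have x1 := enorm_radial y0.
under eq_fun do rewrite rayE//.
set xi := radial y in x1 *.
have V0 : 0 <= V by rewrite divr_ge0// ltW.
have mV : measurable (`[0, V]%classic : set (measurableTypeR R)) by exact: measurable_itv.
have [] := @Rdominated_convergence _ (measurableTypeR R) R L _ (fun j => zoom j xi)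
  (fun v => 2 * g xi * mjac xi * kbump (2 * ((1 - enorm x ^+ 2) / mden x xi) * v))
  (fun=> C) mV.
- by move=> j; apply: measurable_funTS; exact: measurable_zoom.
- apply: measurable_funTS; apply: measurable_funM => //.
  by apply: (measurableT_comp measurable_kbump); exact: measurable_funM.
- by move=> v vV; exact: zoom_cvg.
- by move=> j v _; have /andP[p0 pC] := zoom_bound j v x1; rewrite ger0_norm.
- apply: measurable_bounded_integrable => //.
    have h : (@lebesgue_measure R `[0%R, V]%classic < +oo)%E.
      by rewrite lebesgue_measure_itv/=; case: ifP => _; rewrite ?ltry.
    exact: h.
  by exists `|C|; split; [exact: num_real|move=> z Cz v _ /=; exact: ltW].
move=> _ hc; suff -> : pois xi * g xi = \int[L]_(v in `[0, V])
  (2 * g xi * mjac xi * kbump (2 * ((1 - enorm x ^+ 2) / mden x xi) * v)) by exact: hc.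
have m0 : 0 < mden x xi by rewrite mden_gt0// x1.
have l0 : 0 < 2 * ((1 - enorm x ^+ 2) / mden x xi) by rewrite mulr_gt0// divr_gt0.
rewrite RintegralZl//; last first.
  apply: continuous_compact_integrable; first exact: segment_compact.
  apply: continuous_subspaceT => v; apply: (@cont_comp R R (@kbump R)); last exact: kbump_continuous.
  by apply: contM; [exact: cont_cst|exact: cvg_id].
rewrite /Rintegral integral_kbump//=.
  rewrite /pois /mjac /=; set l := _ / mden _ _ in l0 *.
  have ln0 : l != 0 by rewrite gt_eqF// -(pmulr_rgt0 _ (ltr0n R 2)).
  by rewrite (exprS l); move: (l ^+ m) => lm; field.
have /andP[h1 _] := @mratio_bounds xi (ltac:(by rewrite x1)).
apply: (@le_trans _ _ (2 * ((1 - enorm x ^+ 2) / 4) * V)).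
  rewrite (_ : _ * V = 4) ?ler_nat// /V.
  by move: (1 - enorm x ^+ 2) a1 => A A0; field; rewrite gt_eqF.
by rewrite ler_wpM2r// ler_wpM2l.
Qed.

Lemma measurable_ray j : measurable_fun setT (ray j).
Proof.
pose K (p : E * measurableTypeR R) : R := if (0 < p.2) && (p.2 < 1) then
  n%:R * p.2 ^+ m * (if enorm (p.2 *: radial p.1) < 1 then outer g j (p.2 *: radial p.1) else 0)
  else 0.
have m2 : measurable_fun [set: (E * measurableTypeR R)%type]
  (snd : _ -> measurableTypeR R) by [].
have mz : measurable_fun [set: (E * measurableTypeR R)%type]
    (fun p => p.2 *: radial p.1 : E).
  apply: measurable_fun_coorP => i.
  rewrite (_ : (fun _ => _) = (fun p : E * measurableTypeR R => p.2 * radial p.1 ord0 i)).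
    apply: measurable_funM => //.
    apply: (measurableT_comp (@measurable_coor _ _ _ i)).
    exact: (measurableT_comp (@measurable_radial R n)).
  by apply/funext => p; rewrite mxE.
have mK : measurable_fun setT (EFin \o K).
  apply/measurable_EFinP; apply: measurable_if0.
    by apply: measurable_and; exact: measurable_fun_ltr.
  apply: measurable_funM; first by apply: measurable_funM => //; exact: measurable_funX.
  apply: measurable_if0; last exact: (measurableT_comp (measurable_outer j mg) mz).
  apply: measurable_fun_ltr => //; exact: (measurableT_comp (@measurable_enorm R n) mz).
rewrite (_ : ray j = fubini_F L (EFin \o K)); last first.
  apply/funext => y; rewrite /ray /fubini_F (@integral_mkif _ _ _ _ _ (fun r : measurableTypeR R => (0 < r) && (r < 1)))//.
apply: measurable_fun_fubini_tonelli_F => // p.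
rewrite lee_fin /K; case: ifPn => // /andP[r0 r1].
rewrite !mulr_ge0 ?exprn_ge0 ?(ltW r0)//; case: ifPn => // h.
by apply: outer_ge0 (ltW h); have /andP[] := gM (p.2 *: radial p.1).
Qed.

Lemma ray_bound j y : pball y -> (0 <= ray j y <= (C * V)%:E)%E.
Proof.
move=> py; have /andP[y0 _] := py; have x1 := enorm_radial y0.
have V0 : 0 <= V by rewrite divr_ge0// ltW.
rewrite rayE//; apply/andP; split.
  by apply: integral_ge0 => v _; rewrite lee_fin; have /andP[] := zoom_bound j v x1.
apply: (@le_trans _ _ (\int[L]_(v in `[0%R, V]) (cst C%:E) v)%E).
  apply: ge0_le_integral => //.
  - by move=> v _; rewrite lee_fin; have /andP[] := zoom_bound j v x1.
  - by apply/measurable_EFinP/measurable_funTS; exact: measurable_zoom.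
  - by move=> v _; rewrite lee_fin; have /andP[] := zoom_bound j v x1.
rewrite integral_cst//= lebesgue_measure_itv/= lte_fin.
case: ltP => h; first by rewrite -EFinB subr0 -EFinM.
rewrite mule0 lee_fin mulr_ge0//.
by have /andP[] := zoom_bound j 0 x1; exact: le_trans.
Qed.

Lemma ray_fin j y : pball y -> ray j y \is a fin_num.
Proof.
move=> py; have /andP[h0 h1] := ray_bound j py.
by rewrite ge0_fin_numE//; apply: le_lt_trans h1 _; rewrite ltry.
Qed.

Lemma Rintegral_outerE j :
  \int[nu]_(y in uball) outer g j y = \int[nu]_(y in pball) fine (ray j y).
Proof.
rewrite /Rintegral; congr fine.
pose Phi (y : E) : R := if enorm y < 1 then outer g j y else 0.
have Phi0 y : 0 <= Phi y.
  by rewrite /Phi; case: ifPn => // h; apply: outer_ge0 (ltW h); have /andP[] := gM y.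
have mPhi : measurable_fun setT Phi.
  apply: measurable_if0; last exact: measurable_outer.
  by apply: measurable_fun_ltr => //; exact: measurable_enorm.
transitivity (\int[nu]_(y in uball) (Phi y)%:E)%E.
  by apply: eq_integral => y; rewrite inE /uball /Phi /= => ->.
rewrite ge0_integral_nu//; last 3 first.
- exact: measurable_uball.
- by apply/measurable_EFinP; exact: measurable_funTS.
- by move=> y _; rewrite lee_fin.
rewrite ge0_integral_pball//; last exact/measurable_EFinP.
rewrite ge0_integral_polar// -ge0_integral_nu//.
- apply: eq_integral => y; rewrite inE => py.
  by rewrite fineK// ray_fin.
- exact: measurable_pball.
- by apply: measurable_funTS; exact: measurable_ray.
- by move=> y /(ray_bound j)/andP[].
Qed.

(** Integrate along each ray first.  The integrand lives where 1 - r is of order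
    eps; with r = 1 - eps v it is bounded, supported in a fixed interval of v
    ([zoom_supp]), and converges pointwise. *)
Theorem outer_limit : \int[nu]_(y in uball) outer g j y @[j --> \oo] -->
  \int[nu]_(y in pball) (pois (radial y) * g (radial y)).
Proof.
under eq_fun do rewrite Rintegral_outerE.
have [] := @Rdominated_convergence _ E R nu pball (fun j y => fine (ray j y))
  (fun y => pois (radial y) * g (radial y)) (fun=> C * V) (@measurable_pball R n).
- move=> j; apply: measurable_funTS.
  exact: (measurableT_comp (fine_measurable measurableT) (measurable_ray j)).
- apply: measurable_funTS; apply: measurable_funM.
    apply: (measurableT_comp _ (@measurable_radial R n)).
    apply: measurable_funX; apply: measurable_funM => //.
    by apply: (measurableT_comp (@measurable_invr R)); exact: measurable_mden.
  by apply: (measurableT_comp mg); exact: measurable_radial.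
- by move=> y py; exact: ray_cvg.
- move=> j y py; have := ray_bound j py; rewrite -(fineK (ray_fin j py)).
  by rewrite !lee_fin => /andP[r0 r1]; rewrite ger0_norm.
- apply: (bounded_integrable_nu (M := `|C * V|)) => //.
  + exact: measurable_pball.
  + by move=> y /andP[].
by [].
Qed.

End outer_limit.

(** * The test identity and its cutoffs *)

Section test_identity.
Context {R : realType} (m : nat).
Local Notation n := m.+1.
Local Notation E := 'rV[R]_n.
Local Notation L := (@lebesgue_measure R).
Hypothesis n3 : (3 <= n)%N.
Variable x : E.
Hypothesis xb : uball x.

Let a1 : 0 < 1 - enorm x ^+ 2. Proof. exact: uball_defect. Qed.

Lemma mjacE y : uball y -> (1 - ms x y) ^+ n * tau_density y = mjac x y.
Proof.
move=> yb; have b0 := uball_defect yb.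
rewrite ms_compl//; last exact: ltW.
rewrite /tau_density /mjac mulrAC exprMn mulfK// expf_neq0// gt_eqF//.
Qed.

Lemma continuous_mjac y : uball y -> {for y, continuous (mjac x)}.
Proof.
move=> yb; apply: contX; apply: contM; first exact: cont_cst.
by apply: contV; [rewrite gt_eqF// mden_gt0// ltW|exact: continuous_mden].
Qed.

Lemma continuous_ms y : uball y -> {for y, continuous (ms x)}.
Proof.
by move=> yb; have [] := C2_ball_ms xb (ord0 : 'I_n) yb.
Qed.

(** This turns a cutoff near s = 1 into compact support in the ball. *)
Lemma ms_near1 (b : R) y : uball y -> 1 - (1 - b) * (1 - enorm x ^+ 2) / 4 < enorm y ^+ 2 ->
  b <= ms x y.
Proof.
move=> yb h; have m0 := mden_gt0 xb (ltW yb).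
have ml := mden_lb xb (ltW yb).
suff : 1 - ms x y <= 1 - b by lra.
rewrite ms_compl//; last exact: ltW.
rewrite ler_pdivrMr//.
have A0 := a1; have p1 := uball_defect yb.
set A := 1 - enorm x ^+ 2 in A0 h ml *; set p := enorm y ^+ 2 in h p1 *.
have b1 : 0 < 1 - b by rewrite -(pmulr_rgt0 _ A0); lra.
have h2 : 1 - p <= (1 - b) * A / 4 by lra.
apply: (@le_trans _ _ (A * ((1 - b) * A / 4))); first by rewrite ler_wpM2l// ltW.
apply: (@le_trans _ _ ((1 - b) * (A ^+ 2 / 4))); last by rewrite ler_wpM2l// ltW.
by rewrite le_eqVlt; apply/orP; left; apply/eqP; field.
Qed.

Section weight.
Variables (k : R -> R) (a b : R).
Hypotheses (a0 : 0 < a) (b1 : b < 1) (ck : continuous k).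
Hypothesis k0 : forall t, t <= a -> k t = 0.
Hypothesis k1 : forall t, b <= t -> k t = 0.

Lemma continuous_spk p t : {for t, continuous (fun t => sp p t * k t)}.
Proof.
have [t0|t0] := ltP 0 t.
  by apply: contM; [exact: continuous_sp|exact: ck].
have ta : t < a by apply: le_lt_trans a0.
apply: (@cont_near_eq R _ (fun _ => 0)); last exact: cont_cst.
  by rewrite k0 ?mulr0// ltW.
near=> s; rewrite k0 ?mulr0//; apply: ltW; near: s; exact: lt_nbhsl.
Unshelve. all: by end_near. Qed.

Lemma test_integrable (u : E -> R) : (forall y, uball y -> {for y, continuous u}) ->
  nu.-integrable uball
    (EFin \o (fun y => u y * (sp (n - 2) (ms x y) * k (ms x y) * mjac x y))).
Proof.
move=> cu.
apply: (@integrable_compact_support _ _ (1 - (1 - b) * (1 - enorm x ^+ 2) / 4)).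
- have : 0 < (1 - b) * (1 - enorm x ^+ 2) by rewrite mulr_gt0// subr_gt0.
  lra.
- by move=> y yb /(ms_near1 yb) h; rewrite k1// mulr0 mul0r mulr0.
- move=> y yb; apply: contM; first exact: cu.
  apply: contM; last exact: continuous_mjac.
  apply: (@cont_comp _ _ (fun t => sp (n - 2) t * k t)); first exact: continuous_ms.
  exact: continuous_spk.
Qed.

End weight.

(** The Green identity for the test function y |-> rad (s). *)
Theorem test_identity (eta k : R -> R) (a b : R) (u : E -> R) (u1 u2 : 'I_n -> E -> R) :
  cutoff eta k a -> b < 1 -> (forall t, b <= t -> eta t = 0 /\ k t = 0) ->
  C2_ball u u1 u2 ->
  \int[nu]_(y in uball) (rad n eta (ms x y) * hlap u1 u2 y * tau_density y) =
  - (2 / n%:R) *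
    \int[nu]_(y in uball) (u y * (sp (n - 2) (ms x y) * k (ms x y) * mjac x y)).
Proof.
move=> ek b1 e1 hu.
have [a0 _ ck e0] := ek.
have cu y : uball y -> {for y, continuous u}.
  by move=> yb; have [] := hu (ord0 : 'I_n) y yb.
rewrite (@green_identity _ _ u (fun y => rad n eta (ms x y)) u1 u2
  (fun i y => rad1 n eta (ms x y) * ms1 x i y)
  (fun i y => rad2 n eta k (ms x y) * ms1 x i y ^+ 2 + rad1 n eta (ms x y) * ms2 x i y)
  (1 - (1 - b) * (1 - enorm x ^+ 2) / 4)).
- rewrite -RintegralZl//; last 2 first.
  + exact: measurable_uball.
  + apply: (test_integrable a0 b1 ck _ _ cu) => t ta; [exact: (e0 _ ta).2|exact: (e1 _ ta).2].
  apply: eq_Rintegral => y /[!inE] yb.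
  have s01 : 0 <= ms x y < 1 by rewrite ms_ge0 ?ms_lt1// ltW.
  rewrite hlap_comp// (rad_lap n3 ek)// -mjacE//.
  by ring.
- exact: ltnW.
- have : 0 < (1 - b) * (1 - enorm x ^+ 2) by rewrite mulr_gt0// subr_gt0.
  lra.
- exact: hu.
- apply: C2_ball_comp => //.
  + by move=> t /andP[t0 _]; apply: (is_derive_rad _ ek); lra.
  + by move=> t _; exact: (is_derive_rad1 _ ek).
  + by move=> t _; exact: (continuous_rad2 ek).
- move=> y yb /(ms_near1 yb) h.
  have s0 := ms_ge0 xb (ltW yb); have s1 := ltW (ms_lt1 xb yb).
  split; first by apply: (rad_eq0 _ ek) => // [t /e1[]//|]; rewrite h.
  move=> i; rewrite /rad1 /rad2 (e1 _ h).1 (e1 _ h).2.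
  by rewrite !mul0r !addr0 oppr0 !mul0r addr0.
Qed.

End test_identity.

Section cutoffs.
Context {R : realType}.
Implicit Types (e t : R).
Local Notation eps := (@eps R).

Lemma hstep_homo : {homo (@hstep R) : s t / s <= t}.
Proof.
move=> s t st; have cc : clip s <= clip t.
  rewrite /clip ge_max le_max lexx/= le_max le_min.
  have st1 : s - 1 <= t - 1 by lra.
  by rewrite !ge_min lexx/= st1 !orbT.
have /andP[z0 z1] := clip_itv s; have /andP[w0 w1] := clip_itv t.
rewrite -subr_ge0 /hstep; move: (clip s) (clip t) cc z0 z1 w0 w1 => z w zw z0 z1 w0 w1.
rewrite (_ : _ - _ = (w - z) * (3 * (w + z) - 2 * (w ^+ 2 + w * z + z ^+ 2))); last by ring.
by apply: mulr_ge0; nra.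
Qed.

Lemma is_derive_hstepZ (c t : R) :
  is_derive t (1 : R) (fun t => hstep (c * t)) (c * kbump (c * t)).
Proof.
apply: is_derive_cong (is_derive_chain (is_derive_hstep _)
    (is_derive_fZ c (is_derive_id t (1 : R)))) _.
by rewrite mulr1 mulrC.
Qed.

Lemma is_derive_hstepC (c t : R) :
  is_derive t (1 : R) (fun t => hstep (c * (1 - t))) (- (c * kbump (c * (1 - t)))).
Proof.
have d1 := is_derive_fB (is_derive_cst (1 : R) t 1) (is_derive_id t (1 : R)).
apply: is_derive_cong (is_derive_chain (is_derive_hstep _) (is_derive_fZ c d1)) _.
by rewrite sub0r mulrN1 mulrN mulrC.
Qed.

Definition kin (j : nat) t : R := kbump (t / eps j) / eps j.

Definition etaj (j : nat) t : R := hstep ((eps j)^-1 * t) * hstep ((eps j)^-1 * (1 - t)).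

Definition kj (j : nat) t : R := kin j t - kout j t.

Lemma kin_ge0 j t : 0 <= kin j t.
Proof.
by rewrite mulr_ge0 ?invr_ge0 ?(ltW (@eps_gt0 R j))//; have /andP[] := kbump_itv (t / eps j).
Qed.

Lemma kin_le j t : t <= eps j -> kin j t = 0.
Proof. by move=> te; rewrite /kin kbump_le ?mul0r// ler_pdivrMr ?(@eps_gt0 R)// mul1r. Qed.

Lemma kin_ge j t : 2 * eps j <= t -> kin j t = 0.
Proof. by move=> te; rewrite /kin kbump_ge ?mul0r// ler_pdivlMr ?(@eps_gt0 R). Qed.

Lemma kout_le j t : t <= 1 - 2 * eps j -> kout j t = 0.
Proof.
by move=> te; rewrite /kout kbump_ge ?mul0r// ler_pdivlMr ?(@eps_gt0 R)//; lra.
Qed.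

Lemma kout_ge j t : 1 - eps j <= t -> kout j t = 0.
Proof.
by move=> te; rewrite /kout kbump_le ?mul0r// ler_pdivrMr ?(@eps_gt0 R)//; lra.
Qed.

Lemma continuous_kin j : continuous (kin j).
Proof.
move=> t; apply: (@contM R R (fun t => kbump (t / eps j)) (fun=> (eps j)^-1)); last exact: cont_cst.
apply: (@cont_comp _ _ (@kbump R) (fun t => t / eps j)); last exact: kbump_continuous.
by apply: contM; [exact: cvg_id|exact: cont_cst].
Qed.

Lemma continuous_kout j : continuous (@kout R j).
Proof.
move=> t; apply: (@contM R R (fun t => kbump ((1 - t) / eps j)) (fun=> (eps j)^-1)); last exact: cont_cst.
apply: (@cont_comp _ _ (@kbump R) (fun t => (1 - t) / eps j)); last exact: kbump_continuous.
by apply: contM; [apply: contB; [exact: cont_cst|exact: cvg_id]|exact: cont_cst].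
Qed.

Lemma etaj_itv j t : 0 <= etaj j t <= 1.
Proof.
have /andP[p0 p1] := hstep_itv ((eps j)^-1 * t).
have /andP[q0 q1] := hstep_itv ((eps j)^-1 * (1 - t)).
by rewrite /etaj mulr_ge0//= mulr_ile1.
Qed.

Lemma etaj_ge j t : 1 - eps j <= t -> etaj j t = 0.
Proof.
move=> te; rewrite /etaj (@hstep_le _ (_ * (1 - t))) ?mulr0//.
by rewrite mulrC ler_pdivrMr ?(@eps_gt0 R)//; lra.
Qed.

(** Each factor of [etaj] is 1 where the other one varies, so that the derivative
    is a difference of two bumps. *)
Lemma etaj_cutoff j : cutoff (etaj j) (kj j) (eps j).
Proof.
have e0 := @eps_gt0 R j; have e4 := @eps_le R j.
split; first exact: e0.
- move=> t; apply: is_derive_cong (is_derive_fM (is_derive_hstepZ _ t) (is_derive_hstepC _ t)) _.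
  rewrite /kj /kin /kout !(mulrC _ (eps j)^-1).
  have [t2|t2] := leP t 2^-1.
    rewrite (@hstep_ge _ (_ * (1 - t))); last by rewrite mulrC ler_pdivlMr//; lra.
    rewrite (@kbump_ge _ (_ * (1 - t))); last by rewrite mulrC ler_pdivlMr//; lra.
    by ring.
  rewrite (@hstep_ge _ (_ * t)); last by rewrite mulrC ler_pdivlMr//; lra.
  rewrite (@kbump_ge _ (_ * t)); last by rewrite mulrC ler_pdivlMr//; lra.
  by ring.
- by move=> t; apply: contB; [exact: continuous_kin|exact: continuous_kout].
- move=> t te; rewrite /etaj /kj kin_le// kout_le; last by lra.
  rewrite subr0 hstep_le ?mul0r// mulrC ler_pdivrMr//; lra.
Qed.

Lemma etaj_cvg t : 0 < t < 1 -> etaj ^~ t @ \oo --> (1 : R).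
Proof.
move=> /andP[t0 t1]; apply: (cvg_near_cst); near=> j.
have e0 := @eps_gt0 R j.
have h1 : eps j < t / 2 by near: j; apply: (cvgr_lt _ (@eps_cvg0 R)); lra.
have h2 : eps j < (1 - t) / 2 by near: j; apply: (cvgr_lt _ (@eps_cvg0 R)); lra.
by rewrite /etaj !hstep_ge ?mulr1// mulrC ler_pdivlMr//; lra.
Unshelve. all: by end_near. Qed.

End cutoffs.

(** * Integrability of the Green function at its pole *)

Section real_integrable.
Context d (T : measurableType d) (R : realType) (mu : {measure set T -> \bar R}) (D : set T).
Hypothesis mD : measurable D.
Implicit Types f g : T -> R.

Lemma integrable_RD f g : mu.-integrable D (EFin \o f) -> mu.-integrable D (EFin \o g) ->
  mu.-integrable D (EFin \o (fun y => f y + g y)).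
Proof. by move=> fi gi; have := integrableD mD fi gi. Qed.

Lemma integrable_RZ c f : mu.-integrable D (EFin \o f) ->
  mu.-integrable D (EFin \o (fun y => c * f y)).
Proof. by move=> fi; have := integrableZl mD c fi. Qed.

Lemma le_Rintegrable f g : measurable_fun D f -> (forall y, D y -> `|f y| <= g y) ->
  mu.-integrable D (EFin \o g) -> mu.-integrable D (EFin \o f).
Proof.
move=> mf fg; apply: le_integrable => //; first exact/measurable_EFinP.
move=> y Dy; rewrite /= lee_fin (le_trans (fg _ Dy))//; exact: ler_norm.
Qed.

Lemma integrable_measurable f : mu.-integrable D (EFin \o f) -> measurable_fun D f.
Proof. by move=> fi; apply/measurable_EFinP; have [] := integrableP _ _ _ fi. Qed.

End real_integrable.

Section null_point.
Context {R : realType} (m : nat).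
Local Notation n := m.+1.
Local Notation E := 'rV[R]_n.

Lemma measurable_point (x : E) : measurable [set x].
Proof.
rewrite -[X in measurable X]setCK; apply: measurableC.
apply: open_measurable_rV; apply: closed_openC.
exact: (accessible_closed_set1 (hausdorff_accessible (@norm_hausdorff _ _))).
Qed.

Lemma nu_point (x : E) : nu [set x] = 0%E.
Proof.
rewrite /nu /mscale /= (_ : leb n [set x] = 0%E) ?mule0//.
apply/eqP; rewrite eq_le measure_ge0 andbT.
rewrite /leb /= -/(leb m) /leb_step /pushforward.
apply: (@le_trans _ _ ((lebesgue_measure \x leb m)%E ([set x ord0 ord0] `*` setT))).
  apply: le_measure; rewrite ?inE.
  - rewrite -[X in measurable X]setTI; apply: measurable_cons_rV => //.
    exact: measurable_point.
  - by apply: measurableX => //; exact: measurable_set1.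
  - by move=> [a z] /= <-; split => //=; rewrite mxE unlift_none.
rewrite product_measure1E//.
rewrite [X in (X * _)%E](_ : _ = 0%E) ?mul0e//.
exact: (@lebesgue_measure_set1 R (x ord0 ord0)).
Qed.

End null_point.

Section kernel_integrability.
Context {R : realType} (m : nat).
Local Notation n := m.+1.
Local Notation E := 'rV[R]_n.
Local Notation L := (@lebesgue_measure R).
Local Notation eps := (@eps R).
Hypothesis n3 : (3 <= n)%N.
Variable x : E.
Hypothesis xb : uball x.

Let a1 : 0 < 1 - enorm x ^+ 2. Proof. exact: uball_defect. Qed.

Let C : R := (4 / (1 - enorm x ^+ 2)) ^+ n.

Let h1 (j : nat) (t : R) := hstep ((eps j)^-1 * t).
Let h2 (t : R) : R := hstep (4 * (1 - t)).

Let F (j : nat) (y : E) : R :=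
  1 * (sp (n - 2) (ms x y) * (h1 j (ms x y) * h2 (ms x y)) * mjac x y).

Let h1_itv j t : 0 <= h1 j t <= 1. Proof. exact: hstep_itv. Qed.
Let h2_itv t : 0 <= h2 t <= 1. Proof. exact: hstep_itv. Qed.

Let h1_le j t : t <= eps j -> h1 j t = 0.
Proof. by move=> te; apply: hstep_le; rewrite mulrC ler_pdivrMr ?(@eps_gt0 R)// mul1r. Qed.

Let h2_ge t : 3 / 4 <= t -> h2 t = 0.
Proof. by move=> te; apply: hstep_le; lra. Qed.

Lemma C2_ball_cst (c : R) : C2_ball (fun=> c : R) (fun (_ : 'I_n) _ => 0) (fun (_ : 'I_n) (_ : E) => 0).
Proof. by move=> i y _; split; try exact: is_derive_cst; exact: cont_cst. Qed.

Lemma hlap_cst (y : E) : hlap (fun (_ : 'I_n) (_ : E) => 0 : R) (fun (_ : 'I_n) (_ : E) => 0) y = 0.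
Proof.
by rewrite /hlap !big1 ?mulr0 ?addr0// => i _; rewrite mulr0.
Qed.

Let ch1 j t : is_derive t (1 : R) (h1 j) ((eps j)^-1 * kbump ((eps j)^-1 * t)).
Proof. exact: is_derive_hstepZ. Qed.

Let ch2 t : is_derive t (1 : R) h2 (- (4 * kbump (4 * (1 - t)))).
Proof. exact: is_derive_hstepC. Qed.

Let ckbZ (c t : R) : {for t, continuous (fun t => kbump (c * t))}.
Proof.
apply: (@cont_comp _ _ (@kbump R)); last exact: kbump_continuous.
by apply: contM; [exact: cont_cst|exact: cvg_id].
Qed.

Let ckbC (c t : R) : {for t, continuous (fun t : R => kbump (c * (1 - t)))}.
Proof.
apply: (@cont_comp _ _ (@kbump R)); last exact: kbump_continuous.
by apply: contM; [exact: cont_cst|apply: contB; [exact: cont_cst|exact: cvg_id]].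
Qed.

Let F_integrable j : nu.-integrable uball (EFin \o F j).
Proof.
apply: (@test_integrable _ _ _ xb (fun t => h1 j t * h2 t) (eps j) (3 / 4)).
- exact: eps_gt0.
- by lra.
- move=> t; apply: (@contM R R (h1 j) h2).
    exact: derive_continuous (ch1 j t).
  exact: derive_continuous (ch2 t).
- by move=> t /h1_le ->; rewrite mul0r.
- by move=> t /h2_ge ->; rewrite mulr0.
- by move=> y _; exact: cont_cst.
Qed.

Let F_ge0 j y : uball y -> 0 <= F j y.
Proof.
move=> yb; have /andP[j0 _] := mjac_bounds xb (ltW yb).
have /andP[p0 _] := h1_itv j (ms x y); have /andP[q0 _] := h2_itv (ms x y).
by rewrite /F !mulr_ge0 ?sp_ge0// ltW.
Qed.

Let K : R := 24 * sp (n - 2) 2^-1 * C.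

(** The test identity for u = 1 and the cutoff t h1(t) h2(t), where the factor t
    makes the derivative a sum of h1 h2, a nonnegative term, and a bounded term
    supported in s >= 1/2. *)
Let F_mass j : \int[nu]_(y in uball) F j y <= K.
Proof.
pose eta t := t * (h1 j t * h2 t).
pose k t := 1 * (h1 j t * h2 t) + t * ((eps j)^-1 * kbump ((eps j)^-1 * t) * h2 t +
   h1 j t * - (4 * kbump (4 * (1 - t)))).
have e0 := @eps_gt0 R j.
have ek : cutoff eta k (eps j).
  split; first exact: e0.
  - by move=> t; exact: (is_derive_fM (is_derive_id t (1 : R)) (is_derive_fM (ch1 j t) (ch2 t))).
  - have c1 t := derive_continuous (ch1 j t); have c2 t := derive_continuous (ch2 t).
    move=> t; apply: (@contD R R (fun t => 1 * (h1 j t * h2 t)) (fun t => t *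
      ((eps j)^-1 * kbump ((eps j)^-1 * t) * h2 t + h1 j t * - (4 * kbump (4 * (1 - t)))))).
      by apply: contM; [exact: cont_cst|exact: contM].
    apply: contM; first exact: cvg_id.
    apply: contD; apply: contM => //.
      by apply: contM; [exact: cont_cst|exact: ckbZ].
    have -> : (fun t => - (4 * kbump (4 * (1 - t)))) = (fun t => 0 - 4 * kbump (4 * (1 - t)) : R).
      by apply/funext => z; rewrite sub0r.
    apply: contB; first exact: cont_cst.
    by apply: contM; [exact: cont_cst|exact: ckbC].
  - move=> t te; rewrite /eta /k h1_le// kbump_le ?(mul0r, mulr0, addr0)//.
    by rewrite mulrC ler_pdivrMr// mul1r.
have e1 t : 3 / 4 <= t -> eta t = 0 /\ k t = 0.
  move=> te; rewrite /eta /k h2_ge// (@kbump_le _ (4 * _)); last by lra.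
  by rewrite !(mulr0, addr0, oppr0).
have [_ _ ck k0] := ek.
have b1 : 3 / 4 < 1 :> R by lra.
have c1 y : uball y -> {for y, continuous (fun _ : E => 1 : R)} by move=> _; exact: cont_cst.
have ki := test_integrable xb e0 b1 ck (fun t te => (k0 t te).2) (fun t te => (e1 t te).2) c1.
have := test_identity n3 xb ek b1 e1 (C2_ball_cst 1).
rewrite (_ : Rintegral _ _ _ = 0); last first.
  transitivity (\int[nu]_(y in (@uball R n)) (0 : R)); last first.
    by rewrite Rintegral_cst ?mul0r//; exact: measurable_uball.
  by apply: eq_Rintegral => y _; rewrite hlap_cst mulr0 mul0r.
move/esym/eqP; rewrite mulf_eq0 oppr_eq0 mulf_eq0 invr_eq0 !pnatr_eq0 /= => /eqP kz.
(* kz says that the mass of k is zero; K compensates its negative part. *)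
have Ki : nu.-integrable (@uball R n) (EFin \o (fun _ : E => K)).
  apply: (@bounded_integrable_nu _ _ _ _ `|K|) => //; exact: measurable_uball.
apply: (@le_trans _ _ (\int[nu]_(y in uball)
    (1 * (sp (n - 2) (ms x y) * k (ms x y) * mjac x y) + K))); last first.
  rewrite RintegralD//; last exact: measurable_uball.
  rewrite kz add0r Rintegral_cst; last exact: measurable_uball.
  rewrite [X in K * X](_ : _ = 1) ?mulr1//.
  exact: (congr1 fine (@nu_uball R n)).
apply: le_Rintegral => //.
- exact: measurable_uball.
- by apply: integrable_RD => //; exact: measurable_uball.
move=> y yb; rewrite /F.
have /andP[j0 jC] := mjac_bounds xb (ltW yb); have {}j0 := ltW j0.
set t := ms x y.
have t0 : 0 <= t by exact: ms_ge0 (ltW yb).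
have t1 : t <= 1 by apply: ltW; exact: ms_lt1.
have /andP[p0 p1] := h1_itv j t; have /andP[q0 q1] := h2_itv t.
have S0 := sp_ge0 (n - 2) t.
have /andP[kb0 _] := kbump_itv ((eps j)^-1 * t).
have /andP[kc0 kc1] := kbump_itv (4 * (1 - t)).
rewrite -subr_ge0 (_ : _ - _ = sp (n - 2) t * (t * ((eps j)^-1 * kbump ((eps j)^-1 * t) * h2 t)) * mjac x y
  + (K - sp (n - 2) t * (t * h1 j t * (4 * kbump (4 * (1 - t)))) * mjac x y)); last by rewrite /k; ring.
apply: addr_ge0.
  have ei0 : 0 <= (eps j)^-1 by rewrite invr_ge0 ltW.
  exact: (mulr_ge0 (mulr_ge0 S0 (mulr_ge0 t0 (mulr_ge0 (mulr_ge0 ei0 kb0) q0))) j0).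
rewrite subr_ge0; have [t2|t2] := leP t 2^-1.
  rewrite (@kbump_ge _ (4 * _)); last by lra.
  by rewrite !(mulr0, mul0r) !mulr_ge0// ?sp_ge0// exprn_ge0// divr_ge0// ltW.
have hs := sp_le (n - 2) (ltW t2).
rewrite /K (mulrC 24); clearbody t.
move: (sp _ t) S0 hs (h1 j t) p0 p1 (kbump (4 * _)) kc0 kc1 (mjac x y) j0 jC.
move=> S S0 hs h p0 p1 k' kc0 kc1 J j0 jC.
have th0 : 0 <= t * h by exact: mulr_ge0.
have k40 : 0 <= 4 * k' by exact: mulr_ge0.
apply: ler_pM => //; first by apply: mulr_ge0 => //; exact: mulr_ge0.
apply: ler_pM => //; first exact: mulr_ge0.
rewrite -[leRHS]mul1r; apply: ler_pM => //; last by lra.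
exact: mulr_ile1.
Qed.

Let G (y : E) : R := sp (n - 2) (ms x y) * h2 (ms x y) * mjac x y.

Let F_cvg y : uball y -> F ^~ y @ \oo --> G y.
Proof.
move=> yb; have := ms_ge0 xb (ltW yb); rewrite le_eqVlt => /predU1P[s0|s0].
  (* At the pole all terms are 0, because the inverse of 0 is 0. *)
  have z0 : sp (n - 2) (ms x y) = 0.
    by rewrite -s0 /sp sqrtr0 expr0n subn_eq0 leqNgt n3/= invr0.
  rewrite /F /G z0 !mul0r.
  under eq_fun do rewrite !mul0r mulr0.
  exact: cvg_cst.
apply: cvg_near_cst; near=> j.
have e0 := @eps_gt0 R j.
have h : eps j < ms x y / 2 by near: j; apply: (cvgr_lt _ (@eps_cvg0 R)); lra.
rewrite /F /G /h1 hstep_ge ?mul1r// mulrC ler_pdivlMr//; lra.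
Unshelve. all: by end_near. Qed.

Let F_homo y : uball y -> {homo F ^~ y : i j / (i <= j)%N >-> i <= j}.
Proof.
move=> yb i j ij; have /andP[j0 _] := mjac_bounds xb (ltW yb); have {}j0 := ltW j0.
have /andP[p0 _] := h1_itv i (ms x y); have /andP[q0 _] := h2_itv (ms x y).
rewrite /F !mul1r ler_wpM2r// ler_wpM2l ?sp_ge0// ler_wpM2r//.
apply: hstep_homo; rewrite ler_wpM2r ?ms_ge0 ?(ltW yb)//.
by rewrite !invrK ler_nat.
Qed.

Let measurable_G : measurable_fun setT G.
Proof.
apply: measurable_funM; last exact: measurable_mjac.
apply: measurable_funM.
  by apply: (measurableT_comp (measurable_sp _)); exact: measurable_ms.
have mh : measurable_fun setT h2.
  apply: continuous_measurable_fun => t; exact: derive_continuous (ch2 t).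
by apply: (measurableT_comp mh); exact: measurable_ms.
Qed.

Let G_integrable : nu.-integrable uball (EFin \o G).
Proof.
have mu' := @measurable_uball R n.
have mF j := integrable_measurable (F_integrable j).
have mono := @monotone_convergence _ E R nu uball mu' (fun j y => (F j y)%:E)
   (fun j => (measurable_EFinP _ _).2 (mF j)).
apply/integrableP; split.
  by apply/measurable_EFinP; exact: measurable_funTS measurable_G.
apply: (@le_lt_trans _ _ K%:E); last exact: ltry.
rewrite (_ : (\int[nu]_(y in uball) `|(EFin \o G) y| =
    \int[nu]_(y in uball) limn (fun j => (F j y)%:E))%E); last first.
  apply: eq_integral => y /[!inE] yb.
  have G0 : 0 <= G y.
    have /andP[j0 _] := mjac_bounds xb (ltW yb); have /andP[q0 _] := h2_itv (ms x y).
    by rewrite /G !mulr_ge0 ?sp_ge0// ltW.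
  apply/esym/cvg_lim => //; rewrite /= ger0_norm//.
  by apply/fine_cvgP; split; [exact: nearW|exact: F_cvg].
rewrite mono; last 2 first.
- by move=> j y yb; rewrite lee_fin; exact: F_ge0.
- by move=> y yb i j ij; rewrite lee_fin; exact: F_homo.
apply: lime_le.
  apply: ereal_nondecreasing_is_cvgn => i j ij; apply: ge0_le_integral => //.
  - by move=> y yb; rewrite lee_fin; exact: F_ge0.
  - exact/measurable_EFinP.
  - exact/measurable_EFinP.
  - by move=> y yb; rewrite lee_fin; exact: F_homo.
apply: nearW => j; have := F_mass j.
rewrite -lee_fin /Rintegral fineK//; exact: (integrable_fin_num _ (F_integrable j)).
Qed.

(** This power is the singularity of the Green function at x.  Its truncated
    integrals are bounded by [F_mass], uniformly in the truncation. *)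
Lemma sp_integrable : nu.-integrable uball (EFin \o (fun y => sp (n - 2) (ms x y))).
Proof.
have mu' := @measurable_uball R n.
have Ki : nu.-integrable (@uball R n) (EFin \o (fun _ : E => sp (n - 2) 2^-1 : R)).
  by apply: (@bounded_integrable_nu _ _ _ _ `|sp (n - 2) 2^-1 : R|).
pose c : R := ((1 - enorm x ^+ 2) / 4) ^+ n.
have c0 : 0 < c by rewrite exprn_gt0// divr_gt0.
apply: (@le_Rintegrable _ _ _ _ _ mu' _ (fun y => sp (n - 2) 2^-1 + c^-1 * G y)).
- by apply: measurable_funTS; apply: (measurableT_comp (measurable_sp _)); exact: measurable_ms.
- move=> y yb; have S0 := sp_ge0 (n - 2) (ms x y); rewrite ger0_norm//.
  have /andP[j0 _] := mjac_bounds xb (ltW yb); have {}j0 := ltW j0.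
  have /andP[q0 _] := h2_itv (ms x y).
  have [t2|t2] := leP (ms x y) 2^-1.
    rewrite -[leLHS]add0r; apply: lerD; first exact: sp_ge0.
    rewrite ler_pdivlMl// mulrC /G /h2 hstep_ge; last by lra.
    rewrite mulr1 ler_wpM2l//; have /andP[h _] := mratio_bounds xb (ltW yb).
    rewrite /c /mjac ler_pXn2r// nnegrE; first by rewrite divr_ge0// ltW.
    by apply: le_trans h; rewrite divr_ge0// ltW.
  rewrite -[leLHS]addr0; apply: lerD; first by apply: sp_le; exact: ltW.
  by rewrite !mulr_ge0 ?invr_ge0 ?(ltW c0).
- by apply: integrable_RD => //; exact: integrable_RZ.
Qed.

End kernel_integrability.

(** * Limit of the Green term and concentration at the pole *)

Section green_limit.
Context {R : realType} (m : nat).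
Local Notation n := m.+1.
Local Notation E := 'rV[R]_n.
Local Notation eps := (@eps R).
Hypothesis n3 : (3 <= n)%N.

Lemma compact_bounded_ball (f : E -> R) (r : R) : r < 1 ->
  (forall y, uball y -> {for y, continuous f}) ->
  exists K, forall y : E, enorm y ^+ 2 <= r -> `|f y| <= K.
Proof.
move=> r1 cf; pose A := [set y : E | enorm y ^+ 2 <= r].
have Ab : A `<=` uball.
  move=> y; rewrite /A /uball/= => yr; rewrite -(@ltr_pXn2r _ 2) ?nnegrE ?enorm_ge0//.
  by rewrite expr1n; exact: le_lt_trans r1.
have cA : compact A.
  apply: (subclosed_compact _ (@compact_box R n 1)).
    apply: (@preimage_closed _ _ (fun y : E => enorm y ^+ 2) [set t | t <= r]).
      by move=> y _; exact: continuous_enorm2.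
    exact: closed_le.
  by move=> y /Ab/uball_box.
have cfA : {within A, continuous f}.
  by apply: continuous_in_subspaceT => y; rewrite inE => /Ab/cf.
have [K [Kr hK]] := compact_bounded (continuous_compact cfA cA).
exists (`|K| + 1) => y yA; apply: (hK (`|K| + 1)); first by rewrite ltr_pwDr// ler_norm.
by exists y.
Qed.

Variable x : E.
Hypothesis xb : uball x.

Let a1 : 0 < 1 - enorm x ^+ 2. Proof. exact: uball_defect. Qed.

Variable psi : E -> R.
Hypothesis cpsi : forall y, uball y -> {for y, continuous psi}.
Hypothesis ipsi : nu.-integrable uball
  (EFin \o (fun y => (1 - enorm y ^+ 2) ^+ n.-1 * `|psi y| * tau_density y)).

Let D := @uball R n `\ x.

Let mD : measurable D.
Proof. by apply: measurableD; [exact: measurable_uball|exact: measurable_point]. Qed.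

Let f (j : nat) (y : E) := rad n (etaj j) (ms x y) * psi y * tau_density y.
Let f0 (y : E) := Gam n (ms x y) * psi y * tau_density y.

Let D_ms y : D y -> 0 < ms x y < 1.
Proof.
move=> [yb /= yx]; rewrite ms_lt1// lt0r ms_ge0 ?(ltW yb)// !andbT.
by apply: contra_notN yx => /eqP /(ms_eq0 xb yb).
Qed.

Let cf j y : uball y -> {for y, continuous (f j)}.
Proof.
move=> yb; apply: contM; last exact: continuous_tau.
apply: contM; last exact: cpsi.
apply: (@cont_comp _ _ (rad n (etaj j))); first exact: continuous_ms.
apply: derive_continuous (is_derive_rad _ (@etaj_cutoff R j) _).
by apply: lt_le_trans (ms_ge0 xb (ltW yb)); lra.
Qed.

Let fi j : nu.-integrable uball (EFin \o f j).
Proof.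
have e0 := @eps_gt0 R j.
apply: (@integrable_compact_support _ _ (1 - eps j * (1 - enorm x ^+ 2) / 4)).
- have : 0 < eps j * (1 - enorm x ^+ 2) by rewrite mulr_gt0.
  lra.
- move=> y yb h; rewrite /f (@rad_eq0 _ _ _ _ _ (1 - eps j) _ (@etaj_cutoff R j)) ?mul0r//.
  + by move=> s; exact: etaj_ge.
  + exact: ms_ge0 (ltW yb).
  + rewrite (ltW (ms_lt1 xb yb)) andbT; apply: ms_near1 => //.
    by rewrite subKr.
- by move=> y yb; exact: cf.
Qed.

(** For s >= 1/2 the weight (1 - |y|^2)^(n-1) of the hypothesis dominates; for
    s <= 1/2 the point y stays in a compact part of the ball, where psi is
    bounded by K. *)
Lemma green_dominated (y : E) (K : R) : uball y -> ms x y != 0 ->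
  (forall z : E, enorm z ^+ 2 <= 1 - (1 - enorm x ^+ 2) / 8 -> `|psi z| <= K) ->
  Gam n (ms x y) * `|psi y| * tau_density y <=
  sp (n - 2) 2^-1 * (4 / (1 - enorm x ^+ 2)) ^+ n.-1 *
    ((1 - enorm y ^+ 2) ^+ n.-1 * `|psi y| * tau_density y) +
  K * (8 / (1 - enorm x ^+ 2)) ^+ n * sp (n - 2) (ms x y).
Proof.
move=> yb s0 hK; have b0 := uball_defect yb.
have t0 : 0 <= tau_density y by rewrite invr_ge0 exprn_ge0// ltW.
have K0 : 0 <= K.
  apply: le_trans (hK 0 _); rewrite ?normr_ge0// enorm0 expr0n /=.
  by have := sqr_ge0 (enorm x); lra.
have sg0 : 0 < ms x y by rewrite lt0r s0 ms_ge0// ltW.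
have s1 := ms_lt1 xb yb.
have /andP[G0 GW] : 0 <= Gam n (ms x y) <= Gam_ub n (ms x y).
  by apply: Gam_le => //; rewrite sg0 ltW.
have S0 := sp_ge0 (n - 2) (ms x y).
have /andP[r0 r1] := mratio_bounds xb (ltW yb).
have m0 := mden_gt0 xb (ltW yb).
have rp : 0 <= (1 - enorm x ^+ 2) / mden x y by rewrite divr_ge0// ltW.
have se : 1 - ms x y = (1 - enorm x ^+ 2) / mden x y * (1 - enorm y ^+ 2).
  by rewrite ms_compl ?(ltW yb)// mulrAC.
have [t2|t2] := leP 2^-1 (ms x y).
  rewrite -[leLHS]addr0; apply: lerD; last first.
    by rewrite !mulr_ge0// exprn_ge0// divr_ge0// ltW.
  rewrite mulrA ler_wpM2r// mulrA ler_wpM2r//.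
  apply: (le_trans GW); rewrite /Gam_ub -mulrA; apply: ler_pM => //.
  - by rewrite exprn_ge0// subr_ge0 ltW.
  - exact: sp_le.
  have rhs0 : 0 <= 4 / (1 - enorm x ^+ 2) * (1 - enorm y ^+ 2).
    by rewrite mulr_ge0 ?(ltW b0)// divr_ge0// ltW.
  by rewrite -exprMn lerXn2r ?nnegrE ?subr_ge0 ?(ltW s1)// se ler_wpM2r// ltW.
rewrite -[leLHS]add0r; apply: lerD.
  rewrite !mulr_ge0 ?sp_ge0 ?exprn_ge0// ?(ltW b0)//.
  by rewrite divr_ge0// ltW.
have by8 : (1 - enorm x ^+ 2) / 8 <= 1 - enorm y ^+ 2.
  have h2 : 2^-1 <= 4 / (1 - enorm x ^+ 2) * (1 - enorm y ^+ 2).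
    apply: (@le_trans _ _ (1 - ms x y)); first by lra.
    by rewrite se ler_wpM2r// ltW.
  rewrite mulrAC ler_pdivlMr// in h2; lra.
have pK : `|psi y| <= K by apply: hK; lra.
have tb : tau_density y <= (8 / (1 - enorm x ^+ 2)) ^+ n.
  rewrite /tau_density -[8 / _]invf_div -exprVn ler_pXn2r// ?nnegrE ?invr_ge0 ?divr_ge0 ?(ltW b0) ?(ltW a1)//.
  by rewrite lef_pV2 ?posrE// divr_gt0.
have W1 : Gam_ub n (ms x y) <= sp (n - 2) (ms x y).
  rewrite /Gam_ub ler_piMr// exprn_ile1// ?subr_ge0 ?(ltW s1)//.
  by rewrite lerBlDr lerDl ltW.
apply: (@le_trans _ _ (sp (n - 2) (ms x y) * K * (8 / (1 - enorm x ^+ 2)) ^+ n)).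
  apply: ler_pM => //; first exact: mulr_ge0.
  by apply: ler_pM => //; exact: le_trans W1.
rewrite le_eqVlt; apply/orP; left; apply/eqP.
by move: (sp _ _) ((8 / _) ^+ n) => S T; ring.
Qed.

Let etaj_GamP j y : D y -> 0 <= rad n (etaj j) (ms x y) <= Gam n (ms x y).
Proof.
move=> /D_ms /andP[s0 s1].
have s01 : 0 < ms x y <= 1 by rewrite s0 ltW.
exact: (@rad_bounds R n _ _ _ _ (@etaj_cutoff R j) (@etaj_itv R j) s01).
Qed.

Let green_dct : nu.-integrable D (EFin \o f0) /\
  \int[nu]_(y in D) f j y @[j --> \oo] --> \int[nu]_(y in D) f0 y.
Proof.
have mu' := @measurable_uball R n.
have r1 : 1 - (1 - enorm x ^+ 2) / 8 < 1 by have := a1; lra.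
have [K hK] := compact_bounded_ball r1 cpsi.
have mf j : measurable_fun D (f j).
  by apply: (measurable_funS mu' _ (integrable_measurable (fi j))) => y [].
have fc y : D y -> f ^~ y @ \oo --> f0 y.
  move=> Dy; apply: cvgM; last exact: cvg_cst.
  apply: cvgM; last exact: cvg_cst.
  apply: (rad_cvg (@etaj_cutoff R)); [exact: etaj_itv|exact: etaj_cvg|exact: D_ms].
have := @Rdominated_convergence _ E R nu D f f0
  (fun y => sp (n - 2) 2^-1 * (4 / (1 - enorm x ^+ 2)) ^+ n.-1 *
    ((1 - enorm y ^+ 2) ^+ n.-1 * `|psi y| * tau_density y) +
    K * (8 / (1 - enorm x ^+ 2)) ^+ n * sp (n - 2) (ms x y)) mD mf.
apply => //.
- exact: measurable_fun_cvg mf fc.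
- move=> j y Dy; have [yb _] := Dy; have /andP[s0 s1] := D_ms Dy.
  have t0 : 0 <= tau_density y by rewrite invr_ge0 exprn_ge0// ltW// uball_defect.
  have /andP[g0 g1] := etaj_GamP j Dy.
  apply: le_trans (green_dominated yb (lt0r_neq0 s0) hK).
  by rewrite !normrM (ger0_norm g0) (ger0_norm t0) ler_wpM2r// ler_wpM2r.
- have DU : D `<=` uball by move=> y [].
  apply: integrable_RD => //; apply: integrable_RZ => //.
    exact: (integrableS mu' mD DU ipsi).
  exact: (integrableS mu' mD DU (sp_integrable n3 xb)).
Qed.

Lemma Gam_integrable : nu.-integrable (uball `\ x) (EFin \o f0).
Proof. exact: green_dct.1. Qed.

Theorem green_limit :
  \int[nu]_(y in uball) (rad n (etaj j) (ms x y) * psi y * tau_density y)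
    @[j --> \oo] --> \int[nu]_(y in uball `\ x) (Gam n (ms x y) * psi y * tau_density y).
Proof.
have [_] := green_dct; apply: cvg_trans; apply: near_eq_cvg; apply: nearW => j.
rewrite /Rintegral; congr fine; apply: esym.
apply: negligible_integral => //; last exact: nu_point.
- exact: measurable_point.
- exact: measurable_uball.
- exact: fi.
Qed.

(** Points are null sets, so the kernel may be computed off the diagonal. *)
Theorem green_integral_coord (i : 'I_n) (Psi : E -> E) :
  (forall y, uball y -> Psi y ord0 i = psi y) ->
  green_integral Psi x ord0 i =
  \int[nu]_(y in uball `\ x) (Gam n (ms x y) * psi y * tau_density y).
Proof.
move=> hP; rewrite mxE.
pose g y := green_kernel x y * Psi y ord0 i * tau_density y.
have gE y : D y -> g y = f0 y.
  by move=> [yb /= yx]; rewrite /g /f0 hP// green_kernelE// eq_sym; apply/eqP.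
have gi : nu.-integrable D (EFin \o g).
  apply: (@eq_integrable _ _ _ _ D mD (EFin \o f0)); last exact: Gam_integrable.
  by move=> y; rewrite inE => /gE /= ->.
have xU : x |` D = @uball R n.
  by rewrite /D setD1K.
have mg : measurable_fun (@uball R n) (EFin \o g).
  rewrite -xU; apply/measurable_funU => //; first exact: measurable_point.
  split; first exact: measurable_fun_set1.
  by have [] := integrableP _ _ _ gi.
have gU : nu.-integrable (@uball R n) (EFin \o g).
  apply/(negligible_integrable (measurable_point x) _ mg (nu_point x)) => //.
  exact: measurable_uball.
rewrite /Rintegral; congr fine.
rewrite (negligible_integral (measurable_point x) _ gU (nu_point x)); last exact: measurable_uball.
by apply: eq_integral => y; rewrite inE => /gE /= ->.
Qed.

End green_limit.

Section concentration.
Context {R : realType} (m : nat).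
Local Notation n := m.+1.
Local Notation E := 'rV[R]_n.
Local Notation eps := (@eps R).
Hypothesis n3 : (3 <= n)%N.
Variable x : E.
Hypothesis xb : uball x.

(** The sets where s is small form a neighbourhood basis at x, since
    |x - y|^2 = s [x, y]^2 <= 4 s. *)
Lemma ms_nbhs (P : set E) : nbhs x P ->
  exists2 e : R, 0 < e & forall y, uball y -> ms x y < e -> P y.
Proof.
move=> /nbhs_ballP[d d0 dP]; exists (d ^+ 2 / 4).
  by rewrite divr_gt0// exprn_gt0.
move=> y yb h; apply: dP; split => // i j; rewrite ord1 /ball/=.
have m0 := mden_gt0 xb (ltW yb).
have h2 : enorm (x - y) ^+ 2 < d ^+ 2.
  rewrite -mnumE -(divfK (lt0r_neq0 m0) (mnum x y)) -/(ms x y).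
  have := ms_ge0 xb (ltW yb); have := mden_ub xb (ltW yb).
  move=> B4 s0; apply: (@le_lt_trans _ _ (ms x y * 4)); first exact: ler_wpM2l.
  by rewrite -ltr_pdivlMr.
have := le_lt_trans (sqr_coord_le (x - y) j) h2.
rewrite !mxE -[X in X < _]real_normK ?num_real// ltr_pXn2r ?nnegrE ?(ltW d0)//.
Qed.

(** The counterpart of [outer] near s = 0. *)
Definition inner (g : E -> R) (j : nat) (y : E) : R :=
  2 / n%:R * (g y * (sp (n - 2) (ms x y) * kin j (ms x y) * mjac x y)).

Lemma inner_integrable g j : (forall y, uball y -> {for y, continuous g}) ->
  nu.-integrable uball (EFin \o inner g j).
Proof.
move=> cg; apply: integrable_RZ; first exact: measurable_uball.
apply: (@test_integrable _ _ _ xb (kin j) (eps j) (3 / 4)) => //.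
- exact: eps_gt0.
- by lra.
- exact: continuous_kin.
- by move=> t; exact: kin_le.
- by move=> t t3; apply: kin_ge; have := @eps_le R j; lra.
Qed.

Lemma inner_ge0 g j y : uball y -> 0 <= g y -> 0 <= inner g j y.
Proof.
move=> yb g0; have /andP[/ltW j0 _] := mjac_bounds xb (ltW yb).
have c0 : 0 <= 2 / n%:R :> R by rewrite divr_ge0.
exact: (mulr_ge0 c0 (mulr_ge0 g0 (mulr_ge0 (mulr_ge0 (sp_ge0 _ _) (kin_ge0 _ _)) j0))).
Qed.

(** The weights are nonnegative, of mass tending to c, and supported where
    s <= 2 eps, hence ever closer to x. *)
Theorem inner_concentration (g : E -> R) (c : R) :
  (forall y, uball y -> {for y, continuous g}) ->
  \int[nu]_(y in uball) inner (fun=> 1) j y @[j --> \oo] --> c ->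
  \int[nu]_(y in uball) inner g j y @[j --> \oo] --> c * g x.
Proof.
move=> cg hc.
have mu' := @measurable_uball R n.
have c1 y : uball y -> {for y, continuous (fun _ : E => 1 : R)} by move=> _; exact: cont_cst.
have cd y : uball y -> {for y, continuous (fun y : E => g y - g x)}.
  by move=> yb; apply: contB; [exact: cg|exact: cont_cst].
have split j : \int[nu]_(y in uball) inner g j y =
    \int[nu]_(y in uball) inner (fun=> 1) j y * g x +
    \int[nu]_(y in uball) inner (fun y => g y - g x) j y.
  rewrite mulrC -RintegralZl//; last exact: inner_integrable.
  rewrite -RintegralD//; last exact: inner_integrable.
    by apply: eq_Rintegral => y _; rewrite /inner; ring.
  by apply: integrable_RZ => //; exact: inner_integrable.
rewrite (funext split : (fun j => _) = _) -[c * g x]addr0.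
apply: cvgD; first by apply: cvgM => //; exact: cvg_cst.
apply/cvgr0Pnorm_le => e e0.
pose d := e / (`|c| + 1).
have d0 : 0 < d by rewrite divr_gt0// ltr_wpDl.
have [s s0 hs] : exists2 s : R, 0 < s & forall y, uball y -> ms x y < s -> `|g y - g x| <= d.
  apply: ms_nbhs; have := cg _ xb => /cvgrPdist_le /(_ _ d0).
  by apply: filterS => y; rewrite distrC.
near=> j.
have e2 : 2 * eps j < s.
  have : eps j < s / 2 by near: j; apply: (cvgr_lt _ (@eps_cvg0 R)); rewrite divr_gt0.
  lra.
have mass : \int[nu]_(y in uball) inner (fun=> 1) j y < `|c| + 1.
  near: j; apply: (cvgr_lt _ hc); by rewrite ltr_pwDr// ler_norm.
have ii := inner_integrable j cd.
apply: (le_trans (le_normr_Rintegral mu' ii)).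
apply: (@le_trans _ _ (\int[nu]_(y in uball) (d * inner (fun=> 1) j y))).
  apply: le_Rintegral => //.
  - have := integrable_norm ii; exact.
  - by apply: integrable_RZ => //; exact: inner_integrable.
  move=> y yb; have i0 := inner_ge0 j yb (ler01 : 0 <= (fun=> 1) y).
  have -> : inner (fun y => g y - g x) j y = (g y - g x) * inner (fun=> 1) j y.
    by rewrite /inner; ring.
  rewrite normrM (ger0_norm i0).
  have [sy|sy] := ltP (ms x y) s; first by rewrite ler_wpM2r// hs.
  rewrite /inner kin_ge; last by apply: le_trans sy; exact: ltW.
  by rewrite !(mulr0, mul0r).
rewrite RintegralZl//; last exact: inner_integrable.
rewrite /d mulrAC ler_pdivrMr; last by rewrite ltr_wpDl.
by rewrite ler_wpM2l// ltW.
Unshelve. all: by end_near. Qed.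

End concentration.

(** * The representation formula and the mass of the Poisson kernel *)

Section representation.
Context {R : realType} (m : nat).
Local Notation n := m.+1.
Local Notation E := 'rV[R]_n.
Local Notation eps := (@eps R).
Local Notation cball := [set y : E | enorm y <= 1].
Hypothesis n3 : (3 <= n)%N.

Lemma ball_cball : @uball R n `<=` cball.
Proof. by move=> y /ltW. Qed.

Lemma compact_cball : compact cball.
Proof.
apply: (subclosed_compact _ (@compact_box R n 1)).
  apply: (@preimage_closed _ _ (@enorm R n) [set t | t <= 1]).
    by move=> y _; exact: continuous_enorm.
  exact: closed_le.
move=> y /= y1 i; rewrite /= in_itv/= -ler_norml -(@ler_pXn2r _ 2) ?nnegrE//.
rewrite expr1n real_normK ?num_real// (le_trans (sqr_coord_le y i))//.
by rewrite expr_le1// enorm_ge0.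
Qed.

Lemma measurable_cball : measurable cball.
Proof.
rewrite (_ : cball = @enorm R n @^-1` `]-oo, 1]).
  by rewrite -[X in measurable X]setTI; exact: measurable_enorm.
by apply/seteqP; split => y; rewrite /= in_itv.
Qed.

Lemma measurable_pois (x : E) : measurable_fun setT (pois x).
Proof.
apply: measurable_funX; apply: measurable_funM => //.
by apply: (measurableT_comp (@measurable_invr R)); exact: measurable_mden.
Qed.

Lemma cball_bounded (u : E -> R) : {within cball, continuous u} ->
  exists2 M, 0 <= M & forall y, cball y -> `|u y| <= M.
Proof.
move=> cu; have [K [Kr hK]] := compact_bounded (continuous_compact cu compact_cball).
exists (`|K| + 1); first by rewrite addr_ge0.
move=> y yb; apply: (hK (`|K| + 1)); first by rewrite ltr_pwDr// ler_norm.
by exists y.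
Qed.

Variable x : E.
Hypothesis xb : uball x.

Let a1 : 0 < 1 - enorm x ^+ 2. Proof. exact: uball_defect. Qed.

Lemma pois_bounds y : enorm y <= 1 -> 0 <= pois x y <= (4 / (1 - enorm x ^+ 2)) ^+ n.-1.
Proof.
move=> y1; have /andP[h1 h2] := mratio_bounds xb y1.
have h0 : 0 <= (1 - enorm x ^+ 2) / mden x y.
  by apply: le_trans h1; rewrite divr_ge0// ltW.
by rewrite exprn_ge0//= lerXn2r// nnegrE (le_trans h0).
Qed.

Lemma pois_integrable (u : E -> R) : {within cball, continuous u} ->
  nu.-integrable pball (EFin \o (fun y => pois x (radial y) * u (radial y))).
Proof.
move=> cu; have [M M0 uM] := cball_bounded cu.
have rE (y : E) : pball y -> enorm (radial y) = 1 by move=> /andP[/enorm_radial].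
have mu : measurable_fun setT (u \_ cball).
  apply/(measurable_restrictT u measurable_cball).
  exact: within_continuous_measurable_rV measurable_cball cu.
have uE (y : E) : pball y -> u (radial y) = (u \_ cball) (radial y).
  by move=> /rE y1; rewrite /restrict mem_set//= y1.
apply: (@bounded_integrable_nu _ _ _ _ ((4 / (1 - enorm x ^+ 2)) ^+ n.-1 * M)).
- exact: measurable_pball.
- by move=> y /andP[].
- apply: (@eq_measurable_fun _ _ _ _ _ (fun y => pois x (radial y) * (u \_ cball) (radial y))).
    by move=> y; rewrite inE => /uE ->.
  apply: measurable_funTS; apply: measurable_funM.
    by apply: (measurableT_comp (measurable_pois x)); exact: measurable_radial.
  by apply: (measurableT_comp mu); exact: measurable_radial.
- move=> y /rE y1; have y1' : enorm (radial y) <= 1 by rewrite y1.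
  have /andP[p0 p1] := pois_bounds y1'.
  by rewrite normrM ger0_norm//; apply: ler_pM => //; exact: uM.
Qed.

Definition poisson_mass : R := \int[nu]_(y in pball) pois x (radial y).

Lemma outer_integrable g j : (forall y, uball y -> {for y, continuous g}) ->
  nu.-integrable uball (EFin \o outer x g j).
Proof.
move=> cg; have e0 := @eps_gt0 R j; have e4 := @eps_le R j.
rewrite (_ : outer x g j = fun y => 2 / n%:R *
    (g y * (sp (n - 2) (ms x y) * kout j (ms x y) * mjac x y))); last first.
  by apply/funext => y; rewrite /outer !mulrA.
apply: integrable_RZ; first exact: measurable_uball.
apply: (@test_integrable _ _ _ xb (kout j) 2^-1 (1 - eps j)) => //.
- by lra.
- exact: continuous_kout.
- by move=> t t2; apply: kout_le; lra.
- by move=> t; exact: kout_ge.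
Qed.

(** The test identity for [etaj], with the two bumps of its derivative separated. *)
Lemma split_identity (u : E -> R) (u1 u2 : 'I_n -> E -> R) j : C2_ball u u1 u2 ->
  \int[nu]_(y in uball) (rad n (etaj j) (ms x y) * hlap u1 u2 y * tau_density y) =
  \int[nu]_(y in uball) outer x u j y - \int[nu]_(y in uball) inner x u j y.
Proof.
move=> hu; have e0 := @eps_gt0 R j; have e4 := @eps_le R j.
have cu y : uball y -> {for y, continuous u}.
  by move=> yb; have [] := hu (ord0 : 'I_n) y yb.
have b1 : 1 - eps j < 1 by lra.
have e1 t : 1 - eps j <= t -> etaj j t = 0 /\ kj j t = 0.
  move=> te; rewrite etaj_ge// /kj kout_ge// kin_ge ?subrr//; lra.
have ek := @etaj_cutoff R j; have [_ _ ck k0] := ek.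
have mu' := @measurable_uball R n.
rewrite (test_identity n3 xb ek b1 e1 hu) -RintegralB//; last 2 first.
- exact: outer_integrable.
- exact: inner_integrable.
rewrite -RintegralZl//; last first.
  apply: (test_integrable xb e0 b1 ck _ _ cu) => t ht; [exact: (k0 _ ht).2|exact: (e1 _ ht).2].
by apply: eq_Rintegral => y _; rewrite /outer /inner /kj; ring.
Qed.

Lemma outer_mass : \int[nu]_(y in uball) outer x (fun=> 1) j y @[j --> \oo] --> poisson_mass.
Proof.
have -> : poisson_mass = \int[nu]_(y in pball) (pois x (radial y) * (fun=> 1) (radial y)).
  by apply: eq_Rintegral => y _; rewrite mulr1.
apply: (@outer_limit _ _ _ xb (fun=> 1) 1) => //.
  by move=> y; rewrite ler01 lexx.
by move=> xi _ r_ _ _; exact: cvg_cst.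
Qed.

(** For u = 1 the left-hand side of [split_identity] is zero. *)
Lemma inner_mass : \int[nu]_(y in uball) inner x (fun=> 1) j y @[j --> \oo] --> poisson_mass.
Proof.
rewrite (_ : (fun j => _) = (fun j => \int[nu]_(y in uball) outer x (fun=> 1) j y)).
  exact: outer_mass.
apply/funext => j; apply/eqP; rewrite eq_sym -subr_eq0.
rewrite -(split_identity j (C2_ball_cst 1)).
apply/eqP; transitivity (\int[nu]_(y in (@uball R n)) (0 : R)); last first.
  by rewrite Rintegral_cst ?mul0r//; exact: measurable_uball.
by apply: eq_Rintegral => y _; rewrite hlap_cst mulr0 mul0r.
Qed.

(** Adding a constant to u makes it nonnegative, as [outer_limit] requires. *)
Lemma outer_limit_cball (u : E -> R) : {within cball, continuous u} ->
  \int[nu]_(y in uball) outer x u j y @[j --> \oo] -->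
  \int[nu]_(y in pball) (pois x (radial y) * u (radial y)).
Proof.
move=> cu; have [M M0 uM] := cball_bounded cu.
have cub y : uball y -> {for y, continuous u}.
  move=> yb P /((subspace_continuousP _ _).1 cu _ (ball_cball yb)) hP.
  have hP' : \forall z \near y, cball z -> P (u z) by exact: hP.
  have hQ : \forall z \near y, P (u z).
    apply: filterS2 hP' (near_uball yb) => z h zb; exact: h (ball_cball zb).
  exact: hQ.
pose g := (fun y => u y + M) \_ cball.
have gE y : cball y -> g y = u y + M by move=> yb; rewrite /g /restrict mem_set.
have mg : measurable_fun setT g.
  apply/(measurable_restrictT _ measurable_cball); apply: measurable_funD => //.
  exact: within_continuous_measurable_rV measurable_cball cu.
have gM y : 0 <= g y <= M + M.
  rewrite /g /restrict; case: ifPn => [|_]; last by rewrite lexx addr_ge0.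
  rewrite inE => /uM; rewrite ler_norml => /andP[u0 u1].
  by apply/andP; split; lra.
have gr (xi : E) : enorm xi = 1 -> forall r_ : nat -> R,
    (forall j, 0 <= r_ j <= 1) -> r_ @ \oo --> (1 : R) ->
    g (r_ j *: xi) @[j --> \oo] --> g xi.
  move=> x1 r_ r01 rc.
  have xc : cball xi by rewrite /= x1.
  have rb j : cball (r_ j *: xi).
    by have /andP[r0 r1] := r01 j; rewrite /= enormZ x1 mulr1 ger0_norm.
  rewrite (gE _ xc) (_ : (fun j => _) = (fun j => u (r_ j *: xi) + M)); last first.
    by apply/funext => j; rewrite gE.
  apply: cvgD; last exact: cvg_cst.
  have yc : r_ j *: xi @[j --> \oo] --> xi.
    by rewrite -[X in _ --> X]scale1r; exact: cvgZr_tmp.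
  move=> P /((subspace_continuousP _ _).1 cu _ xc) hP.
  have hP' : \forall z \near xi, cball z -> P (u z) by exact: hP.
  have hQ : \forall j \near \oo, P (u (r_ j *: xi)).
    have yh : \forall j \near \oo, cball (r_ j *: xi) -> P (u (r_ j *: xi)) := yc _ hP'.
    by apply: filterS yh => j hj; exact: hj (rb j).
  exact: hQ.
have lg := outer_limit xb mg gM gr.
have mu' := @measurable_uball R n.
have c1 y : uball y -> {for y, continuous (fun _ : E => 1 : R)} by move=> _; exact: cont_cst.
have -> : (fun j => \int[nu]_(y in uball) outer x u j y) =
  (fun j => \int[nu]_(y in uball) outer x g j y - M * \int[nu]_(y in uball) outer x (fun=> 1) j y).
  apply/funext => j; apply/eqP; rewrite eq_sym subr_eq -RintegralZl//; last exact: outer_integrable.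
  rewrite -RintegralD//; last 2 first.
  - exact: outer_integrable.
  - by apply: integrable_RZ => //; exact: outer_integrable.
  apply/eqP; apply: eq_Rintegral => y /[!inE] /ball_cball yb.
  by rewrite /outer gE//; ring.
have cw1 : {within cball, continuous (fun _ : E => 1 : R)}.
  by apply: continuous_in_subspaceT => y _; exact: cont_cst.
have cuM : {within cball, continuous (fun y => u y + M)}.
  by move=> y; apply: cvgD; [exact: cu|exact: cvg_cst].
rewrite (_ : \int[nu]_(y in pball) _ =
   \int[nu]_(y in pball) (pois x (radial y) * g (radial y)) - M * poisson_mass).
  by apply: cvgB => //; apply: cvgM; [exact: cvg_cst|exact: outer_mass].
have ip1 := pois_integrable cw1; have ip := pois_integrable cu.
have cE : poisson_mass = \int[nu]_(y in pball) (pois x (radial y) * 1).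
  by apply: eq_Rintegral => y _; rewrite mulr1.
have mP := @measurable_pball R n.
apply/eqP; rewrite eq_sym subr_eq cE -RintegralZl// -RintegralD//; last exact: integrable_RZ.
apply/eqP; apply: eq_Rintegral => y /[!inE] /andP[y0 y1].
by rewrite gE/= ?enorm_radial//; ring.
Qed.

(** The limit of [split_identity] as the widths of the cutoffs tend to 0. *)
Theorem representation (u : E -> R) (u1 u2 : 'I_n -> E -> R) :
  C2_ball u u1 u2 -> {within cball, continuous u} ->
  nu.-integrable uball
    (EFin \o (fun y => (1 - enorm y ^+ 2) ^+ n.-1 * `|hlap u1 u2 y| * tau_density y)) ->
  poisson_mass * u x = \int[nu]_(y in pball) (pois x (radial y) * u (radial y)) -
    \int[nu]_(y in uball `\ x) (Gam n (ms x y) * hlap u1 u2 y * tau_density y).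
Proof.
move=> hu cu il.
have cu' y : uball y -> {for y, continuous u}.
  by move=> yb; have [] := hu (ord0 : 'I_n) y yb.
have cl y : uball y -> {for y, continuous (hlap u1 u2)}.
  by move=> yb; have [] := continuous_hlap (ltn0Sn m) hu yb.
have lim1 := green_limit n3 xb cl il.
have lim2 : \int[nu]_(y in uball) (rad n (etaj j) (ms x y) * hlap u1 u2 y * tau_density y)
    @[j --> \oo] --> \int[nu]_(y in pball) (pois x (radial y) * u (radial y)) - poisson_mass * u x.
  rewrite (funext (fun j => split_identity j hu) : (fun j => _) = _).
  apply: cvgB; first exact: outer_limit_cball.
  exact: inner_concentration cu' inner_mass.
have := cvg_unique _ lim1 lim2; rewrite /= => -> //.
by rewrite opprB addrC subrK.
Qed.

End representation.

Section total_mass.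
Context {R : realType} (m : nat).
Local Notation n := m.+1.
Local Notation E := 'rV[R]_n.
Local Notation eps := (@eps R).
Local Notation L := (@lebesgue_measure R).
Local Notation cball := [set y : E | enorm y <= 1].
Hypothesis n3 : (3 <= n)%N.

Lemma Gam_gt0 (t : R) : 0 < t < 1 -> 0 < Gam n t.
Proof.
move=> /andP[t0 t1]; pose t' := (1 + t) / 2.
have tt' : t < t' by rewrite /t'; lra.
have t'1 : t' < 1 by rewrite /t'; lra.
have gi := gam_integrable n t0.
have := @Rintegral_itvB R (gam n) (BLeft t) (BRight 1) t' gi.
rewrite !bnd_simp => /(_ (ltW tt') (ltW t'1)) /eqP; rewrite subr_eq addrC => /eqP.
rewrite -/(Gam n t) => ->.
pose c : R := (2 * n%:R)^-1 * (1 - t') ^+ (n - 2).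
have c0 : 0 < c by rewrite mulr_gt0 ?invr_gt0 ?exprn_gt0 ?mulr_gt0 ?subr_gt0.
apply: ltr_pwDl; last first.
  by apply: Rintegral_ge0 => s /=; rewrite in_itv/= => /andP[_ s1]; exact: gam_ge0.
apply: (@lt_le_trans _ _ (\int[L]_(s in `[t, t']) c)).
  rewrite Rintegral_cst; last exact: measurable_itv.
  have h : (@lebesgue_measure R) `[t, t']%classic = (t' - t)%:E.
    by rewrite lebesgue_measure_itv/= lte_fin tt' EFinB.
  rewrite mulr_gt0// (_ : fine _ = t' - t) ?subr_gt0//.
  exact: (congr1 fine h).
apply: le_Rintegral.
- exact: measurable_itv.
- apply: continuous_compact_integrable; first exact: segment_compact.
  by apply: continuous_subspaceT => s; exact: cvg_cst.
- apply: integrableS gi => //; apply: subset_itvl; rewrite bnd_simp; exact: ltW.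
- move=> s /=; rewrite in_itv/= => /andP[ts st'].
  have s0 : 0 < s by exact: lt_le_trans ts.
  rewrite /gam /c -[leLHS]mulr1; apply: ler_pM => //; first exact: ltW.
    rewrite ler_wpM2l ?invr_ge0 ?mulr_ge0// lerXn2r ?nnegrE; lra.
  rewrite /sp -[leLHS]invr1 lef_pV2 ?posrE ?exprn_gt0 ?sqrtr_gt0//.
  rewrite exprn_ile1 ?sqrtr_ge0// -sqrtr1 ler_wsqrtr//; lra.
Qed.

Lemma uball0 : uball (0 : E). Proof. by rewrite /uball/= enorm0. Qed.

Lemma ms_center0 y : ms (0 : E) y = enorm y ^+ 2.
Proof.
have d0 : dot (0 : E) y = 0 by rewrite /dot big1// => i _; rewrite mxE mul0r.
by rewrite /ms /mnum /mden d0 enorm0 expr0n/= mulr0 mul0r !subr0 add0r addr0 divr1.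
Qed.

Lemma ms_at0 x : ms x (0 : E) = enorm x ^+ 2.
Proof.
have d0 : dot x (0 : E) = 0 by rewrite /dot big1// => i _; rewrite mxE mulr0.
by rewrite /ms /mnum /mden d0 enorm0 expr0n/= !mulr0 !subr0 !addr0 divr1.
Qed.

Lemma poisson_mass0 : poisson_mass (0 : E) = 1.
Proof.
have e : poisson_mass (0 : E) = \int[nu]_(y in (@uball R n `\ 0)) (1 : R).
  rewrite /poisson_mass (_ : pball = @uball R n `\ 0); last first.
    apply/seteqP; split => y.
      by move=> /andP[y0 y1]; split => //= ye; move: y0; rewrite ye enorm0 ltxx.
    by move=> [y1 /= /eqP y0]; apply/andP; split; [exact: enorm_gt0|].
  apply: eq_Rintegral => y _; rewrite /pois.
  have d0 : dot (0 : E) (radial y) = 0 by rewrite /dot big1// => i _; rewrite mxE mul0r.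
  by rewrite /mden d0 enorm0 expr0n/= mulr0 mul0r !subr0 addr0 divr1 expr1n.
have i1 : nu.-integrable (@uball R n) (EFin \o (fun _ : E => 1 : R)).
  apply: (@bounded_integrable_nu _ _ _ _ 1) => //; first exact: measurable_uball.
  by move=> y _; rewrite normr1.
rewrite e; transitivity (\int[nu]_(y in @uball R n) (1 : R)).
  apply: esym; congr fine; apply: negligible_integral => //; [exact: measurable_point|
    exact: measurable_uball|exact: nu_point].
rewrite Rintegral_cst ?mul1r; last exact: measurable_uball.
exact: (congr1 fine (@nu_uball R n)).
Qed.

Let etad (j : nat) (t : R) : R := hstep ((eps j)^-1 * t).

Let etad_cutoff j : cutoff (etad j) (kin j) (eps j).
Proof.
have e0 := @eps_gt0 R j.
split; first exact: e0.
- move=> t; apply: is_derive_cong (is_derive_hstepZ _ t) _.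
  by rewrite /kin mulrC [_ * t]mulrC.
- exact: continuous_kin.
- move=> t te; split; last exact: kin_le.
  by apply: hstep_le; rewrite mulrC ler_pdivrMr// mul1r.
Qed.

Let etad_ge j s : 2 * eps j <= s -> etad j s = 1.
Proof. by move=> h; apply: hstep_ge; rewrite mulrC ler_pdivlMr ?(@eps_gt0 R). Qed.

Variable x : E.
Hypothesis xb : uball x.

(** The representation formula for the Green function with pole 0, truncated near
    0; the boundary term vanishes. *)
Lemma poisson_mass_Gam j : 2 * eps j <= enorm x ^+ 2 ->
  poisson_mass x * Gam n (enorm x ^+ 2) =
  \int[nu]_(y in uball `\ x) inner (0 : E) (fun y => Gam n (ms x y)) j y.
Proof.
move=> jx; have e0 := @eps_gt0 R j; have e4 := @eps_le R j.
have ek := etad_cutoff j; have b0 := uball0.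
pose u (y : E) := rad n (etad j) (ms 0 y).
pose u1 (i : 'I_n) (y : E) := rad1 n (etad j) (ms 0 y) * ms1 0 i y.
pose u2 (i : 'I_n) (y : E) := rad2 n (etad j) (kin j) (ms 0 y) * ms1 0 i y ^+ 2 +
  rad1 n (etad j) (ms 0 y) * ms2 0 i y.
have hu : C2_ball u u1 u2.
  apply: C2_ball_comp; first exact: b0.
  + by move=> t /andP[t0 _]; apply: (is_derive_rad _ ek); lra.
  + by move=> t _; exact: (is_derive_rad1 _ ek).
  + by move=> t _; exact: (continuous_rad2 ek).
have lE y : uball y -> hlap u1 u2 y =
    - (2 / n%:R) * (sp (n - 2) (ms 0 y) * (1 - ms 0 y) ^+ n * kin j (ms 0 y)).
  move=> yb; rewrite hlap_comp// (rad_lap n3 ek) ?mulNr//.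
  by rewrite ms_ge0 ?ms_lt1// ltW.
have cu : {within cball, continuous u}.
  apply: continuous_in_subspaceT => y; rewrite inE/= => y1.
  apply: (@cont_comp _ _ (rad n (etad j))).
    rewrite (funext ms_center0); exact: continuous_enorm2.
  apply: derive_continuous (is_derive_rad _ ek _).
  by apply: lt_le_trans (ms_ge0 b0 y1); lra.
have cl y : uball y -> {for y, continuous (hlap u1 u2)}.
  by move=> yb; have [] := continuous_hlap (ltn0Sn m) hu yb.
have il : nu.-integrable uball
    (EFin \o (fun y => (1 - enorm y ^+ 2) ^+ n.-1 * `|hlap u1 u2 y| * tau_density y)).
  apply: (@integrable_compact_support _ _ (2 * eps j)); first by lra.
    move=> y yb; rewrite -ms_center0 lE// => h.
    by rewrite kin_ge ?(mulr0, normr0, mul0r)// ltW.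
  move=> y yb; apply: contM; last exact: continuous_tau.
  apply: contM; last exact: (cvg_norm (cl y yb)).
  by apply: contX; exact: continuous_defect.
have := representation n3 xb hu cu il.
rewrite (_ : \int[nu]_(y in pball) _ = 0); last first.
  transitivity (\int[nu]_(y in (@pball R n)) (0 : R)); last first.
    by rewrite Rintegral_cst ?mul0r//; exact: measurable_pball.
  apply: eq_Rintegral => y /[!inE] /andP[y0 _].
  by rewrite /u ms_center0 enorm_radial// expr1n /rad subrr mulr0.
have x1 : enorm x ^+ 2 <= 1 by rewrite expr_le1 ?enorm_ge0// ltW.
rewrite {1}/u ms_center0 (rad_Gam _ ek (@etad_ge j)) ?sqr_ge0 ?jx//.
rewrite sub0r => ->; rewrite -mulN1r -RintegralZl//.
- apply: eq_Rintegral => y /[!inE] -[yb _].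
  by rewrite lE// /inner -mjacE//; ring.
- by apply: measurableD; [exact: measurable_uball|exact: measurable_point].
- exact: (Gam_integrable n3 xb cl il).
Qed.

(** The truncated functions of [poisson_mass_Gam] have Laplacians concentrating
    at 0, where y |-> Gam (s) takes the value Gam (|x|^2). *)
Theorem poisson_mass_eq1 : poisson_mass x = 1.
Proof.
have [->|x0] := eqVneq x 0; first exact: poisson_mass0.
have a0 : 0 < enorm x ^+ 2 by rewrite exprn_gt0// enorm_gt0.
have a1 : enorm x ^+ 2 < 1 by rewrite -subr_gt0 uball_defect.
have G0 : 0 < Gam n (enorm x ^+ 2) by apply: Gam_gt0; rewrite a0 a1.
have d0 : 0 < enorm x ^+ 2 / 4 by rewrite divr_gt0.
have [J J4] : exists J, 2 * eps J < enorm x ^+ 2 / 2.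
  near \oo => J; exists J.
  have : eps J < enorm x ^+ 2 / 4 by near: J; apply: (cvgr_lt _ (@eps_cvg0 R)).
  lra.
have ekJ := etad_cutoff J.
(* y |-> Gam (ms x y) is singular at x; g is smooth and equal to it near 0. *)
pose g (y : E) := rad n (etad J) (ms x y).
have cg y : uball y -> {for y, continuous g}.
  move=> yb; apply: (@cont_comp _ _ (rad n (etad J))); first exact: continuous_ms.
  apply: derive_continuous (is_derive_rad _ ekJ _).
  by apply: lt_le_trans (ms_ge0 xb (ltW yb)); lra.
have gE y : uball y -> 2 * eps J <= ms x y -> g y = Gam n (ms x y).
  move=> yb h; rewrite /g (rad_Gam _ ekJ (@etad_ge J))//; first exact: ms_ge0 (ltW yb).
  by rewrite h ltW// ms_lt1.
have [e e0 he] : exists2 e : R, 0 < e & forall y : E, uball y -> ms 0 y < e -> 2 * eps J <= ms x y.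
  apply: (ms_nbhs uball0).
  have := continuous_ms xb uball0; rewrite /prop_for /continuous_at ms_at0 => h.
  have ev : \forall y \near (0 : E), enorm x ^+ 2 / 2 < ms x y.
    by apply: (cvgr_gt _ h); lra.
  by apply: filterS ev => y yh; lra.
have lim1 := inner_concentration uball0 cg (inner_mass n3 uball0).
have lim2 : \int[nu]_(y in uball) inner (0 : E) g j y @[j --> \oo] -->
    poisson_mass x * Gam n (enorm x ^+ 2).
  apply: cvg_near_cst; near=> j.
  have h1 : eps j < enorm x ^+ 2 / 4 by near: j; apply: (cvgr_lt _ (@eps_cvg0 R)).
  have h2 : eps j < e / 2 by near: j; apply: (cvgr_lt _ (@eps_cvg0 R)); rewrite divr_gt0.
  rewrite (@poisson_mass_Gam j); last by lra.
  rewrite /Rintegral; congr fine.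
  rewrite (negligible_integral (measurable_point x) _ (inner_integrable uball0 j cg) (nu_point x)); last exact: measurable_uball.
  apply: eq_integral => y /[!inE] -[yb _] /=; congr _%:E.
  have [h|h] := ltP (ms 0 y) e; first by rewrite /inner gE// he.
  by rewrite /inner kin_ge ?(mulr0, mul0r)//; lra.
have : poisson_mass (0 : E) * g 0 = poisson_mass x * Gam n (enorm x ^+ 2).
  exact: (cvg_unique _ lim1 lim2).
rewrite poisson_mass0 mul1r gE ?ms_at0; [|exact: uball0|by lra].
move=> /esym/eqP; rewrite -subr_eq0 -[X in _ - X]mul1r -mulrBl mulf_eq0 (gt_eqF G0).
by rewrite orbF subr_eq0 => /eqP.
Unshelve. all: by end_near. Qed.

End total_mass.

(** * Components and boundary values *)

Section components.
Context {R : realType} (m : nat).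
Local Notation n := m.+1.
Local Notation E := 'rV[R]_n.
Local Notation eps := (@eps R).
Local Notation cball := [set y : E | enorm y <= 1].

(** The points (1 - eps) *: y approach y from inside. *)
Lemma cball_closure : cball `<=` closure (@uball R n).
Proof.
move=> y y1 P Py.
have c : (1 - eps j) *: y @[j --> \oo] --> y.
  rewrite -[X in _ --> X]scale1r; apply: cvgZr_tmp.
  by rewrite -[X in _ --> X]subr0; apply: cvgB; [exact: cvg_cst|exact: eps_cvg0].
have [j hj] : exists j, P ((1 - eps j) *: y).
  have h : \forall j \near \oo, P ((1 - eps j) *: y) := c _ Py.
  by near \oo => j; exists j; near: j.
exists ((1 - eps j) *: y); split => //.
have e0 := @eps_gt0 R j; have e4 := @eps_le R j.
rewrite /uball/= enormZ ger0_norm; last by lra.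
by have := enorm_ge0 y; move: y1; rewrite /= => ? ?; nra.
Unshelve. all: by end_near. Qed.

Lemma measurable_usphere : measurable (@usphere R n).
Proof.
rewrite (_ : usphere = @enorm R n @^-1` [set 1]) //.
by rewrite -[X in measurable X]setTI; exact: measurable_enorm.
Qed.

Lemma poisson_kernelE (x xi : E) : usphere xi -> poisson_kernel x xi = pois x xi.
Proof.
rewrite /usphere/= => x1; rewrite /poisson_kernel /pois mdenE x1 expr1n subrr mulr0 addr0.
have -> : xi - x = -1 *: (x - xi) by rewrite scaleN1r opprB.
by rewrite enormZ normrN1 mul1r.
Qed.

Lemma poisson_integral_coord (phi : E -> E) (v : E -> R) (x : E) (i : 'I_n) :
  uball x -> {within cball, continuous v} ->
  (forall xi, usphere xi -> v xi = phi xi ord0 i) ->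
  poisson_integral phi x ord0 i =
  \int[nu]_(y in pball) (pois x (radial y) * v (radial y)).
Proof.
move=> xb cv hv; rewrite mxE; have [M M0 vM] := cball_bounded cv.
have sc : @usphere R n `<=` cball by move=> y /= ->.
rewrite -(@Rintegral_sigma _ _ (fun xi => pois x xi * v xi)
  ((4 / (1 - enorm x ^+ 2)) ^+ n.-1 * M)).
- by apply: eq_Rintegral => xi /[!inE] xs; rewrite poisson_kernelE// hv.
- exact: measurable_usphere.
- apply: measurable_funM; first by apply: measurable_funTS; exact: measurable_pois.
  apply: (measurable_funS (@measurable_cball R m) sc).
  exact: within_continuous_measurable_rV (@measurable_cball R m) cv.
- move=> xi /sc xs; have /andP[p0 p1] := pois_bounds xb xs.
  by rewrite normrM ger0_norm//; apply: ler_pM => //; exact: vM.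
Qed.

(** Limits of row vectors are taken componentwise. *)
Lemma is_derive_component (f : E -> E) (y v : E) (i : 'I_n) : derivable f y v ->
  is_derive y v (fun z => f z ord0 i) ('D_v f y ord0 i).
Proof.
move=> df; have /derivable_mxP dfi := df; have := derive_mx df => ->.
by rewrite mxE; apply: DeriveDef; [exact: dfi|].
Qed.

Lemma continuous_component (f : E -> E) (y : E) (i : 'I_n) : {for y, continuous f} ->
  {for y, continuous (fun z => f z ord0 i)}.
Proof. by move=> cf; exact: (cvg_comp _ _ cf (@coord_continuous R _ _ ord0 i (f y))). Qed.

Lemma C2_ball_component (u : E -> E) (i : 'I_n) : Ck 2 uball u ->
  C2_ball (fun y => u y ord0 i) (fun k y => partial k u y ord0 i)
    (fun k y => partial k (partial k u) y ord0 i).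
Proof.
move=> [cu du] k y yb; have [dk [ck dkk]] := du k; have [dkk' [ckk _]] := dkk k.
split.
- exact/is_derive_component/dk.
- exact/is_derive_component/dkk'.
- exact/continuous_component/cu.
- exact/continuous_component/ck.
- exact/continuous_component/ckk.
Qed.

Lemma hyp_laplacian_component (u : E -> E) (i : 'I_n) y :
  hyp_laplacian u y ord0 i = hlap (fun k y => partial k u y ord0 i)
    (fun k y => partial k (partial k u) y ord0 i) y.
Proof.
rewrite /hyp_laplacian /laplacian /hlap !mxE !summxE.
by congr (_ + _ * _); apply: eq_bigr => k _; rewrite mxE.
Qed.

Lemma coord_le_enorm (y : E) i : `|y ord0 i| <= enorm y.
Proof.
by rewrite -(@ler_pXn2r _ 2) ?nnegrE ?enorm_ge0// real_normK ?num_real// sqr_coord_le.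
Qed.

Lemma weighted_integrable (psi : E -> E) (w : E -> R) (mu1 : R) (i : 'I_n) :
  (forall i, measurable_fun uball (fun y => psi y ord0 i)) ->
  (forall y, uball y -> w y = psi y ord0 i) ->
  (\int[nu]_(x in uball)
    ((1 - enorm x ^+ 2) ^+ n.-1 * enorm (psi x) * tau_density x)%:E <= mu1%:E)%E ->
  nu.-integrable uball
    (EFin \o (fun y => (1 - enorm y ^+ 2) ^+ n.-1 * `|w y| * tau_density y)).
Proof.
move=> mpsi wE hmu; have mu' := @measurable_uball R n.
have me2 : measurable_fun setT (fun y : E => 1 - enorm y ^+ 2).
  by apply: measurable_funB => //; apply: measurable_funX; exact: measurable_enorm.
have mt : measurable_fun setT (@tau_density R n).
  by apply: (measurableT_comp (@measurable_invr R)); exact: measurable_funX.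
have mw : measurable_fun uball w.
  by apply: (eq_measurable_fun (fun y => psi y ord0 i)) => // y; rewrite inE => /wE.
have mp : measurable_fun uball (fun y => enorm (psi y)).
  have ms : measurable_fun setT (@Num.sqrt R).
    by apply: continuous_measurable_fun; exact: sqrt_continuous.
  have m2 : measurable_fun uball (fun y => \sum_(k < n) psi y ord0 k ^+ 2).
    by apply: measurable_sum => k; exact: measurable_funX.
  exact: (measurableT_comp ms m2).
have mf (h : E -> R) : measurable_fun uball h -> measurable_fun uball
    (EFin \o (fun y => (1 - enorm y ^+ 2) ^+ n.-1 * h y * tau_density y)).
  move=> mh; apply/measurable_EFinP; apply: measurable_funM; last exact: measurable_funTS.
  by apply: measurable_funM => //; apply: measurable_funTS; exact: measurable_funX.
have pos (y : E) : uball y -> 0 <= (1 - enorm y ^+ 2) ^+ n.-1 /\ 0 <= tau_density y.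
  by move=> /uball_defect/ltW b0; rewrite /tau_density invr_ge0 !exprn_ge0.
apply/integrableP; split; first by apply: mf; exact: measurableT_comp.
apply: (@le_lt_trans _ _ mu1%:E); last exact: ltry.
apply: le_trans hmu; apply: ge0_le_integral => //.
- by apply: measurableT_comp => //; apply: mf; exact: measurableT_comp.
- exact: (mf (fun y => enorm (psi y))).
- move=> y yb; have [p0 t0] := pos y yb.
  rewrite /= lee_fin ger0_norm ?mulr_ge0// ler_wpM2r// ler_wpM2l// wE//.
  exact: coord_le_enorm.
Qed.

End components.

Theorem theorem1p1 (R : realType) (n : nat) (psi phi u : 'rV[R]_n -> 'rV[R]_n)
  (mu1 : R) :
  (3 <= n)%N ->
  Linfty nu uball psi ->
  Linfty sigma usphere phi ->
  Ck 2 uball u ->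
  {within closure uball, continuous u} ->
  (forall x, uball x -> hyp_laplacian u x = psi x) ->
  (forall xi, usphere xi -> u xi = phi xi) ->
  0 <= mu1 ->
  (\int[nu]_(x in uball)
    ((1 - enorm x ^+ 2) ^+ n.-1 * enorm (psi x) * tau_density x)%:E
      <= mu1%:E)%E ->
  forall x, uball x -> u x = poisson_integral phi x - green_integral psi x.
Proof.
case: n psi phi u => [|m] psi phi u // n3 [mpsi _] _ cu2 cu hpsi hphi _ hmu x xb.
apply/rowP => i; rewrite [RHS]mxE [X in _ + X]mxE.
pose w k y := partial k u y ord0 i.
pose w2 k y := partial k (partial k u) y ord0 i.
have hw := C2_ball_component i cu2.
have wE y : uball y -> hlap w w2 y = psi y ord0 i.
  by move=> yb; rewrite -hpsi// hyp_laplacian_component.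
have cui : {within [set y : 'rV[R]_m.+1 | enorm y <= 1], continuous (fun y => u y ord0 i)}.
  have cu' := continuous_subspaceW (@cball_closure R m) cu.
  by move=> y; exact: (cvg_comp _ _ (cu' y) (@coord_continuous R _ _ ord0 i (u y))).
have il := weighted_integrable mpsi wE hmu.
have cl y : uball y -> {for y, continuous (hlap w w2)}.
  by move=> yb; have [] := continuous_hlap (ltn0Sn m) hw yb.
have := representation n3 xb hw cui il; rewrite poisson_mass_eq1// mul1r => ->.
rewrite (green_integral_coord n3 xb cl il (i := i))//; last by move=> y /wE.
by rewrite (poisson_integral_coord (phi := phi) xb cui)// => xi /hphi ->.
Qed.
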